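(* Suppose that $A_\mu,B_\mu$ are complex solutions on Minkowski space-time $\mathbb{M}^4$ of the source-free Maxwell equation $\partial^\mu(\partial_\mu A_\nu-\partial_\nu A_\mu)=0$ (likewise for $B$), having compact support on every Cauchy surface or at least decaying sufficiently fast at infinity. For a Cauchy surface $\Sigma$, let $$\langle A|B\rangle_\Sigma=-i\int_\Sigma V(d^3x)\,n^\nu(x)\Bigl[A_\mu^*\partial_\nu B^\mu-A_\nu^*\partial_\mu B^\mu-(\partial_\nu A_\mu^* )B^\mu+(\partial^\mu A^*_\mu)B_\nu\Bigr].$$ The scalar product $\langle\cdot|\cdot\rangle_\Sigma$ is not positive definite, but (i) it is sesquilinear and Hermitian, $\langle B|A\rangle_\Sigma=\langle A|B\rangle_\Sigma^*$; (ii) it is independent of $\Sigma$, i.e., for any two Cauchy surfaces $\Sigma,\Sigma'$, $\langle A|B\rangle_{\Sigma'}=\langle A|B\rangle_\Sigma$; and (iii) it is invariant under gauge transformations $A_\mu\to A_\mu-\frac1{e_x}\partial_\mu\theta$, $B_\mu\to B_\mu-\frac1{e_x}\partial_\mu\zeta$.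
   Context: The metric is $\mathrm{diag}(1,-1,-1,-1)$, indices are raised and lowered with it, and the summation convention is used. $V(d^3x)$ is the Riemannian volume on the spacelike Cauchy surface $\Sigma$ and $n^\nu$ its future unit normal. $^*$ denotes complex conjugation. $e_x$ is a real nonzero constant (the electron charge). $\theta$ and $\zeta$ are scalar functions on $\mathbb{M}^4$. The fields are understood to be differentiable as often as needed.
   Formalization: In (iii) the gauge-transformed potentials are also required to have compact support on every Cauchy surface or decay fast enough; for arbitrary θ, ζ a boundary term can survive (A=B=0, ζ=t, θ≈-1/r). ''Sufficiently fast'' means A and ∂A are bounded by K/(1+|x|)^2. *)

(* Defs.v *)
From HB Require Import structures.
From mathcomp Require Import all_boot all_order all_algebra.
From mathcomp Require Export complex.
From mathcomp Require Export all_classical all_reals all_analysis.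
Set Implicit Arguments.
Unset Strict Implicit.
Unset Printing Implicit Defensive.
Import Order.TTheory GRing.Theory Num.Theory numFieldNormedType.Exports.
Local Open Scope classical_set_scope.
Local Open Scope ring_scope.
Local Open Scope complex_scope.

(* The index 0 : 'I_4 is time.  Fields are families of functions indexed by
   their lower Lorentz index. *)
Definition event {R : realType} (t : R) (x : 'rV[R]_3) : 'rV[R]_4 :=
  row_mx (t%:M : 'rV[R]_1) x.

Definition eta {R : realType} (mu nu : 'I_4) : R :=
  if mu == nu then (if mu == 0 then 1 else -1) else 0.

Definition mdot {R : realType} (u v : 'rV[R]_4) : R :=
  \sum_mu \sum_nu eta mu nu * u 0 mu * v 0 nu.

(* The inverse metric has the same components as the metric. *)
Definition raise {R : realType} (w : 'I_4 -> R[i]) (mu : 'I_4) : R[i] :=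
  \sum_nu (eta mu nu)%:C * w nu.

Fixpoint Ck {R : realType} {n : nat} (k : nat) (f : 'rV[R]_n -> R) : Prop :=
  continuous f /\
  if k is k'.+1 then
    forall i : 'I_n, (forall x, derivable f x (delta_mx 0 i)) /\
                     Ck k' (fun x => 'D_(delta_mx 0 i) f x)
  else True.

Definition CkC {R : realType} {n : nat} (k : nat) (f : 'rV[R]_n -> R[i]) : Prop :=
  Ck k (fun p => complex.Re (f p)) /\ Ck k (fun p => complex.Im (f p)).

Definition partial {R : realType} (mu : 'I_4) (f : 'rV[R]_4 -> R[i])
    (p : 'rV[R]_4) : R[i] :=
  'D_(delta_mx 0 mu) (fun q => complex.Re (f q)) p +i*
  'D_(delta_mx 0 mu) (fun q => complex.Im (f q)) p.

Definition partial_up {R : realType} (mu : 'I_4) (f : 'rV[R]_4 -> R[i])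
    (p : 'rV[R]_4) : R[i] :=
  raise (fun nu => partial nu f p) mu.

Definition field4 (R : realType) := 'I_4 -> 'rV[R]_4 -> R[i].

Definition maxwell_solution {R : realType} (A : field4 R) : Prop :=
  (forall mu, CkC 2 (A mu)) /\
  forall nu p,
    \sum_mu partial_up mu
       (fun q => partial mu (A nu) q - partial nu (A mu) q) p = 0.

Definition timelike_curve {R : realType} (gamma : R -> 'rV[R]_4) : Prop :=
  [/\ forall s, derivable gamma s 1,
      continuous ('D_1 gamma) &
      forall s, 0 < mdot ('D_1 gamma s) ('D_1 gamma s)].

(* Parametrizing by the whole real line is no restriction: every open
   parameter interval can be smoothly reparametrized to it. *)
Definition inextendible {R : realType} (gamma : R -> 'rV[R]_4) : Prop :=
  ~ (exists p : 'rV[R]_4, gamma s @[s --> +oo] --> p) /\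
  ~ (exists p : 'rV[R]_4, gamma s @[s --> -oo] --> p).

Definition cauchy_surface {R : realType} (S : set 'rV[R]_4) : Prop :=
  forall gamma, timelike_curve gamma -> inextendible gamma ->
    exists! s, S (gamma s).

(* Lines at rest are inextendible timelike curves, so a Cauchy surface is the
   graph of a unique function on space; [chart S] parametrizes it globally. *)
Definition height {R : realType} (S : set 'rV[R]_4) (x : 'rV[R]_3) : R :=
  get [set t | S (event t x)].

Definition chart {R : realType} (S : set 'rV[R]_4) (x : 'rV[R]_3) : 'rV[R]_4 :=
  event (height S x) x.

Definition tangent {R : realType} (S : set 'rV[R]_4) (x v : 'rV[R]_3) :
    'rV[R]_4 :=
  'D_v (chart S) x.

(* A graph with spacelike tangent spaces is a C^2 submanifold exactly when its
   height function is C^2. *)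
Definition spacelike_cauchy_surface {R : realType} (S : set 'rV[R]_4) : Prop :=
  [/\ cauchy_surface S,
      Ck 2 (height S) &
      forall x v, v != 0 -> mdot (tangent S x v) (tangent S x v) < 0].

Definition future_unit_normal {R : realType} (S : set 'rV[R]_4)
    (x : 'rV[R]_3) (n : 'rV[R]_4) : Prop :=
  [/\ mdot n n = 1, 0 < n 0 0 & forall v, mdot n (tangent S x v) = 0].

Definition normal {R : realType} (S : set 'rV[R]_4) (x : 'rV[R]_3) : 'rV[R]_4 :=
  get [set n | future_unit_normal S x n].

(* The Riemannian metric induced on a spacelike surface is minus the
   restriction of the Lorentzian metric. *)
Definition volume_density {R : realType} (S : set 'rV[R]_4) (x : 'rV[R]_3) : R :=
  Num.sqrt (\det (\matrix_(i < 3, j < 3)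
    - mdot (tangent S x (delta_mx 0 i)) (tangent S x (delta_mx 0 j)))).

Definition space_point {R : realType} (u : R * R * R) : 'rV[R]_3 :=
  \row_(i < 3) [:: u.1.1; u.1.2; u.2]`_i.

Definition space_integral {R : realType} (f : 'rV[R]_3 -> R) : R :=
  Rintegral ((@lebesgue_measure R \x @lebesgue_measure R)
               \x @lebesgue_measure R)%E setT (fun u => f (space_point u)).

(* \int_S V(d^3x) f, the integrand being given in the global chart. *)
Definition surface_integral {R : realType} (S : set 'rV[R]_4)
    (f : 'rV[R]_3 -> R[i]) : R[i] :=
  space_integral (fun x => complex.Re (f x) * volume_density S x) +i*
  space_integral (fun x => complex.Im (f x) * volume_density S x).

Definition current {R : realType} (A B : field4 R) (nu : 'I_4)
    (p : 'rV[R]_4) : R[i] :=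
  let Ac : field4 R := fun mu q => conjc (A mu q) in
  let Bup : field4 R := fun mu q => raise (fun rho => B rho q) mu in
  \sum_mu (Ac mu p * partial nu (Bup mu) p
           - Ac nu p * partial mu (Bup mu) p
           - partial nu (Ac mu) p * Bup mu p
           + partial_up mu (Ac mu) p * B nu p).

Definition scalar_product {R : realType} (S : set 'rV[R]_4) (A B : field4 R) :
    R[i] :=
  - 'i%C * surface_integral S (fun x =>
    \sum_nu (normal S x 0 nu)%:C * current A B nu (chart S x)).

Definition compact_on_cauchy_surfaces {R : realType} (A : field4 R) : Prop :=
  forall S, cauchy_surface S ->
    compact (closure (S `&` [set p | exists mu, A mu p != 0])).

(* Inverse-square decay of the potential and its first derivatives, uniformly
   in the region enclosed by S and S' (on S itself if S' = S).  It makes the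
   integrals converge absolutely and the boundary terms at infinity vanish. *)
Definition decays_between {R : realType} (S S' : set 'rV[R]_4) (A : field4 R) :
    Prop :=
  exists K : R, forall t x,
    Num.min (height S x) (height S' x) <= t <=
      Num.max (height S x) (height S' x) ->
    forall mu,
      `|A mu (event t x)| <= (K / (1 + `|x|) ^+ 2)%:C /\
      forall nu, `|partial nu (A mu) (event t x)| <= (K / (1 + `|x|) ^+ 2)%:C.

Definition falls_off {R : realType} (S S' : set 'rV[R]_4) (A : field4 R) : Prop :=
  compact_on_cauchy_surfaces A \/ decays_between S S' A.

Definition positive_definite_on {R : realType} (S : set 'rV[R]_4) : Prop :=
  forall A : field4 R, maxwell_solution A -> falls_off S S A ->
    (exists mu p, A mu p != 0) -> 0 < scalar_product S A A.

Definition lincomb {R : realType} (a : R[i]) (A : field4 R) (b : R[i])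
    (B : field4 R) : field4 R :=
  fun mu p => a * A mu p + b * B mu p.

Definition gauge {R : realType} (e : R) (theta : 'rV[R]_4 -> R[i])
    (A : field4 R) : field4 R :=
  fun mu p => A mu p - (e^-1)%:C * partial mu theta p.

(* Main.v *)
(* A Cauchy surface is the graph of a 1-Lipschitz height function h, and
   n V(d^3x) = (1, grad h) d^3x in the chart x |-> (h x, x), so <A|B> is made of
   fluxes of the current j(a, b) of the real and imaginary parts.  This current
   is bilinear and antisymmetric, whence (i), and every real field is isotropic,
   so that a real pure gauge field refutes positivity.  It is conserved for
   Maxwell solutions: when h is moved linearly to h', the rate of change of the
   flux is a divergence whose cut-off integral vanishes at infinity, whence (ii).
   For (iii), j(a, dz)_nu = d^mu G_mu_nu with
     G_mu_nu = a_mu d_nu z - a_nu d_mu z + (d_mu a_nu - d_nu a_mu) (z - c)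
   antisymmetric, so its flux is a divergence on the surface; taking for c the
   limit of z at spatial infinity gives G the decay needed to integrate it to 0.
   Finally, a field compactly supported on all Cauchy surfaces vanishes outside a
   bounded part of the region between two of them: otherwise one could draw a
   Cauchy surface through an unbounded sequence of points of its support. *)
Require Import Defs.
From HB Require Import structures.
From mathcomp Require Import all_boot all_order all_algebra.
From mathcomp Require Import complex all_classical all_reals all_analysis.
From mathcomp Require Import measurable_realfun.
From mathcomp Require Import ring lra.
Import Order.TTheory GRing.Theory Num.Theory numFieldNormedType.Exports.
Set Implicit Arguments.
Unset Strict Implicit.
Unset Printing Implicit Defensive.
Local Open Scope classical_set_scope.
Local Open Scope ring_scope.

(** * Calculus on row vectors *)

(** Everything is a count of powers of r = 1 + |x|. Fields and first derivatives are O(r^-2), so the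
    current is O(r^-4), which is integrable over space. Against a cutoff at radius n, the divergence
    of W leaves only W times the gradient of the cutoff, which is O(1/r) uniformly in n; hence W
    need only be O(r^-3). Two heights may differ by O(r), and moving one surface to the other
    produces a W of order r r^-4, which just suffices. In (iii) no decay of theta and zeta is
    assumed. Their gradients are O(r^-2) as multiples of differences of fields that fall off, so on
    the surface they tend to a constant with error O(1/r). Subtracting it makes G of order r^-3; any
    other constant would leave r^-2 only. Compact support on each surface separately says nothing
    uniform about the region between two of them. The surface drawn through an unbounded part of the
    support is only a Lipschitz graph. It is admissible because [compact_on_cauchy_surfaces] ranges
    over all Cauchy surfaces, smooth or not, but it has to be proved Cauchy. *)

Section continuous_real_functions.
Context {R : realType} {T : topologicalType}.
Implicit Types f g : T -> R.

Lemma continuous_add f g :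
  continuous f -> continuous g -> continuous (fun x => f x + g x).
Proof. by move=> cf cg x; apply: cvgD; [exact: cf|exact: cg]. Qed.

Lemma continuous_mul f g :
  continuous f -> continuous g -> continuous (fun x => f x * g x).
Proof. by move=> cf cg x; apply: cvgM; [exact: cf|exact: cg]. Qed.

Lemma continuous_opp f : continuous f -> continuous (fun x => - f x).
Proof. by move=> cf x; apply: cvgN; exact: cf. Qed.

Lemma continuous_sum (I : Type) (r : seq I) (F : I -> T -> R) :
  (forall i, continuous (F i)) -> continuous (fun x => \sum_(i <- r) F i x).
Proof.
move=> cF; elim: r => [|i r IH].
  by under eq_fun do rewrite big_nil; exact: cst_continuous.
by under eq_fun do rewrite big_cons; exact: continuous_add.
Qed.

End continuous_real_functions.

Section Ck.
Context {R : realType} {n : nat}.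
Implicit Types f g : 'rV[R]_n -> R.

Lemma Ck_continuous k f : Ck k f -> continuous f.
Proof. by case: k => [|k] []. Qed.

Lemma CkS_derivable k f i x : Ck k.+1 f -> derivable f x (delta_mx 0 i).
Proof. by move=> [_ /(_ i) []]. Qed.

Lemma CkS_derive k f i : Ck k.+1 f -> Ck k (fun x => 'D_(delta_mx 0 i) f x).
Proof. by move=> [_ /(_ i) []]. Qed.

Lemma CkW k f : Ck k.+1 f -> Ck k f.
Proof.
elim: k f => [f [cf _]|k IH f Cf]; first by [].
split; first exact: (Ck_continuous Cf).
by move=> i; split=> [x|]; [exact: CkS_derivable Cf|exact/IH/CkS_derive].
Qed.

Lemma Ck_cst k (c : R) : Ck k (fun _ : 'rV[R]_n => c).
Proof.
elim: k c => [|k IH] c; split=> //; try exact: cst_continuous.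
move=> i; split=> [x|]; first exact: derivable_cst.
by under eq_fun do rewrite derive_cst; exact: IH.
Qed.

Lemma CkD k f g : Ck k f -> Ck k g -> Ck k (fun x => f x + g x).
Proof.
elim: k f g => [|k IH] f g Cf Cg.
  by split=> //; exact: continuous_add (Ck_continuous Cf) (Ck_continuous Cg).
split=> [|i].
  exact: continuous_add (Ck_continuous Cf) (Ck_continuous Cg).
have df x : derivable f x (delta_mx 0 i) := CkS_derivable Cf.
have dg x : derivable g x (delta_mx 0 i) := CkS_derivable Cg.
split=> [x|]; first exact: derivableD.
under eq_fun do rewrite (deriveD (df _) (dg _)).
by apply: IH; exact: CkS_derive.
Qed.

Lemma CkM k f g : Ck k f -> Ck k g -> Ck k (fun x => f x * g x).
Proof.
elim: k f g => [|k IH] f g Cf Cg.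
  by split=> //; exact: continuous_mul (Ck_continuous Cf) (Ck_continuous Cg).
split=> [|i].
  exact: continuous_mul (Ck_continuous Cf) (Ck_continuous Cg).
have df x : derivable f x (delta_mx 0 i) := CkS_derivable Cf.
have dg x : derivable g x (delta_mx 0 i) := CkS_derivable Cg.
split=> [x|]; first exact: derivableM.
under eq_fun do rewrite (deriveM (df _) (dg _)).
rewrite (_ : (fun x => _) = fun x => f x * 'D_(delta_mx 0 i) g x +
  g x * 'D_(delta_mx 0 i) f x) //.
apply: CkD; apply: IH; [exact: CkW Cf|exact: CkS_derive Cg|
  exact: CkW Cg|exact: CkS_derive Cf].
Qed.

Lemma CkN k f : Ck k f -> Ck k (fun x => - f x).
Proof.
move=> Cf; under eq_fun do rewrite -mulN1r.
by apply: CkM => //; exact: Ck_cst.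
Qed.

Lemma CkB k f g : Ck k f -> Ck k g -> Ck k (fun x => f x - g x).
Proof. by move=> Cf Cg; apply: CkD => //; exact: CkN. Qed.

Lemma Ck_sum k (I : Type) (r : seq I) (P : pred I) (F : I -> 'rV[R]_n -> R) :
  (forall i, P i -> Ck k (F i)) -> Ck k (fun x => \sum_(i <- r | P i) F i x).
Proof.
move=> CF; elim: r => [|i r IH].
  by under eq_fun do rewrite big_nil; exact: Ck_cst.
under eq_fun do rewrite big_cons; have [Pi|//] := boolP (P i).
by apply: CkD => //; exact: CF.
Qed.

Lemma is_derive_coord (j : 'I_n) (x v : 'rV[R]_n) :
  is_derive x v (fun y : 'rV[R]_n => y 0 j) (v 0 j).
Proof.
have dc := differentiable_coord x 0 j.
split; first exact: diff_derivable.
rewrite deriveE //.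
have @f : {linear 'rV[R]_n -> R}.
  by exists (fun N : 'rV[R]_n => N 0 j); do 2![eexists]; do ?[constructor];
     rewrite ?mxE// => ? *; rewrite ?mxE//; move=> ?; rewrite !mxE.
by rewrite (_ : (fun _ => _) = f) // diff_lin //; exact: coord_continuous.
Qed.

Lemma Ck_coord k (j : 'I_n) : Ck k (fun x : 'rV[R]_n => x 0 j).
Proof.
case: k => [|k]; split=> //; try exact: coord_continuous.
move=> i; split=> [x|]; first by have [] := is_derive_coord j x (delta_mx 0 i).
under eq_fun => x do have [_ ->] := is_derive_coord j x (delta_mx 0 i).
exact: Ck_cst.
Qed.

End Ck.

(** * Directional derivatives: mean values, symmetry of mixed derivatives, chain rule *)

Section directional.
Context {R : realType} {V : normedModType R}.
Implicit Types (f : V -> R) (x v w : V).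

Lemma is_derive_line f x v (t : R) : derivable f (x + t *: v) v ->
  is_derive t 1 (fun s : R => f (x + s *: v)) ('D_v f (x + t *: v)).
Proof.
move=> df.
have e : (fun h : R => h^-1 *: (f (x + (h *: 1 + t) *: v) - f (x + t *: v))) =
    (fun h => h^-1 *: (f (h *: v + (x + t *: v)) - f (x + t *: v))).
  apply/funext => h; congr (_ *: (f _ - _)).
  by rewrite [h%:A]mulr1 scalerDl addrCA.
by split; rewrite /derivable /derive /= e.
Qed.

Lemma is_derive_translate f x v w : derivable f (x + w) v ->
  is_derive x v (fun y => f (y + w)) ('D_v f (x + w)).
Proof.
move=> df.
have e : (fun h : R => h^-1 *: (f (h *: v + x + w) - f (x + w))) =
    (fun h => h^-1 *: (f (h *: v + (x + w)) - f (x + w))).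
  by apply/funext => h; rewrite addrA.
by split; rewrite /derivable /derive /= e.
Qed.

Lemma mvt_line f x v (h : R) : (forall y, derivable f y v) ->
  exists c, `|c| <= `|h| /\ f (x + h *: v) - f x = h * 'D_v f (x + c *: v).
Proof.
move=> df; pose g (s : R) := f (x + s *: v).
have dg (t : R) : is_derive t 1 g ('D_v f (x + t *: v)) by exact: is_derive_line.
have cg (a b : R) : {within `[a, b], continuous g}.
  apply: derivable_within_continuous => t _; by have [] := dg t.
have g0 : g 0 = f x by rewrite /g scale0r addr0.
have [h0|h0] := leP 0 h.
- have [c cI e] := MVT_segment h0 (fun t _ => dg t) (cg _ _).
  exists c; move: cI; rewrite in_itv /= => /andP[c0 ch].
  by rewrite !ger0_norm //; split=> //; rewrite -g0 -/(g h) e subr0 mulrC.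
- have [c cI e] := MVT_segment (ltW h0) (fun t _ => dg t) (cg _ _).
  exists c; move: cI; rewrite in_itv /= => /andP[c0 ch].
  rewrite !ler0_norm ?(ltW h0) // lerN2; split=> //.
  by rewrite -g0 -/(g h) -opprB e sub0r mulrN opprK mulrC.
Qed.

(** Two mean value steps: the increment of f in the direction v is moved along u, and the resulting
    difference of ['D_u f] is then taken along v. The derivative is evaluated at a point of the
    parallelogram with sides of order h u and h v. *)
Lemma second_difference f x u v (h : R) :
  (forall y, derivable f y u) -> (forall y, derivable ('D_u f) y v) ->
  exists c d, [/\ `|c| <= `|h|, `|d| <= `|h| &
    f (x + h *: u + h *: v) - f (x + h *: u) - (f (x + h *: v) - f x) =
    h * h * 'D_v ('D_u f) (x + c *: u + d *: v)].
Proof.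
move=> du dvu.
pose g y := f (y + h *: v) - f y.
have dg y : is_derive y u g ('D_u f (y + h *: v) - 'D_u f y).
  apply: is_deriveB; last exact: derivableP.
  exact: is_derive_translate.
have [|c [ch e]] := @mvt_line g x u h; first by move=> y; have [] := dg y.
have [d [dh e']] := mvt_line (x + c *: u) h dvu.
exists c, d; split=> //.
have [_ Dg] := dg (x + c *: u).
move: e; rewrite Dg e' mulrA => <-.
by [].
Qed.

(** The second difference is symmetric in u and v, so the two mixed derivatives agree at two points,
    possibly different, that can be taken as close to x as desired; continuity at x concludes. *)
Lemma Schwarz f x u v :
  (forall y, derivable f y u) -> (forall y, derivable f y v) ->
  (forall y, derivable ('D_u f) y v) -> (forall y, derivable ('D_v f) y u) ->
  continuous ('D_v ('D_u f)) -> continuous ('D_u ('D_v f)) ->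
  'D_v ('D_u f) x = 'D_u ('D_v f) x.
Proof.
move=> du dv dvu duv cvu cuv; apply/eqP; rewrite -subr_eq0 -normr_le0.
apply/ler_addgt0Pl => e e0; rewrite addr0.
have e2 : 0 < e / 2 by rewrite divr_gt0.
have [d1 /= d10 H1] : nbhs_ball x [set y | `|'D_v ('D_u f) x - 'D_v ('D_u f) y| < e / 2].
  by apply/nbhs_ballP; have /cvgrPdist_lt /(_ _ e2) := cvu x.
have [d2 /= d20 H2] : nbhs_ball x [set y | `|'D_u ('D_v f) x - 'D_u ('D_v f) y| < e / 2].
  by apply/nbhs_ballP; have /cvgrPdist_lt /(_ _ e2) := cuv x.
(* The summand 1 makes s positive and strictly larger than |u| + |v|, and the factor 2 in h gives h
   s < m. Both parallelograms then lie in the balls where the mixed derivatives vary by less than e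
   / 2. *)
pose s := `|u| + `|v| + 1.
have s0 : 0 < s by rewrite /s ltr_wpDl // addr_ge0.
pose m := Num.min d1 d2.
have m0 : 0 < m by rewrite /m lt_min d10.
pose h := m / (2 * s).
have h0 : 0 < h by rewrite divr_gt0 // mulr_gt0.
have hs : h * s < m.
  by rewrite /h invfM mulrA divfK ?gt_eqF // ltr_pdivrMr // ltr_pMr // ltr1n.
have bnd (p q : V) (c d : R) : `|c| <= `|h| -> `|d| <= `|h| -> `|p| + `|q| < s ->
    `|x - (x + c *: p + d *: q)| < m.
  move=> ch dh pqs; apply: le_lt_trans hs.
  rewrite -addrA opprD addNKr normrN (le_trans (ler_normD _ _)) // !normrZ.
  rewrite (gtr0_norm h0) in ch dh.
  have : `|c| * `|p| + `|d| * `|q| <= h * `|p| + h * `|q|.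
    by apply: lerD; apply: ler_wpM2r.
  by move/le_trans; apply; rewrite -mulrDr ler_pM2l // ltW.
have [c1 [c2 [c1h c2h e1]]] := @second_difference f x u v h du dvu.
have [c3 [c4 [c3h c4h e3]]] := @second_difference f x v u h dv duv.
have hh : h * h != 0 by rewrite mulf_neq0 // gt_eqF.
have E : 'D_v ('D_u f) (x + c1 *: u + c2 *: v) = 'D_u ('D_v f) (x + c3 *: v + c4 *: u).
  move: e1 e3; move: ('D_v _ _) ('D_u _ _) => A B e1 e3.
  apply: (mulfI hh); rewrite -e1 -e3 (addrAC x (h *: v) (h *: u)).
  by move: (f _) (f _) (f _) (f _) => p q r t; ring.
have b1 : ball x d1 (x + c1 *: u + c2 *: v).
  rewrite -ball_normE /=; apply: lt_le_trans (bnd _ _ _ _ c1h c2h _) _.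
    by rewrite /s ltrDl.
  by rewrite /m ge_min lexx.
have b2 : ball x d2 (x + c3 *: v + c4 *: u).
  rewrite -ball_normE /=; apply: lt_le_trans (bnd _ _ _ _ c3h c4h _) _.
    by rewrite /s (addrC `|v|) ltrDl.
  by rewrite /m ge_min lexx orbT.
have {}H1 := H1 _ b1; have {}H2 := H2 _ b2.
rewrite /= in H1 H2; rewrite -E in H2.
rewrite (splitr e) -(subrKA ('D_v ('D_u f) (x + c1 *: u + c2 *: v))).
apply: (le_trans (ler_normD _ _)); apply: lerD; apply: ltW; first exact: H1.
by rewrite distrC; exact: H2.
Qed.

(** Since g is derivable only in the direction v, it is first restricted to the line through x;
    there derivable and differentiable coincide, and the chain rule for differentials applies. *)
Lemma is_derive_chain n (f : 'rV[R]_n -> R) (g : V -> 'rV[R]_n) x v :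
  differentiable f (g x) -> derivable g x v ->
  is_derive x v (f \o g) ('D_('D_v g x) f (g x)).
Proof.
move=> df dg.
have line0 (W : normedModType R) (k : V -> W) :
    (fun h : R => h^-1 *: (k ((h *: (1 : R) + 0 : R) *: v + x) - k (0 *: v + x))) =
    (fun h : R => h^-1 *: (k (h *: v + x) - k x)).
  by apply/funext => h; rewrite [h%:A]mulr1 addr0 scale0r add0r.
have /derivable1P dl := dg.
have Dl : 'D_1 (fun h : R => g (h *: v + x)) 0 = 'D_v g x.
  by rewrite /derive /= (line0 _ g).
have g0 : g (0 *: v + x) = g x by rewrite scale0r add0r.
have dfl : differentiable (f \o (fun h : R => g (h *: v + x))) 0.
  by apply: differentiable_comp; [exact/derivable1_diffP|rewrite g0].
split; first exact/derivable1P/derivable1_diffP.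
transitivity ('D_1 (f \o (fun h : R => g (h *: v + x))) 0).
  by rewrite /derive /= (line0 _ (f \o g)).
rewrite deriveE // diff_comp; last 2 first.
- exact/derivable1_diffP.
- by rewrite g0.
have dl' : differentiable (fun h : R => g (h *: v + x)) 0.
  exact/derivable1_diffP.
rewrite [LHS]/= g0 -(deriveE _ dl') Dl; exact/esym/deriveE.
Qed.

End directional.

(** * Continuous partial derivatives imply differentiability *)

Section C1_differentiable.
Context {R : realType} {n : nat}.
Implicit Types (f : 'rV[R]_n -> R) (x v : 'rV[R]_n).

Lemma ler_coord_norm x i : `|x 0 i| <= `|x|.
Proof.
rewrite [leRHS]/Num.Def.normr /= mx_normrE.
exact: (le_bigmax _ (fun ij => `|x ij.1 ij.2|) (0, i)).
Qed.

Lemma rV_norm_le x (c : R) : 0 <= c -> (forall i, `|x 0 i| <= c) -> `|x| <= c.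
Proof.
move=> c0 H; rewrite [leLHS]/Num.Def.normr /= mx_normrE.
by apply/bigmax_leP; split=> // -[i j] _ /=; rewrite (ord1 i).
Qed.

(** A staircase changes one coordinate at a time from x to x + d, with a mean value on each step. In
    the sup norm no point of the staircase is farther than |d| from x. *)
Lemma C1_first_order f x d : Ck 1 f -> exists y : 'I_n -> 'rV[R]_n,
  (forall k, `|y k - x| <= `|d|) /\
  f (x + d) - f x = \sum_k d 0 k * 'D_(delta_mx 0 k) f (y k).
Proof.
move=> Cf.
pose z (k : nat) : 'rV[R]_n := \row_j (if (j < k)%N then x 0 j + d 0 j else x 0 j).
have zS (k : 'I_n) : z k.+1 = z k + d 0 k *: delta_mx 0 k.
  apply/rowP => j; rewrite !mxE /= ltnS leq_eqVlt.
  have [->|jk] := eqVneq j k; first by rewrite eqxx ltnn mulr1.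
  by rewrite -val_eqE in jk; rewrite (negPf jk) mulr0 addr0.
have H (k : 'I_n) : exists y, `|y - x| <= `|d| /\
    f (z k.+1) - f (z k) = d 0 k * 'D_(delta_mx 0 k) f y.
  have [|c [cd e]] := @mvt_line R _ f (z k) (delta_mx 0 k) (d 0 k).
    by move=> y; exact: CkS_derivable Cf.
  exists (z k + c *: delta_mx 0 k); rewrite zS; split=> //.
  apply: rV_norm_le => // j; rewrite !mxE /=.
  case: eqVneq => [->|_]; rewrite ?ltnn ?mulr1 ?mulr0 ?addr0.
    by rewrite addrAC subrr add0r (le_trans cd) // ler_coord_norm.
  by case: ifP; rewrite ?subrr ?normr0 // addrAC subrr add0r ler_coord_norm.
have [y Hy] := choice H.
exists y; split=> [k|]; first by have [] := Hy k.
under eq_bigr => k _ do have [_ <-] := Hy k.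
rewrite -(big_mkord xpredT (fun k => f (z k.+1) - f (z k))) telescope_sumr //.
by congr (f _ - f _); apply/rowP => j; rewrite !mxE ?ltn_ord.
Qed.

Lemma C1_differentiable f x : Ck 1 f -> differentiable f x.
Proof.
move=> Cf.
pose F (d : 'rV[R]_n) : R := \sum_k d 0 k * 'D_(delta_mx 0 k) f x.
have linF : linear F.
  move=> a u v; rewrite /F /GRing.scale /= mulr_sumr -big_split.
  by apply: eq_bigr => k _; rewrite !mxE mulrDl mulrA.
pose Fm := GRing.isLinear.Build _ _ _ _ _ linF.
pose L : {linear _ -> _} := HB.pack F Fm.
have cL : continuous L.
  apply: continuous_sum => k; apply: continuous_mul; first exact: coord_continuous.
  exact: cst_continuous.
have key : f \o shift x = cst (f x) + L +o_ (0 : 'rV[R]_n) id.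
  apply/eqaddoP => e e0.
  (* The error e is shared among n coordinates; n + 1 keeps the denominator nonzero when n = 0. *)
  have en : 0 < e / n.+1%:R by rewrite divr_gt0.
  have : \forall y \near x, forall k : 'I_n,
      `|'D_(delta_mx 0 k) f x - 'D_(delta_mx 0 k) f y| < e / n.+1%:R.
    apply: (filter_forall (F := nbhs x)) => k.
    have /CkS_derive/Ck_continuous cf : Ck 1 f := Cf.
    by have /cvgrPdist_lt /(_ _ en) := cf k x.
  move=> /nbhs_ballP[r /= r0 H].
  near=> d.
  have dr : `|d| < r.
    by near: d; apply/nbhs_ballP; exists r => //= d; rewrite -ball_normE /= sub0r normrN.
  have [y [yx Y]] := C1_first_order x d Cf.
  have -> : (f \o shift x - (cst (f x) + L)) d =
      \sum_k d 0 k * ('D_(delta_mx 0 k) f (y k) - 'D_(delta_mx 0 k) f x).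
    under eq_bigr do rewrite mulrBr.
    by rewrite sumrB -Y !fctE /= opprD addrA (addrC d).
  rewrite (le_trans (ler_norm_sum _ _ _)) //.
  apply: (@le_trans _ _ (\sum_(k < n) `|d| * (e / n.+1%:R))).
    apply: ler_sum => k _; rewrite normrM ler_pM ?ler_coord_norm //.
    rewrite distrC ltW //; apply: H; rewrite -ball_normE /= distrC.
    exact: le_lt_trans (yx k) dr.
  rewrite sumr_const card_ord -[leLHS]mulr_natr -mulrA [leRHS]mulrC ler_wpM2l //.
  by rewrite -mulrA ger_pMr // mulrC ler_pdivrMr // mul1r ler_nat.
have dL := diff_unique cL key.
by apply/diff_locallyP; rewrite dL.
Unshelve. all: by end_near.
Qed.

Lemma derive_sum_coord f x v : Ck 1 f ->
  'D_v f x = \sum_k v 0 k * 'D_(delta_mx 0 k) f x.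
Proof.
move=> Cf; have df := C1_differentiable x Cf.
rewrite deriveE // {1}(row_sum_delta v) linear_sum.
by apply: eq_bigr => k _; rewrite linearZ /= deriveE.
Qed.

Lemma is_derive_comp (V : normedModType R) f (g : V -> 'rV[R]_n) (t v : V)
    (dg : 'I_n -> R) : Ck 1 f ->
  (forall k, is_derive t v (fun s => g s 0 k) (dg k)) ->
  is_derive t v (fun s => f (g s)) (\sum_k dg k * 'D_(delta_mx 0 k) f (g t)).
Proof.
move=> Cf Dg.
have dgt : derivable g t v.
  by apply/derivable_mxP => i j; rewrite (ord1 i); have [] := Dg j.
have := is_derive_chain (C1_differentiable (g t) Cf) dgt.
rewrite derive_sum_coord //.
under eq_bigr do rewrite derive_mx // mxE.
by under eq_bigr => k _ do have [_ ->] := Dg k.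
Qed.

Lemma partialC k f x i j : Ck k.+2 f ->
  'D_(delta_mx 0 i) ('D_(delta_mx 0 j) f) x =
  'D_(delta_mx 0 j) ('D_(delta_mx 0 i) f) x.
Proof.
move=> Cf; have C1f l := CkS_derive l Cf.
have C0f l m := Ck_continuous (CkS_derive m (C1f l)).
have a l y : derivable f y (delta_mx 0 l) := CkS_derivable Cf.
have b l m y : derivable ('D_(delta_mx 0 l) f) y (delta_mx 0 m) :=
  CkS_derivable (C1f l).
exact: (@Schwarz R _ f x (delta_mx 0 j) (delta_mx 0 i) (a j) (a i) (b j i)
  (b i j) (C0f j i) (C0f i j)).
Qed.

End C1_differentiable.

(** * Integration over space *)

Section measurability.
Context {R : realType}.

Lemma space_pointE (u : R * R * R) :
  [/\ space_point u 0 0 = u.1.1, space_point u 0 1 = u.1.2 &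
      space_point u 0 2%:R = u.2].
Proof. by rewrite /space_point !mxE. Qed.

(** Half-open cells of the grid of mesh 1 / (k + 1). Over all k and a they are countably many, and
    each point lies in arbitrarily small ones. *)
Let box (k : nat) (a : int) : set R :=
  [set s | a%:~R / k.+1%:R <= s < (a%:~R + 1) / k.+1%:R].

Let measurable_box k a : measurable (box k a).
Proof. by rewrite (_ : box k a = `[a%:~R / k.+1%:R, (a%:~R + 1) / k.+1%:R[%classic). Qed.

Let box_floor k s : box k (Num.floor (s * k.+1%:R)) s.
Proof.
rewrite /box /= ler_pdivrMr // ltr_pdivlMr // Num.Theory.floor_le /=.
by have := floorD1_gt (s * k.+1%:R); rewrite intrD.
Qed.

Let box_dist k a s t : box k a s -> box k a t -> `|s - t| < k.+1%:R^-1.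
Proof.
have aux (A B p q : R) : A <= p -> p < A + B -> A <= q -> q < A + B ->
    `|p - q| < B.
  by move=> *; rewrite ltr_distl; apply/andP; split; lra.
rewrite /box /= => /andP[s1 s2] /andP[t1 t2].
by rewrite mulrDl mul1r in s2 t2; exact: aux s1 s2 t1 t2.
Qed.

(** The measure lives on triples, with the product sigma-algebra. The preimage of an open set is the
    union of the countably many grid cubes that it contains, and each cube is a measurable
    rectangle. *)
Lemma measurable_space_preimage (U : set 'rV[R]_3) :
  open U -> measurable (@space_point R @^-1` U).
Proof.
move=> oU.
pose B (c : nat * int * int * int) : set (R * R * R) :=
  (box c.1.1.1 c.1.1.2 `*` box c.1.1.1 c.1.2) `*` box c.1.1.1 c.2.
pose F c := if `[< B c `<=` @space_point R @^-1` U >] then B c else set0.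
have -> : @space_point R @^-1` U = \bigcup_c F c.
  apply/seteqP; split=> [u Uu|u [c _]]; last first.
    by rewrite /F; case: asboolP => // + Bu; exact.
  have /nbhs_ballP[r /= r0 rU] : nbhs (space_point u) U by exact: open_nbhs_nbhs.
  pose k := Num.truncn r^-1.
  have kr : k.+1%:R^-1 < r.
    rewrite invf_plt ?posrE //.
    by have := truncnS_gt r^-1.
  pose fl (s : R) := Num.floor (s * k.+1%:R).
  exists (k, fl u.1.1, fl u.1.2, fl u.2) => //.
  have Bu : B (k, fl u.1.1, fl u.1.2, fl u.2) u by do !split; exact: box_floor.
  rewrite /F; case: asboolP => // -[] v [[/= v1 v2] v3].
  case: Bu => [[/= u1 u2] u3]; apply: rU.
  rewrite -ball_normE /=; apply: le_lt_trans kr.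
  apply: rV_norm_le => // i; rewrite ltW // !mxE.
  by case: i => [[|[|[|//]]] p] /=; [exact: box_dist u1 v1|exact: box_dist u2 v2|exact: box_dist u3 v3].
apply: countable_bigcupT_measurable => // c; rewrite /F; case: ifP => // _.
by do 2! (apply: measurableX => //).
Qed.

Lemma measurable_space_function (f : 'rV[R]_3 -> R) :
  continuous f -> measurable_fun setT (f \o @space_point R).
Proof.
move=> cf; apply: (measurability _ (RGenOpens.measurableE R)).
move=> _ [_ [a [b ->]] <-]; rewrite setTI comp_preimage.
apply: measurable_space_preimage; apply: open_comp; last exact: interval_open.
by move=> x _; exact: cf.
Qed.

End measurability.

(** * Integrable majorants *)

Section integrability.
Context {R : realType}.
Notation leb := (@lebesgue_measure R).

(** The exponent 4/3 exceeds 1, so this is integrable on the line; and three such factors, one for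
    each coordinate, dominate (1 + |x|)^-4 because every |x_i| is at most |x|. This reduces
    integrability over space to one dimension. *)
Definition decay (s : R) : R := ((1 + `|s|) `^ (4 / 3))^-1.

Lemma one_plus_norm_gt0 (s : R) : 0 < 1 + `|s|.
Proof. by rewrite ltr_pwDl. Qed.

Lemma decay_gt0 s : 0 < decay s.
Proof. by rewrite invr_gt0 powR_gt0 // one_plus_norm_gt0. Qed.

Lemma continuous_powR (a : R) (p : R) : 0 < a -> {for a, continuous (fun b => b `^ p)}.
Proof.
move=> a0; apply: differentiable_continuous; apply/derivable1_diffP.
by apply: derivable_powR; rewrite in_itv /= a0.
Qed.

Lemma continuous_decay : continuous decay.
Proof.
have c : continuous ((fun b : R => b `^ (4 / 3)) \o (fun s : R => 1 + `|s|)).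
  move=> s; apply: continuous_comp; last exact/continuous_powR/one_plus_norm_gt0.
  by apply: cvgD; [exact: cvg_cst|apply: cvg_norm; exact: cvg_id].
move=> s; apply: cvgV; last exact: c.
by rewrite gt_eqF // powR_gt0 // one_plus_norm_gt0.
Qed.

Lemma integrable_decay : leb.-integrable setT (EFin \o decay).
Proof.
apply/integrableP; split.
  apply/measurable_EFinP; apply: continuous_measurable_fun.
  exact: continuous_decay.
under eq_integral do rewrite /= ger0_norm ?(ltW (decay_gt0 _)) //.
rewrite ge0_symfun_integralT; [|by move=> s; exact/ltW/decay_gt0|
  exact: continuous_decay|by move=> s; rewrite /decay /= normrN].
rewrite -set_itvcy.
(* A primitive of (1 + s)^(-4/3) that tends to 0 at infinity. *)
pose F (s : R) : R := - 3 * (1 + s) `^ (- (1 / 3)).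
have dF (s : R) : 0 < 1 + s -> is_derive s 1 F ((1 + s) `^ (- (4 / 3))).
  move=> s0.
  have d1 : is_derive s 1 (fun t : R => 1 + t) 1.
    have := is_deriveD (is_derive_cst (1 : R) s 1) (is_derive_id s (1 : R)).
    by rewrite add0r.
  have := is_deriveZ (-3) (@is_derive1_comp R (@powR R ^~ (- (1 / 3))) _ _ _ _ (is_derive1_powR _ s0) d1).
  move/is_derive_eq; apply.
  rewrite /GRing.scale /= mulr1 mulrA (_ : - (1 / 3) - 1 = - (4 / 3)); last by lra.
  by rewrite (_ : -3 * - (1 / 3) = 1) ?mul1r //; lra.
suff -> : (\int[leb]_(x in `[0%R, +oo[) (decay x)%:E = 0%:E - (F 0)%:E)%E.
  by rewrite -EFinB -EFinM ltry.
apply: ge0_continuous_FTC2y.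
- by move=> x _; exact/ltW/decay_gt0.
- exact/continuous_subspaceT/continuous_decay.
- rewrite -[0](mulr0 (- 3)); apply: cvgM; first exact: cvg_cst.
  apply/cvgrPdist_le => e e0; near=> s.
  have s0 : 0 < 1 + s by rewrite ltr_pwDl // ltW //; near: s; exact: nbhs_pinfty_gt.
  rewrite sub0r normrN ger0_norm ?powR_ge0 // powRN invf_ple ?posrE ?powR_gt0 //.
  have -> : e^-1 = (e^-1 ^+ 3) `^ (1 / 3).
    rewrite -powR_mulrn ?invr_ge0 ?ltW // -powRrM (_ : 3 * (1 / 3) = 1); last by lra.
    by rewrite powRr1 // invr_ge0 ltW.
  have p13 : 0 <= 1 / 3 :> R by lra.
  apply: ge0_ler_powR => //; rewrite ?nnegrE ?exprn_ge0 ?invr_ge0 ?(ltW e0) ?(ltW s0) //.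
  rewrite -lerBlDl; near: s; apply: nbhs_pinfty_ge; exact: num_real.
- move=> x x0; have [] // := dF x; by rewrite addr_gt0.
- apply: cvg_at_right_filter; apply: differentiable_continuous.
  by apply/derivable1_diffP; have [] // := dF 0; rewrite addr0.
- move=> x; rewrite in_itv /= andbT => x0; rewrite derive1E.
  have [|_ ->] := dF x; first by rewrite addr_gt0.
  by rewrite powRN /decay gtr0_norm.
Unshelve. all: by end_near.
Qed.

Lemma integrable_prod d1 d2 (T1 : measurableType d1) (T2 : measurableType d2)
    (m1 : {sigma_finite_measure set T1 -> \bar R})
    (m2 : {sigma_finite_measure set T2 -> \bar R}) (f : T1 -> R) (g : T2 -> R) :
  m1.-integrable setT (EFin \o f) -> m2.-integrable setT (EFin \o g) ->
  (m1 \x m2)%E.-integrable setT (EFin \o (fun u => f u.1 * g u.2)).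
Proof.
move=> fi gi.
have mf : measurable_fun setT f by apply/measurable_EFinP; exact: measurable_int fi.
have mg : measurable_fun setT g by apply/measurable_EFinP; exact: measurable_int gi.
have mh : measurable_fun setT (fun u : T1 * T2 => f u.1 * g u.2).
  apply: measurable_funM; apply: measurableT_comp => //.
apply/integrable12ltyP; first exact/measurable_EFinP.
have /integrableP[_ gf] := gi; have /integrableP[_ ff] := fi.
have E (x : T1) : (\int[m2]_y `|(f x * g y)%:E| =
    (\int[m2]_y `|(g y)%:E|) * `|(f x)%:E|)%E.
  under eq_integral do rewrite EFinM abseM muleC.
  rewrite ge0_integralZr //.
  by apply: measurableT_comp => //; exact/measurable_EFinP.
under eq_integral do rewrite E.
rewrite ge0_integralZl //; last 2 first.
- by apply: measurableT_comp => //; exact/measurable_EFinP.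
- exact: integral_ge0.
by rewrite lte_mul_pinfty // ?integral_ge0 // ge0_fin_numE // integral_ge0.
Qed.

End integrability.

Section plane_measure.
Context (R : realType).
Notation leb := (@lebesgue_measure R).

(* The library's sigma-finiteness instance for [\x] is shadowed by the one for
   subprobability measures, hence this alias. *)
Definition plane_measure := (leb \x leb)%E.

HB.instance Definition _ := Measure.on plane_measure.

Lemma sigma_finite_plane_measure : sigma_finite setT plane_measure.
Proof.
pose I n : set R := `[- n%:R, n%:R]%classic.
have inI (s : R) n : `|s| <= n%:R -> I n s by rewrite ler_norml /I /= in_itv.
exists (fun n => I n `*` I n) => [|n].
  apply/esym; rewrite -subTset => -[s t] _.
  pose n := (Num.truncn (Num.max `|s| `|t|)).+1.
  have : Num.max `|s| `|t| <= n%:R by rewrite ltW // truncnS_gt.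
  by rewrite ge_max => /andP[sn tn]; exists n => //; split; exact: inI.
have mI : measurable (I n) by exact: measurable_itv.
split; first exact: measurableX.
by rewrite /plane_measure product_measure1E //= lebesgue_measure_itv; case: ifP => _;
  rewrite ?mule0 // -EFinB -EFinM ltry.
Qed.

HB.instance Definition _ :=
  Measure_isSigmaFinite.Build _ _ _ plane_measure sigma_finite_plane_measure.

End plane_measure.

Section space_integration.
Context {R : realType}.
Notation leb := (@lebesgue_measure R).
Notation space_measure := (@plane_measure R \x leb)%E.
Implicit Types f g : 'rV[R]_3 -> R.

Lemma space_integralE (f : 'rV[R]_3 -> R) :
  space_integral f = (\int[space_measure]_u f (space_point u))%R.
Proof. by []. Qed.

Definition space_integrable f :=
  space_measure.-integrable setT (EFin \o (f \o @space_point R)).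

Lemma norm_rV1_gt0 n (x : 'rV[R]_n) : 0 < 1 + `|x|.
Proof. by rewrite ltr_pwDl. Qed.

Lemma decay_rpow (s : R) : decay s ^+ 3 = ((1 + `|s|) ^+ 4)^-1.
Proof.
rewrite /decay exprVn; congr (_^-1); rewrite -powR_mulrn ?powR_ge0 // -powRrM.
by rewrite (_ : 4 / 3 * 3 = 4); [rewrite powR_mulrn ?ltW ?one_plus_norm_gt0|lra].
Qed.

Lemma decay_le (s : R) (r : R) : `|s| <= r -> decay r <= decay s.
Proof.
move=> sr; have r0 : 0 <= r by apply: le_trans sr.
rewrite /decay (ger0_norm r0) lef_pV2 ?posrE ?powR_gt0 ?ltr_pwDl //.
by rewrite ge0_ler_powR ?nnegrE ?addr_ge0 ?lerD2l //; lra.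
Qed.

Lemma inv_pow4_le_decay (x : 'rV[R]_3) :
  ((1 + `|x|) ^+ 4)^-1 <= decay (x 0 0) * decay (x 0 1) * decay (x 0 2%:R).
Proof.
have H i := decay_le (ler_coord_norm x i).
have d0 s := ltW (@decay_gt0 R s).
rewrite -[X in (1 + X)](ger0_norm (normr_ge0 x)) -decay_rpow exprS expr2 mulrA.
by apply: ler_pM; rewrite ?mulr_ge0 //; apply: ler_pM.
Qed.

Lemma integrable_decay3 :
  space_measure.-integrable setT
  (EFin \o (fun u : R * R * R => decay u.1.1 * decay u.1.2 * decay u.2)).
Proof.
have i1 := @integrable_decay R.
have i2 := integrable_prod i1 i1.
exact: (@integrable_prod R _ _ _ _ (@plane_measure R) leb _ _ i2 i1).
Qed.

Lemma space_integrable_bounded f K : continuous f ->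
  (forall x, `|f x| <= K / (1 + `|x|) ^+ 4) -> space_integrable f.
Proof.
move=> cf fK.
have K0 : 0 <= K.
  have := le_trans (normr_ge0 _) (fK 0).
  by rewrite normr0 addr0 expr1n divr1.
have i3 := integrableZl measurableT K integrable_decay3.
apply: le_integrable i3 => //.
  by apply/measurable_EFinP; exact: measurable_space_function.
move=> u _ /=; rewrite lee_fin; apply: (le_trans (fK _)).
have [e0 e1 e2] := space_pointE u.
have := inv_pow4_le_decay (space_point u); rewrite e0 e1 e2 => H.
have d0 s := ltW (@decay_gt0 R s).
rewrite ger0_norm ?mulr_ge0 //; exact: ler_wpM2l.
Qed.

Lemma space_integralD f g : space_integrable f -> space_integrable g ->
  space_integral (fun x => f x + g x) = space_integral f + space_integral g.
Proof. by move=> fi gi; rewrite !space_integralE (RintegralD _ fi gi). Qed.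

Lemma space_integralZ f (c : R) : space_integrable f ->
  space_integral (fun x => c * f x) = c * space_integral f.
Proof. by move=> fi; rewrite !space_integralE (RintegralZl _ _ fi). Qed.

Lemma space_integrableD f g : space_integrable f -> space_integrable g ->
  space_integrable (fun x => f x + g x).
Proof. by move=> fi gi; have := integrableD measurableT fi gi. Qed.

Lemma space_integrableZ f (c : R) : space_integrable f ->
  space_integrable (fun x => c * f x).
Proof. by move=> fi; have := integrableZl measurableT c fi. Qed.

Lemma space_integral_sum (I : Type) (r : seq I) (F : I -> 'rV[R]_3 -> R) :
  (forall i, space_integrable (F i)) ->
  space_integral (fun x => \sum_(i <- r) F i x) =
  \sum_(i <- r) space_integral (F i).
Proof.
move=> Fi; have i0 : space_integrable (fun=> 0).
  apply: (@space_integrable_bounded _ 0); first exact: cst_continuous.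
  by move=> x; rewrite normr0 mul0r.
have si s : space_integrable (fun x => \sum_(i <- s) F i x).
  elim: s => [|i s IH]; first by under eq_fun do rewrite big_nil.
  by under eq_fun do rewrite big_cons; exact: space_integrableD.
elim: r => [|i r IH].
  under eq_fun do rewrite big_nil; rewrite big_nil -[X in space_integral X]/(fun=> 0).
  transitivity (0 * space_integral (fun _ : 'rV[R]_3 => 0 : R)); last by rewrite mul0r.
  rewrite -(space_integralZ 0 i0).
  by congr space_integral; apply/funext => x; rewrite mul0r.
under eq_fun do rewrite big_cons.
by rewrite big_cons space_integralD // IH.
Qed.

Lemma ler_space_integral f g : space_integrable f -> space_integrable g ->
  (forall x, f x <= g x) -> space_integral f <= space_integral g.
Proof.
by move=> fi gi fg; rewrite !space_integralE; apply: le_Rintegral => // x _; exact: fg.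
Qed.

Lemma space_integral_cvg (F : nat -> 'rV[R]_3 -> R) f K :
  (forall n, continuous (F n)) -> continuous f ->
  (forall n x, `|F n x| <= K / (1 + `|x|) ^+ 4) ->
  (forall x, F n x @[n --> \oo] --> f x) ->
  space_integral (F n) @[n --> \oo] --> space_integral f.
Proof.
move=> cF cf FK Ff.
have K0 : 0 <= K.
  have := le_trans (normr_ge0 _) (FK 0%N 0).
  by rewrite normr0 addr0 expr1n divr1.
have d0 s := ltW (@decay_gt0 R s).
have fi : space_integrable f.
  apply: (@space_integrable_bounded _ K) => // x.
  have h : `|F n x| @[n --> \oo] --> `|f x| by apply: cvg_norm; exact: Ff.
   rewrite -(cvg_lim _ h) //.
  by apply: limr_le; [exact: cvgP h|apply: nearW => n; exact: FK].
have := @dominated_convergence _ _ R space_measure setT measurableT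
  (fun n => EFin \o (F n \o @space_point R)) (EFin \o (f \o @space_point R))
  (fun u : R * R * R => K%:E * (decay u.1.1 * decay u.1.2 * decay u.2)%:E)%E.
case.
- by move=> n; apply/measurable_EFinP; exact: measurable_space_function.
- by apply/measurable_EFinP; exact: measurable_space_function.
- by apply: aeW => u _; apply: cvg_EFin; [near=> n|exact: Ff].
- have i3 := integrableZl measurableT K integrable_decay3.
  by apply: eq_integrable i3.
- apply: aeW => u n _ /=; rewrite lee_fin; apply: (le_trans (FK _ _)).
  have [e0 e1 e2] := space_pointE u.
  by have := inv_pow4_le_decay (space_point u); rewrite e0 e1 e2 => H; exact: ler_wpM2l.
move=> _ _ H; rewrite !space_integralE /Rintegral.
apply: fine_cvg; rewrite fineK //.
exact: integrable_fin_num.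
Unshelve. all: by end_near.
Qed.

Lemma continuous_bounded_ball n (f : 'rV[R]_n -> R) (r : R) : continuous f ->
  exists2 M, 0 <= M & forall x, `|x| <= r -> `|f x| <= M.
Proof.
move=> cf.
have cB : compact [set x : 'rV[R]_n | `|x| <= r].
  apply: bounded_closed_compact.
    by exists r; split; [exact: num_real|move=> M rM x /= xr; rewrite (le_trans xr) // ltW].
  rewrite (_ : mkset _ = (fun x : 'rV[R]_n => `|x|) @^-1` [set t | t <= r]) //.
  by apply: closed_comp; [move=> x _; exact: norm_continuous|exact: closed_le].
have := @continuous_compact _ _ f _ (continuous_subspaceT cf) cB.
move=> /compact_bounded[M [_ H]].
exists (`|M| + 1); first by rewrite addr_ge0.
move=> x xr; apply: (H (`|M| + 1)); last by exists x.
by rewrite (le_lt_trans (ler_norm M)) // ltrDl.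
Qed.

(** Puts functions of compact support into the form (1 + |x|)^-4 required by the integration
    lemmas. *)
Lemma compact_support_bound f (r : R) : continuous f ->
  (forall x, r < `|x| -> f x = 0) ->
  exists2 K, 0 <= K & forall x, `|f x| <= K / (1 + `|x|) ^+ 4.
Proof.
move=> cf f0; have [M M0 fM] := continuous_bounded_ball r cf.
exists (M * (1 + `|r|) ^+ 4).
  by rewrite mulr_ge0 // exprn_ge0 // addr_ge0.
move=> x; have p0 : 0 < (1 + `|x|) ^+ 4 by rewrite exprn_gt0 // norm_rV1_gt0.
have [xr|xr] := leP `|x| r; last first.
  by rewrite f0 // normr0 divr_ge0 ?(ltW p0) // mulr_ge0 // exprn_ge0 // addr_ge0.
rewrite ler_pdivlMr //; apply: ler_pM => //; rewrite ?(ltW p0) //; first exact: fM.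
rewrite lerXn2r ?nnegrE ?addr_ge0 // lerD2l (le_trans xr) //; exact: ler_norm.
Qed.

Lemma integral_derive_compact_support (g dg : R -> R) (r : R) : 0 < r ->
  (forall s : R, is_derive s 1 g (dg s)) -> continuous dg ->
  (forall s, r <= `|s| -> g s = 0) -> (forall s, r < `|s| -> dg s = 0) ->
  (\int[leb]_s (dg s)%:E = 0)%E.
Proof.
move=> r0 Dg cdg g0 dg0.
have rr : - r < r by rewrite -subr_gt0 opprK addr_gt0.
have cg : continuous g.
  by move=> s; apply: differentiable_continuous; apply/derivable1_diffP; have [] := Dg s.
transitivity (\int[leb]_(s in `[(- r)%R, r]) (dg s)%:E)%E.
  rewrite [RHS]integral_mkcond; apply: eq_integral => s _.
  rewrite patchE; case: ifPn => //; rewrite notin_setE /= in_itv /= => /negP sr.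
  by rewrite dg0 // ltNge ler_norml.
rewrite (@continuous_FTC2 _ dg g) //.
- by rewrite !g0 ?normrN ?gtr0_norm // subee.
- exact: continuous_subspaceT.
- split=> [s _||].
  + by have [] := Dg s.
  + by apply: cvg_at_right_filter; exact: cg.
  + by apply: cvg_at_left_filter; exact: cg.
- by move=> s _; rewrite derive1E; have [_ ->] := Dg s.
Qed.

End space_integration.

(** * The divergence theorem without boundary terms *)

Lemma continuous_compose (T U V : topologicalType) (g : T -> U) (f : U -> V) :
  continuous g -> continuous f -> continuous (fun x => f (g x)).
Proof.
by move=> cg cf x; apply: (@continuous_comp _ _ _ g f); [exact: cg|exact: cf].
Qed.

Lemma continuous_inv (R : realType) (T : topologicalType) (f : T -> R) :
  continuous f -> (forall x, f x != 0) -> continuous (fun x => (f x)^-1).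
Proof. by move=> cf f0 x; apply: cvgV; [exact: f0|exact: cf]. Qed.

Lemma continuous_expn (R : realType) (T : topologicalType) (f : T -> R) k :
  continuous f -> continuous (fun x => f x ^+ k).
Proof.
move=> cf; elim: k => [|k IH].
  by under eq_fun do rewrite expr0; exact: cst_continuous.
by under eq_fun do rewrite exprS; exact: continuous_mul.
Qed.

Lemma partialM (R : realType) n (f g : 'rV[R]_n -> R) i x : Ck 1 f -> Ck 1 g ->
  'D_(delta_mx 0 i) (fun y => f y * g y) x =
  'D_(delta_mx 0 i) f x * g x + f x * 'D_(delta_mx 0 i) g x.
Proof.
move=> Cf Cg.
have df : derivable f x (delta_mx 0 i) := CkS_derivable Cf.
have dg : derivable g x (delta_mx 0 i) := CkS_derivable Cg.
by rewrite (deriveM df dg) /GRing.scale /= addrC [g x * _]mulrC.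
Qed.

Lemma norm_gt_coord (R : realType) n (y : 'rV[R]_n) r : 0 <= r -> r < `|y| ->
  exists j, r <= `|y 0 j|.
Proof.
move=> r0 ry; apply: contrapT => H; move: ry; apply/negP; rewrite -leNgt.
apply: rV_norm_le => // j.
by rewrite leNgt; apply/negP => yj; apply: H; exists j; exact: ltW.
Qed.

Lemma derive_near0 (R : realType) (V : normedModType R) (f : V -> R) x v :
  (\forall y \near x, f y = 0) -> 'D_v f x = 0.
Proof.
move=> f0; have [->|v0] := eqVneq v 0; first by rewrite derive0.
by rewrite (@near_eq_derive _ _ _ f (cst 0)) // derive_cst.
Qed.

Section divergence.
Context {R : realType}.
Notation leb := (@lebesgue_measure R).
Notation space_measure := (@plane_measure R \x leb)%E.
Notation "''e_' i" := (delta_mx 0 i) (format "''e_' i").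
Implicit Types f g : 'rV[R]_3 -> R.

(** Fubini alone gives integrability of almost every slice. The pointwise bound gives it for all of
    them, which the second application of Fubini uses. *)
Lemma plane_integrable_slice f K z : continuous f ->
  (forall x, `|f x| <= K / (1 + `|x|) ^+ 4) ->
  (@plane_measure R).-integrable setT (fun v => (f (space_point (v, z)))%:E).
Proof.
move=> cf fK.
have K0 : 0 <= K.
  have := le_trans (normr_ge0 _) (fK 0).
  by rewrite normr0 addr0 expr1n divr1.
have i1 := @integrable_decay R.
have i2 : (@plane_measure R).-integrable setT _ := integrable_prod i1 i1.
have i3 := integrableZl measurableT (K * decay z) i2.
apply: le_integrable i3 => //.
  apply/measurable_EFinP.
  apply: (measurable_fun_pair1 (f := f \o @space_point R)).
  exact: measurable_space_function.
move=> v _ /=; rewrite lee_fin; apply: (le_trans (fK _)).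
have [e0 e1 e2] := space_pointE (v, z).
have := inv_pow4_le_decay (space_point (v, z)); rewrite e0 e1 e2 /= => H.
have d0 s := ltW (@decay_gt0 R s).
rewrite ger0_norm ?mulr_ge0 // -mulrA; apply: ler_wpM2l => //.
by rewrite mulrC in H *.
Qed.

Lemma space_point_line (a b s : R) :
  [/\ space_point (s, a, b) = space_point (0, a, b) + s *: 'e_0,
      space_point (a, s, b) = space_point (a, 0, b) + s *: 'e_1 &
      space_point (a, b, s) = space_point (a, b, 0) + s *: 'e_(2%:R)].
Proof.
by split; apply/rowP => -[[|[|[|//]]] p]; rewrite !mxE /= ?mulr0 ?mulr1 ?addr0 ?add0r.
Qed.

Lemma integral_slice0 (V : 'rV[R]_3 -> R) (c : R -> 'rV[R]_3) (i : 'I_3) (r : R) :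
  0 < r -> Ck 1 V -> (forall (x : 'rV[R]_3) j, r <= `|x 0 j| -> V x = 0) ->
  (forall s, c s = c 0 + s *: 'e_i) -> (forall s, c s 0 i = s) ->
  (\int[leb]_s ('D_('e_i) V (c s))%:E = 0)%E.
Proof.
move=> r0 CV V0 cE ci.
have -> : c = (fun s => c 0 + s *: 'e_i) by apply/funext.
have cl : continuous (fun s : R => c 0 + s *: 'e_i : 'rV[R]_3).
  by move=> s; apply: cvgD; [exact: cvg_cst|exact: scalel_continuous].
have cdl := continuous_compose cl (Ck_continuous (CkS_derive i CV)).
apply: (@integral_derive_compact_support R (fun s => V (c 0 + s *: 'e_i)) _ r) => //.
- by move=> s; apply: is_derive_line; exact: CkS_derivable CV.
- by move=> s rs; apply: (V0 _ i); rewrite -cE ci.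
- move=> s rs; apply: derive_near0; rewrite -cE.
  have : \forall y \near c s, r < `|(y : 'rV[R]_3) 0 i|.
    have cn : continuous (fun y : 'rV[R]_3 => `|y 0 i|).
      exact: (continuous_compose (@coord_continuous _ _ _ 0 i) (@norm_continuous _ _)).
    by apply: (cvgr_gt _ (cn (c s))); rewrite ci.
  by apply: filterS => y ry; apply: (V0 _ i); exact: ltW.
Qed.

(** Fubini makes the integration over the coordinate i innermost, where the fundamental theorem
    gives 0 for a function vanishing at both ends. The three cases differ only in the order of
    integration. *)
Lemma space_integral_partial0 (V : 'rV[R]_3 -> R) (i : 'I_3) (r : R) :
  0 < r -> Ck 1 V -> (forall (x : 'rV[R]_3) j, r <= `|x 0 j| -> V x = 0) ->
  space_integral ('D_('e_i) V) = 0.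
Proof.
move=> r0 CV V0.
have cdV : continuous ('D_('e_i) V) := Ck_continuous (CkS_derive i CV).
have [K K0 dK] : exists2 K, 0 <= K &
    forall x, `|'D_('e_i) V x| <= K / (1 + `|x|) ^+ 4.
  apply: (@compact_support_bound R _ r) => // x rx; apply: derive_near0.
  have : \forall y \near x, r < `|y|.
    by apply: (cvgr_gt _ (@norm_continuous _ _ x)).
  apply: filterS => y ry.
  have [j rj] := norm_gt_coord (ltW r0) ry.
  exact: V0 rj.
have fi := space_integrable_bounded cdV dK.
rewrite space_integralE /Rintegral.
suff -> : (\int[space_measure]_u ('D_('e_i) V (space_point u))%:E = 0)%E by [].
case: i cdV dK fi => [[|[|[|//]]] p] cdV dK fi.
- rewrite -(integral21_prod_meas1 fi); apply: integral0_eq => z _.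
  have si := plane_integrable_slice z cdV dK.
  rewrite /fubini_G -(integral21_prod_meas1 si); apply: integral0_eq => b _.
  apply: (@integral_slice0 V (fun s => space_point (s, b, z)) _ r) => // s.
  + have [-> _ _] := space_point_line b z s; have [-> _ _] := space_point_line b z 0.
    by rewrite scale0r addr0; congr (_ + _ *: _); congr delta_mx; exact: val_inj.
  + by rewrite !mxE.
- rewrite -(integral21_prod_meas1 fi); apply: integral0_eq => z _.
  have si := plane_integrable_slice z cdV dK.
  rewrite /fubini_G -(integral12_prod_meas1 si); apply: integral0_eq => a _.
  apply: (@integral_slice0 V (fun s => space_point (a, s, z)) _ r) => // s.
  + have [_ -> _] := space_point_line a z s; have [_ -> _] := space_point_line a z 0.
    by rewrite scale0r addr0; congr (_ + _ *: _); congr delta_mx; exact: val_inj.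
  + by rewrite !mxE.
- rewrite -(integral12_prod_meas1 fi); apply: integral0_eq => -[a b] _.
  apply: (@integral_slice0 V (fun s => space_point (a, b, s)) _ r) => // s.
  + have [_ _ ->] := space_point_line a b s; have [_ _ ->] := space_point_line a b 0.
    by rewrite scale0r addr0; congr (_ + _ *: _); congr delta_mx; exact: val_inj.
  + by rewrite !mxE.
Qed.

(* max(0, u)^2 is C^1, which is all the smoothness that the cutoffs need. *)
Definition sqpos (u : R) := Num.max 0 u ^+ 2.

Lemma sqpos_remainder (u h : R) :
  `|sqpos (u + h) - sqpos u - 2 * Num.max 0 u * h| <= h ^+ 2.
Proof.
rewrite /sqpos ler_norml.
by case: (leP 0 (u + h)); case: (leP 0 u) => *; apply/andP; split; nra.
Qed.

(** Yields derivability and the value of the derivative from one algebraic inequality; for affine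
    and quadratic functions the remainder is exactly computable. *)
Lemma is_derive_quadratic_remainder (f : R -> R) (u d : R) :
  (forall h, `|f (u + h) - f u - d * h| <= h ^+ 2) -> is_derive u 1 f d.
Proof.
move=> H.
have L : h^-1 *: (f (h *: 1 + u) - f u) @[h --> 0^'] --> d.
  apply/cvgrPdist_le => e e0; near=> h.
  have h0 : h != 0 by near: h; exact: nbhs_dnbhs_neq.
  have he : `|h| <= e by near: h; exact: dnbhs0_le.
  have -> : d - h^-1 *: (f (h *: 1 + u) - f u) = - (h^-1 * (f (u + h) - f u - d * h)).
    by rewrite [h *: 1]mulr1 (addrC h) /GRing.scale /=; field.
  rewrite normrN normrM normfV mulrC ler_pdivrMr ?normr_gt0 //.
  rewrite (le_trans (H h)) // -real_normK ?num_real // expr2.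
  by rewrite ler_wpM2r.
by split; [exact: cvgP L|exact: cvg_lim L].
Unshelve. all: by end_near.
Qed.

Lemma is_derive_sqpos (u : R) : is_derive u 1 sqpos (2 * Num.max 0 u).
Proof. by apply: is_derive_quadratic_remainder => h; exact: sqpos_remainder. Qed.

Lemma continuous_max0 : continuous (fun u : R => Num.max 0 u).
Proof.
have -> : (fun u : R => Num.max 0 u) = (fun u => (u + `|u|) * 2^-1).
  by apply/funext => u; case: (leP 0 u) => u0;
    [rewrite ger0_norm //|rewrite ltr0_norm //]; lra.
apply: continuous_mul; last exact: cst_continuous.
by apply: continuous_add; [move=> ?; exact: cvg_id|exact: norm_continuous].
Qed.

(** A bump with values in [0, 1], zero for |s| >= n + 1 and tending to 1 pointwise as n grows. *)
Definition cut (n : nat) (s : R) : R := sqpos (1 - (s / n.+1%:R) ^+ 2).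

Definition dcut (n : nat) (s : R) : R :=
  2 * Num.max 0 (1 - (s / n.+1%:R) ^+ 2) * (- (2 * s / n.+1%:R ^+ 2)).

Lemma is_derive_cut n (s : R) : is_derive s 1 (cut n) (dcut n s).
Proof.
have d1 : is_derive s 1 (fun t : R => 1 - (t / n.+1%:R) ^+ 2) (- (2 * s / n.+1%:R ^+ 2)).
  apply: is_derive_quadratic_remainder => h.
  have n0 : (n.+1%:R : R) != 0 by [].
  rewrite (_ : _ - _ = - (h / n.+1%:R) ^+ 2); last by field.
  rewrite normrN ger0_norm ?sqr_ge0 // expr_div_n ler_pdivrMr ?exprn_gt0 //.
  by rewrite ler_peMr ?sqr_ge0 // exprn_ege1 // ler1n.
exact: (@is_derive1_comp R sqpos _ _ _ _ (is_derive_sqpos _) d1).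
Qed.

Lemma continuous_dcut n : continuous (dcut n).
Proof.
apply: continuous_mul; last first.
  apply: continuous_opp; apply: continuous_mul; last exact: cst_continuous.
  by apply: continuous_mul; [exact: cst_continuous|move=> ?; exact: cvg_id].
apply: continuous_mul; first exact: cst_continuous.
apply: (continuous_compose _ continuous_max0).
apply: continuous_add; first exact: cst_continuous.
apply: continuous_opp.
have c : continuous (fun s : R => s / n.+1%:R).
  by apply: continuous_mul; [move=> ?; exact: cvg_id|exact: cst_continuous].
by under eq_fun do rewrite expr2; exact: (continuous_mul c).
Qed.

Lemma continuous_cut n : continuous (cut n).
Proof.
move=> s; apply: differentiable_continuous; apply/derivable1_diffP.
by have [] := is_derive_cut n s.
Qed.

Lemma cut_outside n s : n.+1%:R <= `|s| -> cut n s = 0 /\ dcut n s = 0.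
Proof.
move=> ns; have n0 : (0 : R) < n.+1%:R by [].
have : Num.max 0 (1 - (s / n.+1%:R) ^+ 2) = 0.
  apply/max_idPl; rewrite subr_le0 -real_normK ?num_real // exprn_ege1 //.
  by rewrite normrM normfV (ger0_norm (ltW n0)) ler_pdivlMr // mul1r.
by rewrite /cut /dcut /sqpos => ->; rewrite expr0n mulr0 mul0r.
Qed.

Lemma max_cut n (s : R) : 0 <= Num.max 0 (1 - (s / n.+1%:R) ^+ 2) <= 1.
Proof. by rewrite le_max lexx ge_max ler01 gerBl sqr_ge0. Qed.

Lemma cut_bounds n s : 0 <= cut n s <= 1.
Proof.
have /andP[m0 m1] := max_cut n s.
by rewrite /cut /sqpos sqr_ge0 exprn_ile1.
Qed.

Lemma dcut_bound n s : `|dcut n s| <= 4 / n.+1%:R.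
Proof.
have n0 : (0 : R) < n.+1%:R by [].
have [ns|ns] := leP n.+1%:R `|s|.
  by have [_ ->] := cut_outside ns; rewrite normr0 divr_ge0.
have /andP[m0 m1] := max_cut n s.
rewrite /dcut normrM normrN (ger0_norm (_ : 0 <= 2 * _)) ?mulr_ge0 //.
rewrite !normrM normfV (ger0_norm (ler0n R 2)) (ger0_norm (exprn_ge0 _ (ltW n0))).
apply: (@le_trans _ _ (2 * (2 * n.+1%:R / n.+1%:R ^+ 2))).
  apply: ler_pM; rewrite ?mulr_ge0 ?invr_ge0 ?exprn_ge0 //.
    by rewrite ger_pMr.
  by rewrite ler_pM2r ?invr_gt0 ?exprn_gt0 // ler_pM2l // ltW.
have n0' : (n.+1%:R : R) != 0 by [].
by rewrite le_eqVlt; apply/orP; left; apply/eqP; field.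
Qed.

Lemma is_derive_coord_comp (g : R -> R) (d : R) (x : 'rV[R]_3) (i j : 'I_3) :
  is_derive (x 0 j) 1 g d ->
  is_derive x ('e_i) (fun y : 'rV[R]_3 => g (y 0 j)) ((j == i)%:R * d).
Proof.
move=> Dg.
have df : differentiable g (x 0 j) by apply/derivable1_diffP; have [] := Dg.
have dc := differentiable_coord x 0 j.
have dgc : differentiable (g \o (fun y : 'rV[R]_3 => y 0 j)) x.
  exact: differentiable_comp.
split; first exact: diff_derivable.
rewrite (deriveE ('e_i) dgc) diff_comp // /=.
have [_ Dc] := is_derive_coord j x ('e_i).
rewrite -(deriveE ('e_i) dc) Dc mxE /=.
rewrite deriv1E; last by have [] := Dg.
by rewrite derive1E; have [_ ->] := Dg.
Qed.

Definition cutoff (n : nat) (x : 'rV[R]_3) : R :=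
  cut n (x 0 0) * cut n (x 0 1) * cut n (x 0 2%:R).

Lemma Ck_cut n (j : 'I_3) : Ck 1 (fun x : 'rV[R]_3 => cut n (x 0 j)).
Proof.
have c (g : R -> R) : continuous g -> continuous (fun x : 'rV[R]_3 => g (x 0 j)).
  by move=> cg; exact: (continuous_compose (@coord_continuous _ _ _ 0 j) cg).
split; first exact/c/continuous_cut.
move=> i; have D (x : 'rV[R]_3) := is_derive_coord_comp i (is_derive_cut n (x 0 j)).
split=> [x|]; first by have [] := D x.
split=> //; under eq_fun => x do have [_ ->] := D x.
apply: continuous_mul; first exact: cst_continuous.
exact/c/continuous_dcut.
Qed.

Lemma Ck_cutoff n : Ck 1 (cutoff n).
Proof. by apply: CkM; [apply: CkM|]; exact: Ck_cut. Qed.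

Lemma cutoff_outside n (x : 'rV[R]_3) j : n.+1%:R <= `|x 0 j| ->
  cutoff n x = 0.
Proof.
by case: j => [[|[|[|//]]] p] h; have [e _] := cut_outside h; rewrite /cutoff;
  [rewrite (_ : 0 = Ordinal p) ?e ?mul0r|rewrite (_ : 1 = Ordinal p) ?e ?mulr0 ?mul0r|
   rewrite (_ : 2%:R = Ordinal p) ?e ?mulr0] => //; exact: val_inj.
Qed.

Lemma cutoff_bounds n x : 0 <= cutoff n x <= 1.
Proof.
have /andP[a0 a1] := cut_bounds n (x 0 0).
have /andP[b0 b1] := cut_bounds n (x 0 1).
have /andP[c0 c1] := cut_bounds n (x 0 2%:R).
have p0 := mulr_ge0 a0 b0; have p1 := mulr_ile1 a0 b0 a1 b1.
by rewrite /cutoff mulr_ge0 //= mulr_ile1.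
Qed.

Lemma derive_cutoff_bound n x i : `|'D_('e_i) (cutoff n) x| <= 4 / n.+1%:R.
Proof.
have D j := is_derive_coord_comp i (is_derive_cut n (x 0 j)).
have [_ ->] := is_deriveM (is_deriveM (D 0) (D 1)) (D 2%:R).
have /andP[a0 a1] := cut_bounds n (x 0 0).
have /andP[b0 b1] := cut_bounds n (x 0 1).
have /andP[c0 c1] := cut_bounds n (x 0 2%:R).
have aux (p q : R) j : 0 <= p <= 1 -> 0 <= q <= 1 ->
    `|p * q * dcut n (x 0 j)| <= 4 / n.+1%:R.
  move=> /andP[p0 p1] /andP[q0 q1]; rewrite normrM (ger0_norm (mulr_ge0 p0 q0)).
  by rewrite -[leRHS]mul1r ler_pM ?mulr_ge0 ?mulr_ile1 ?dcut_bound.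
rewrite !fctE /GRing.scale /=.
have h0 := aux _ _ 0 (cut_bounds n (x 0 1)) (cut_bounds n (x 0 2%:R)).
have h1 := aux _ _ 1 (cut_bounds n (x 0 0)) (cut_bounds n (x 0 2%:R)).
have h2 := aux _ _ 2%:R (cut_bounds n (x 0 0)) (cut_bounds n (x 0 1)).
case: i {D} => [[|[|[|//]]] p] /=; rewrite ?(mul1r, mul0r, mulr0, addr0, add0r).
- by rewrite mulrA (mulrC (cut n (x 0 2%:R))).
- by rewrite mulrA (mulrC (cut n (x 0 2%:R))).
- by [].
Qed.

Lemma derive_cutoff_outside n (x : 'rV[R]_3) i : n.+1%:R < `|x| ->
  'D_('e_i) (cutoff n) x = 0.
Proof.
move=> nx; apply: derive_near0.
have : \forall y \near x, n.+1%:R < `|y| by apply: (cvgr_gt _ (@norm_continuous _ _ x)).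
apply: filterS => y ny.
have [j nj] := norm_gt_coord (ler0n R n.+1) ny.
exact: cutoff_outside nj.
Qed.

(** Where the derivative is nonzero, 1 + |x| <= 2 (n + 1), so the bound 4 / (n + 1) becomes a decay
    in x independent of n. This is the extra power of 1 / |x| that allows dominated convergence. *)
Lemma derive_cutoff_decay n (x : 'rV[R]_3) i :
  `|'D_('e_i) (cutoff n) x| <= 8 / (1 + `|x|).
Proof.
have x0 := norm_rV1_gt0 x; have n0 : (0 : R) < n.+1%:R by [].
have [nx|nx] := ltP n.+1%:R `|x|.
  by rewrite derive_cutoff_outside // normr0 divr_ge0 // ltW.
apply: (le_trans (derive_cutoff_bound n x i)).
rewrite ler_pdivlMr // mulrAC ler_pdivrMr //.
have : (1 : R) <= n.+1%:R by rewrite ler1n.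
lra.
Qed.

Lemma cutoff_cvg (x : 'rV[R]_3) : cutoff n x @[n --> \oo] --> (1 : R).
Proof.
have c s : cut n s @[n --> \oo] --> (1 : R).
  have -> : (1 : R) = sqpos (1 - (s * 0) ^+ 2).
    by rewrite mulr0 expr0n subr0 /sqpos max_r // expr1n.
  apply: (@cvg_comp _ _ _ (fun n => 1 - (s / n.+1%:R) ^+ 2) sqpos); last first.
    apply: differentiable_continuous; apply/derivable1_diffP.
    by have [] := is_derive_sqpos (1 - (s * 0) ^+ 2).
  apply: cvgB; first exact: cvg_cst.
  have h : (s / n.+1%:R) @[n --> \oo] --> s * 0.
    by apply: cvgM; [exact: cvg_cst|exact: cvg_harmonic].
  by under eq_fun do rewrite expr2; rewrite expr2; exact: cvgM.
rewrite -[1]mulr1 -[X in X * _]mulr1.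
by apply: cvgM => //; apply: cvgM.
Qed.

Lemma space_integrable_cutoff n f : continuous f ->
  space_integrable (fun x => cutoff n x * f x).
Proof.
move=> cf; have cc : continuous (fun x => cutoff n x * f x).
  exact: continuous_mul (Ck_continuous (Ck_cutoff n)) cf.
have [|K _ fK] := @compact_support_bound R _ n.+1%:R cc; last first.
  exact: space_integrable_bounded fK.
move=> x nx; have [j nj] := norm_gt_coord (ler0n R n.+1) nx.
by rewrite (cutoff_outside nj) mul0r.
Qed.

Lemma space_integral_cutoff_cvg f K : continuous f ->
  (forall x, `|f x| <= K / (1 + `|x|) ^+ 4) ->
  space_integral (fun x => cutoff n x * f x) @[n --> \oo] --> space_integral f.
Proof.
move=> cf fK; apply: (@space_integral_cvg R (fun n x => cutoff n x * f x) f K) => //.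
- by move=> n; exact: continuous_mul (Ck_continuous (Ck_cutoff n)) cf.
- move=> n x; have /andP[c0 c1] := cutoff_bounds n x.
  by rewrite normrM (ger0_norm c0) (le_trans _ (fK x)) // ler_piMl.
- by move=> x; rewrite -[X in _ --> X]mul1r; apply: cvgM; [exact: cutoff_cvg|exact: cvg_cst].
Qed.

(** The derivatives of the products [cutoff n] W_i integrate to 0 by compact support, so W may grow
    arbitrarily here. *)
Lemma space_integral_by_parts n (W : 'I_3 -> 'rV[R]_3 -> R) :
  (forall i, Ck 1 (W i)) ->
  space_integral (fun x => cutoff n x * \sum_i 'D_('e_i) (W i) x) =
  - space_integral (fun x => \sum_i 'D_('e_i) (cutoff n) x * W i x).
Proof.
move=> CW; apply/eqP; rewrite -addr_eq0; apply/eqP.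
have cc := Ck_continuous (Ck_cutoff n).
have cW i := Ck_continuous (CW i).
have cdc i := Ck_continuous (CkS_derive i (Ck_cutoff n)).
have cdW i := Ck_continuous (CkS_derive i (CW i)).
have cV i := CkM (Ck_cutoff n) (CW i).
have i1 : space_integrable (fun x => cutoff n x * \sum_i 'D_('e_i) (W i) x).
  by apply: space_integrable_cutoff; exact: continuous_sum.
have c2 : continuous (fun x => \sum_i 'D_('e_i) (cutoff n) x * W i x).
  by apply: continuous_sum => i; exact: continuous_mul.
have [|K _ fK] := @compact_support_bound R _ n.+1%:R c2.
  by move=> x nx; apply: big1 => i _; rewrite derive_cutoff_outside ?mul0r.
rewrite -space_integralD //; last exact: space_integrable_bounded fK.
rewrite (_ : (fun x => _) =
    fun x => \sum_i 'D_('e_i) (fun y => cutoff n y * W i y) x); last first.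
  apply/funext => x; rewrite mulr_sumr -big_split; apply: eq_bigr => i _.
  by rewrite (partialM _ _ (Ck_cutoff n) (CW i)) addrC.
have V0 i (x : 'rV[R]_3) j : n.+1%:R <= `|x 0 j| -> cutoff n x * W i x = 0.
  by move=> nj; rewrite (cutoff_outside nj) mul0r.
rewrite space_integral_sum => [|i].
  by apply: big1 => i _; apply: (@space_integral_partial0 _ i n.+1%:R) => //; exact: V0.
have [|K' _ fK'] := @compact_support_bound R _ n.+1%:R (Ck_continuous (CkS_derive i (cV i))).
  move=> x nx; rewrite (partialM _ _ (Ck_cutoff n) (CW i)) derive_cutoff_outside // mul0r add0r.
  have [j nj] := norm_gt_coord (ler0n R n.+1) nx.
  by rewrite (cutoff_outside nj) mul0r.
exact: (space_integrable_bounded (Ck_continuous (CkS_derive i (cV i))) fK').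
Qed.

(** The sequence depends on K alone. Uniformity in W matters: [flux_surface_independent] applies
    this to a field containing an intermediate point of a mean value theorem, which changes with
    n. *)
Lemma cutoff_flux_vanishes (K : R) : 0 <= K -> exists eps : nat -> R,
  eps n @[n --> \oo] --> 0 /\
  forall n (W : 'I_3 -> 'rV[R]_3 -> R), (forall i, Ck 1 (W i)) ->
    (forall i x, `|W i x| <= K / (1 + `|x|) ^+ 3) ->
    `|space_integral (fun x => cutoff n x * \sum_i 'D_('e_i) (W i) x)| <= eps n.
Proof.
move=> K0.
pose E n (x : 'rV[R]_3) := \sum_(i < 3) `|'D_('e_i) (cutoff n) x| * (K / (1 + `|x|) ^+ 3).
have p0 (x : 'rV[R]_3) k : 0 < (1 + `|x|) ^+ k by rewrite exprn_gt0 // norm_rV1_gt0.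
have cE n : continuous (E n).
  apply: continuous_sum => i; apply: continuous_mul.
    exact: (continuous_compose (Ck_continuous (CkS_derive i (Ck_cutoff n))) (@norm_continuous _ _)).
  apply: continuous_mul; first exact: cst_continuous.
  apply: continuous_inv => [|x]; last by rewrite gt_eqF // p0.
  apply: continuous_expn.
  by apply: continuous_add; [exact: cst_continuous|exact: norm_continuous].
have E0 n x : 0 <= E n x.
  by apply: sumr_ge0 => i _; rewrite mulr_ge0 // divr_ge0 // ltW.
(* 24 is 3 coordinates times the 8 of [derive_cutoff_decay]. This majorant is independent of n; the
   bound of order 1 / (n + 1) below gives the pointwise limit. *)
have EK n x : `|E n x| <= (24 * K) / (1 + `|x|) ^+ 4.
  rewrite ger0_norm // /E.
  apply: (@le_trans _ _ (\sum_(i < 3) (8 / (1 + `|x|)) * (K / (1 + `|x|) ^+ 3))).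
    by apply: ler_sum => i _; rewrite ler_wpM2r ?derive_cutoff_decay // divr_ge0 // ltW.
  rewrite sumr_const card_ord -mulr_natr.
  have x0 : 1 + `|x| != 0 by rewrite gt_eqF // norm_rV1_gt0.
  by rewrite le_eqVlt; apply/orP; left; apply/eqP; field.
have Ecvg x : E n x @[n --> \oo] --> 0.
  have -> : 0 = (12 * K) * 0 :> R by rewrite mulr0.
  apply: (@squeeze_cvgr _ _ _ _ (fun=> 0) (fun n => (12 * K) * n.+1%:R^-1)).
  - apply: nearW => n; rewrite E0 /=.
    apply: (@le_trans _ _ (\sum_(i < 3) (4 / n.+1%:R) * K)).
      apply: ler_sum => i _; apply: ler_pM => //; first by rewrite divr_ge0 // ltW.
        exact: derive_cutoff_bound.
      by rewrite ler_pdivrMr // ler_peMr // exprn_ege1 // lerDl.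
    rewrite sumr_const card_ord -mulr_natr le_eqVlt; apply/orP; left; apply/eqP.
    by have n0 : (n.+1%:R : R) != 0 by []; field.
  - by rewrite mulr0; exact: cvg_cst.
  - by apply: cvgM; [exact: cvg_cst|exact: cvg_harmonic].
have cz : continuous (fun _ : 'rV[R]_3 => 0 : R) by exact: cst_continuous.
exists (fun n => space_integral (E n)); split.
  have -> : 0 = space_integral (fun _ : 'rV[R]_3 => 0 : R) :> R.
    have iz : space_integrable (fun _ : 'rV[R]_3 => 0 : R).
      by apply: (space_integrable_bounded (K := 0)) => // x; rewrite normr0 mul0r.
    rewrite -[LHS](mul0r (space_integral (fun _ : 'rV[R]_3 => 0 : R))) -(space_integralZ 0 iz).
    by congr space_integral; apply/funext => x; rewrite mul0r.
  exact: (space_integral_cvg cE cz EK Ecvg).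
move=> n W CW WK; rewrite space_integral_by_parts // normrN.
have c2 : continuous (fun x => \sum_i 'D_('e_i) (cutoff n) x * W i x).
  apply: continuous_sum => i; apply: continuous_mul.
    exact: (Ck_continuous (CkS_derive i (Ck_cutoff n))).
  exact: Ck_continuous (CW i).
have bE x : `|\sum_i 'D_('e_i) (cutoff n) x * W i x| <= E n x.
  rewrite (le_trans (ler_norm_sum _ _ _)) //; apply: ler_sum => i _.
  by rewrite normrM ler_wpM2l.
have i2 : space_integrable (fun x => \sum_i 'D_('e_i) (cutoff n) x * W i x).
  apply: (space_integrable_bounded (K := 24 * K)) => // x.
  by rewrite (le_trans (bE x)) // (le_trans _ (EK n x)) // ler_norm.
have iE : space_integrable (E n) := space_integrable_bounded (cE n) (EK n).
rewrite ler_norml; apply/andP; split; last first.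
  by apply: ler_space_integral => // x; rewrite (le_trans (ler_norm _)).
rewrite -[X in X <= _]mulN1r -space_integralZ //.
apply: ler_space_integral => // [|x]; first exact: space_integrableZ.
by rewrite mulN1r; have := bE x; rewrite ler_norml => /andP[].
Qed.

(** The cut-off integrals tend to the full integral, by the fourth-power decay of the divergence,
    and to 0, by the third-power decay of W. *)
Lemma space_integral_divergence0 (W : 'I_3 -> 'rV[R]_3 -> R) (K : R) : 0 <= K ->
  (forall i, Ck 1 (W i)) -> (forall i x, `|W i x| <= K / (1 + `|x|) ^+ 3) ->
  (forall x, `|\sum_i 'D_('e_i) (W i) x| <= K / (1 + `|x|) ^+ 4) ->
  space_integral (fun x => \sum_i 'D_('e_i) (W i) x) = 0.
Proof.
move=> K0 CW WK dK.
have [eps [eps0 H]] := cutoff_flux_vanishes K0.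
have cf : continuous (fun x => \sum_i 'D_('e_i) (W i) x).
  by apply: continuous_sum => i; exact: (Ck_continuous (CkS_derive i (CW i))).
have h := space_integral_cutoff_cvg cf dK.
apply: (cvg_unique _ h) => //.
apply: (@squeeze_cvgr _ _ _ _ (fun n => - eps n) eps) => //.
- by apply: nearW => n; rewrite -ler_norml; exact: H.
- by rewrite -oppr0; exact: cvgN.
Qed.

End divergence.

(** * Fluxes of conserved currents *)

Lemma continuous_rV (R : realType) (T : topologicalType) n (g : T -> 'rV[R]_n) :
  (forall i, continuous (fun x => g x 0 i)) -> continuous g.
Proof.
move=> cg x; apply/cvgrPdist_le => e e0.
have : \forall y \near x, forall i, `|g x 0 i - g y 0 i| <= e.
  apply: (filter_forall (F := nbhs x)) => i.
  by have /cvgrPdist_le /(_ _ e0) := cg i x.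
apply: filterS => y H; apply: rV_norm_le => [|i]; first exact: ltW.
by rewrite !mxE; exact: H.
Qed.

Section graphs.
Context {R : realType}.
Notation "''e_' i" := (delta_mx 0 i) (format "''e_' i").
Notation sp i := (lift (0 : 'I_4) (i : 'I_3)).
Implicit Types (f : 'rV[R]_4 -> R) (h : 'rV[R]_3 -> R).

Lemma sum_delta n (i : 'I_n) (F : 'I_n -> R) : \sum_k ('e_i : 'rV[R]_n) 0 k * F k = F i.
Proof.
rewrite (bigD1 i) //= big1 => [|k ki]; first by rewrite mxE !eqxx mul1r addr0.
by rewrite mxE (negPf ki) andbF mul0r.
Qed.

Lemma event_time (t : R) (x : 'rV[R]_3) : event t x 0 0 = t.
Proof.
rewrite /event (_ : 0 = lshift 3 (0 : 'I_1) :> 'I_4); last exact: val_inj.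
by rewrite (@row_mxEl R 1 1 3 t%:M x 0 0) mxE eqxx.
Qed.

Lemma event_space (t : R) (x : 'rV[R]_3) (i : 'I_3) : event t x 0 (sp i) = x 0 i.
Proof.
rewrite /event (_ : sp i = rshift 1 i :> 'I_4); last exact: val_inj.
exact: (@row_mxEr R 1 1 3 t%:M x 0 i).
Qed.

Lemma event_coord (t : R) (x : 'rV[R]_3) (mu : 'I_4) :
  event t x 0 mu = if unlift 0 mu is Some i then x 0 i else t.
Proof.
by case: unliftP => [i ->|->]; rewrite ?event_space ?event_time.
Qed.

Lemma continuous_event (T : topologicalType) (t : T -> R) (x : T -> 'rV[R]_3) :
  continuous t -> continuous x -> continuous (fun y => event (t y) (x y)).
Proof.
move=> ct cx; apply: continuous_rV => mu.
under eq_fun do rewrite event_coord; case: unliftP => [i _|_] //.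
exact: (continuous_compose cx (@coord_continuous _ _ _ 0 i)).
Qed.

Lemma event_norm (t : R) (x : 'rV[R]_3) r : `|t| <= r -> `|x| <= r ->
  `|event t x| <= r.
Proof.
move=> tr xr; apply: rV_norm_le; first exact: le_trans tr.
move=> mu; rewrite event_coord; case: unliftP => [i _|_] //.
by rewrite (le_trans _ xr) // ler_coord_norm.
Qed.

Lemma is_derive_event (V : normedModType R) f (t : V -> R) (x : V -> 'rV[R]_3)
    (y v : V) (dt : R) (dx : 'I_3 -> R) : Ck 1 f ->
  is_derive y v t dt -> (forall i, is_derive y v (fun z => x z 0 i) (dx i)) ->
  is_derive y v (fun z => f (event (t z) (x z)))
    (dt * 'D_('e_0) f (event (t y) (x y)) +
     \sum_i dx i * 'D_('e_(sp i)) f (event (t y) (x y))).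
Proof.
move=> Cf Dt Dx.
pose dg (mu : 'I_4) := if unlift 0 mu is Some i then dx i else dt.
have Dg (mu : 'I_4) : is_derive y v (fun z => event (t z) (x z) 0 mu) (dg mu).
  under eq_fun do rewrite event_coord; rewrite /dg; case: unliftP => [i _|_] //.
have := is_derive_comp Cf Dg; rewrite big_ord_recl /dg unlift_none.
by under eq_bigr do rewrite liftK.
Qed.

Lemma is_derive_graph f h x i : Ck 1 f -> Ck 1 h ->
  is_derive x ('e_i) (fun y : 'rV[R]_3 => f (event (h y) y))
    ('D_('e_i) h x * 'D_('e_0) f (event (h x) x) + 'D_('e_(sp i)) f (event (h x) x)).
Proof.
move=> Cf Ch.
have Dh : is_derive x ('e_i) h ('D_('e_i) h x).
  by apply: derivableP; exact: CkS_derivable Ch.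
have Dx k := is_derive_coord k x ('e_i).
have := @is_derive_event _ f h id x ('e_i) _ _ Cf Dh Dx.
by rewrite (sum_delta i (fun k => 'D_('e_(sp k)) f (event (h x) x))).
Qed.

Lemma Ck_graph f h : Ck 1 f -> Ck 1 h -> Ck 1 (fun x => f (event (h x) x)).
Proof.
move=> Cf Ch.
have ce : continuous (fun x => event (h x) x).
  by apply: continuous_event; [exact: Ck_continuous Ch|move=> ?; exact: cvg_id].
split; first exact: continuous_compose ce (Ck_continuous Cf).
move=> i; have D x := @is_derive_graph f h x i Cf Ch.
split=> [x|]; first by have [] := D x.
split=> //; under eq_fun => x do have [_ ->] := D x.
apply: continuous_add; last exact: (continuous_compose ce (Ck_continuous (CkS_derive _ Cf))).
apply: continuous_mul; first exact: (Ck_continuous (CkS_derive _ Ch)).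
exact: (continuous_compose ce (Ck_continuous (CkS_derive _ Cf))).
Qed.

(* The integrand n^nu j_nu V(d^3x) in the chart x |-> (h x, x). *)
Definition flux h (j : 'I_4 -> 'rV[R]_4 -> R) (x : 'rV[R]_3) : R :=
  j 0 (event (h x) x) + \sum_i 'D_('e_i) h x * j (sp i) (event (h x) x).

Lemma continuous_flux h j : Ck 1 h -> (forall mu, continuous (j mu)) ->
  continuous (flux h j).
Proof.
move=> Ch cj; have ce : continuous (fun x => event (h x) x).
  by apply: continuous_event; [exact: Ck_continuous Ch|move=> ?; exact: cvg_id].
apply: continuous_add; first exact: continuous_compose ce (cj 0).
apply: continuous_sum => i; apply: continuous_mul.
  exact: (Ck_continuous (CkS_derive _ Ch)).
exact: continuous_compose ce (cj _).
Qed.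

Lemma flux_bound h j (K : R) x : (forall i, `|'D_('e_i) h x| <= 1) ->
  (forall mu, `|j mu (event (h x) x)| <= K) -> `|flux h j x| <= 4 * K.
Proof.
move=> h1 jK; have K0 : 0 <= K := le_trans (normr_ge0 _) (jK 0).
rewrite (le_trans (ler_normD _ _)) // (_ : 4 * K = K + \sum_(i < 3) K).
  rewrite lerD // (le_trans (ler_norm_sum _ _ _)) //; apply: ler_sum => i _.
  by rewrite normrM -[leRHS]mul1r ler_pM.
by rewrite sumr_const card_ord -mulr_natr; lra.
Qed.

(** To be applied to the difference of two heights. Its linear growth costs one of the four powers
    of decay of the current and leaves the three that [cutoff_flux_vanishes] asks for. *)
Lemma Lipschitz_growth h (C : R) : Ck 1 h -> (forall i x, `|'D_('e_i) h x| <= C) ->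
  exists2 C', 0 <= C' & forall x, `|h x| <= C' * (1 + `|x|).
Proof.
move=> Ch hC; have C0 : 0 <= C := le_trans (normr_ge0 _) (hC 0 0).
exists (`|h 0| + 3 * C) => [|x]; first by rewrite addr_ge0 // mulr_ge0.
have [y [_]] := C1_first_order 0 x Ch; rewrite add0r => e.
have -> : h x = h 0 + \sum_k x 0 k * 'D_('e_k) h (y k) by rewrite -e addrC subrK.
rewrite (le_trans (ler_normD _ _)) //.
have : `|\sum_k x 0 k * 'D_('e_k) h (y k)| <= 3 * C * `|x|.
  apply: (@le_trans _ _ (\sum_(k < 3) `|x| * C)).
    rewrite (le_trans (ler_norm_sum _ _ _)) //; apply: ler_sum => k _.
    by rewrite normrM ler_pM // ler_coord_norm.
  by rewrite sumr_const card_ord -mulr_natr; lra.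
have := normr_ge0 (h 0); have := normr_ge0 x; nra.
Qed.

(** * Linear deformation of one graph into another *)

Section interpolation.
Variables (j : 'I_4 -> 'rV[R]_4 -> R) (h h' : 'rV[R]_3 -> R).
Hypotheses (Cj : forall mu, Ck 1 (j mu)) (Ch : Ck 2 h) (Ch' : Ck 2 h').
(** The index of j is a lower one, so the vanishing divergence carries the signs of the metric. *)
Hypothesis conserved :
  forall p, 'D_('e_0) (j 0) p = \sum_(i < 3) 'D_('e_(sp i)) (j (sp i)) p.

Let k x := h' x - h x.
Let hs s x := h x + s * k x.
Let jsp i s x := j (sp i) (event (hs s x) x).
Let djsp i s x := 'D_('e_0) (j (sp i)) (event (hs s x) x).

(** The flux through the graph of [hs s], with the gradient of the height expanded so that its
    dependence on s is visibly affine. *)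
Definition interpolated_flux s x : R :=
  j 0 (event (hs s x) x) +
  \sum_i ('D_('e_i) h x + s * 'D_('e_i) k x) * jsp i s x.

Definition interpolated_flux_rate s x : R :=
  k x * 'D_('e_0) (j 0) (event (hs s x) x) +
  \sum_i ('D_('e_i) k x * jsp i s x +
          ('D_('e_i) h x + s * 'D_('e_i) k x) * (k x * djsp i s x)).

(** The current swept by the vertical motion of the graph, whose velocity is k. *)
Definition interpolation_current s i x : R := k x * jsp i s x.

Let C2k : Ck 2 k. Proof. exact: CkB. Qed.
Let C1k : Ck 1 k. Proof. exact: CkW. Qed.
Let C1h : Ck 1 h. Proof. exact: CkW. Qed.

Let C1hs s : Ck 1 (hs s).
Proof. by apply: CkD => //; apply: CkM => //; exact: Ck_cst. Qed.

Let D_hs s i x : 'D_('e_i) (hs s) x = 'D_('e_i) h x + s * 'D_('e_i) k x.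
Proof.
have dh : derivable h x ('e_i) := CkS_derivable C1h.
have dk : derivable k x ('e_i) := CkS_derivable C1k.
have dsk : derivable (fun y => s * k y) x ('e_i).
  exact: (derivableM (derivable_cst s x ('e_i)) dk).
by rewrite (deriveD dh dsk) (partialM _ _ (Ck_cst 1 s) C1k) derive_cst mul0r add0r.
Qed.

Lemma interpolated_flux0 : interpolated_flux 0 = flux h j.
Proof.
apply/funext => x; rewrite /interpolated_flux /flux /jsp /hs mul0r addr0.
by congr (_ + _); apply: eq_bigr => i _; rewrite mul0r addr0.
Qed.

Lemma interpolated_flux1 : interpolated_flux 1 = flux h' j.
Proof.
have e x : hs 1 x = h' x by rewrite /hs /k mul1r addrC subrK.
apply/funext => x; rewrite /interpolated_flux /flux /jsp e.
by congr (_ + _); apply: eq_bigr => i _; rewrite -D_hs (_ : hs 1 = h') //; exact/funext.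
Qed.

Let is_derive_affine (a b s : R) : is_derive s 1 (fun t => a + t * b) b.
Proof.
apply: is_derive_quadratic_remainder => d.
by rewrite (_ : _ - _ = 0) ?normr0 ?sqr_ge0 //; ring.
Qed.

Lemma is_derive_interpolated_flux (s : R) x :
  is_derive s 1 (fun t => interpolated_flux t x) (interpolated_flux_rate s x).
Proof.
have Dj mu : is_derive s 1 (fun t => j mu (event (hs t x) x))
    (k x * 'D_('e_0) (j mu) (event (hs s x) x)).
  have := @is_derive_event _ (j mu) (fun t => hs t x) (fun=> x) s 1 _ (fun=> 0)
    (Cj mu) (is_derive_affine (h x) (k x) s) (fun i => is_derive_cst (x 0 i) s 1).
  by rewrite big1 ?addr0 // => i _; rewrite mul0r.
have Ds i : is_derive s 1
    (fun t => ('D_('e_i) h x + t * 'D_('e_i) k x) * jsp i t x)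
    ('D_('e_i) k x * jsp i s x +
          ('D_('e_i) h x + s * 'D_('e_i) k x) * (k x * djsp i s x)).
  have := is_deriveM (is_derive_affine ('D_('e_i) h x) ('D_('e_i) k x) s) (Dj (sp i)).
  by rewrite /GRing.scale /= addrC [X in X + _]mulrC.
have := is_deriveD (Dj 0) (is_derive_sum Ds).
rewrite /interpolated_flux_rate (_ : _ + _ = fun t => interpolated_flux t x) //.
apply/funext => t; rewrite !fctE /interpolated_flux; congr (_ + _).
by rewrite fct_sumE.
Qed.

Lemma Ck_interpolation_current s i : Ck 1 (interpolation_current s i).
Proof. by apply: CkM => //; exact: Ck_graph. Qed.

(** Differentiating k j_i along the graph produces the terms with the derivatives of k, the terms
    with the slope times the time derivative of j_i, and k times the spatial divergence of j.
    Conservation identifies the last with k times the time derivative of j_0. *)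
Lemma divergence_interpolation_current s x :
  \sum_i 'D_('e_i) (interpolation_current s i) x = interpolated_flux_rate s x.
Proof.
rewrite /interpolated_flux_rate conserved mulr_sumr -big_split /=.
apply: eq_bigr => i _.
rewrite (partialM _ _ C1k (Ck_graph (Cj (sp i)) (C1hs s))).
have [_ ->] := @is_derive_graph (j (sp i)) (hs s) x i (Cj _) (C1hs s).
rewrite D_hs /djsp /jsp; ring.
Qed.

Lemma interpolated_flux_rate_bounded (r : R) : exists2 M, 0 <= M &
  forall s x, `|s| <= r -> `|x| <= r -> `|interpolated_flux_rate s x| <= M.
Proof.
(* The pair (s, x) is packed into one vector, so that continuity on a closed ball bounds the rate
   jointly in s and x. *)
pose t (y : 'rV[R]_4) := y 0 0.
pose z (y : 'rV[R]_4) : 'rV[R]_3 := \row_i y 0 (sp i).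
have ct : continuous t by exact: coord_continuous.
have cz : continuous z.
  apply: continuous_rV => i; under eq_fun do rewrite mxE.
  exact: coord_continuous.
have ck : continuous (fun y => k (z y)) := continuous_compose cz (Ck_continuous C1k).
have ce : continuous (fun y => event (hs (t y) (z y)) (z y)).
  apply: continuous_event => //; apply: continuous_add.
    exact: continuous_compose cz (Ck_continuous C1h).
  exact: continuous_mul.
have c mu : continuous (fun y => j mu (event (hs (t y) (z y)) (z y))).
  exact: continuous_compose ce (Ck_continuous (Cj mu)).
have cd mu : continuous (fun y => 'D_('e_0) (j mu) (event (hs (t y) (z y)) (z y))).
  exact: continuous_compose ce (Ck_continuous (CkS_derive 0 (Cj mu))).
have cdk i : continuous (fun y => 'D_('e_i) k (z y)).
  exact: continuous_compose cz (Ck_continuous (CkS_derive i C1k)).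
have cdh i : continuous (fun y => 'D_('e_i) h (z y)).
  exact: continuous_compose cz (Ck_continuous (CkS_derive i C1h)).
have cF : continuous (fun y => interpolated_flux_rate (t y) (z y)).
  apply: continuous_add; first exact: (continuous_mul ck (cd 0)).
  apply: continuous_sum => i; apply: continuous_add.
    exact: (continuous_mul (cdk i) (c (sp i))).
  apply: continuous_mul; last exact: (continuous_mul ck (cd (sp i))).
  exact: (continuous_add (cdh i) (continuous_mul ct (cdk i))).
have [M M0 H] := continuous_bounded_ball r cF.
exists M => // s x sr xr.
have := H (event s x) (event_norm sr xr).
rewrite /t event_time (_ : z _ = x) //.
by apply/rowP => i; rewrite mxE event_space.
Qed.

Lemma continuous_interpolated_flux s : continuous (interpolated_flux s).
Proof.
have -> : interpolated_flux s = flux (hs s) j.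
  by apply/funext => x; congr (_ + _); apply: eq_bigr => i _; rewrite D_hs.
by apply: continuous_flux => // mu; exact: Ck_continuous (Cj mu).
Qed.

(** Differentiation under the integral sign. The cutoff confines x to a bounded set, so a local
    bound on the rate is enough; the open interval contains [0, 1], so the endpoints are covered
    too. *)
Lemma is_derive_cutoff_flux n (s : R) : -1 < s < 2 -> is_derive s 1
  (fun t => space_integral (fun x => cutoff n x * interpolated_flux t x))
  (space_integral (fun x => cutoff n x * interpolated_flux_rate s x)).
Proof.
move=> s12.
(* The radius bounds |s| < 2 and |x| <= n + 1 at once, and also 1 + |x| on the support of the
   cutoff, whence the factor (2 + (n + 1))^4 in g. *)
have [M M0 HM] := interpolated_flux_rate_bounded (2 + n.+1%:R).
pose f t (u : R * R * R) :=
  cutoff n (space_point u) * interpolated_flux t (space_point u).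
pose g (x : 'rV[R]_3) := M * (2 + n.+1%:R) ^+ 4 / (1 + `|x|) ^+ 4.
have cg : continuous g.
  apply: continuous_mul; first exact: cst_continuous.
  apply: continuous_inv => [|x]; last by rewrite gt_eqF // exprn_gt0 // norm_rV1_gt0.
  apply: continuous_expn.
  by apply: continuous_add; [exact: cst_continuous|exact: norm_continuous].
have g0 x : 0 <= g x.
  by rewrite divr_ge0 ?mulr_ge0 ?exprn_ge0 ?addr_ge0.
have ig : space_integrable g.
  apply: (space_integrable_bounded (K := M * (2 + n.+1%:R) ^+ 4)) => // x.
  by rewrite ger0_norm.
have df (t : R) u : is_derive t 1 (f ^~ u)
    (cutoff n (space_point u) * interpolated_flux_rate t (space_point u)).
  exact: (is_deriveZ (cutoff n (space_point u)) (is_derive_interpolated_flux t (space_point u))).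
have d1 (t : R) u : partial1of2 f t u =
    cutoff n (space_point u) * interpolated_flux_rate t (space_point u).
  by rewrite partial1of2E; have [_ ->] := df t u.
have intf (t : R) : `](-1), 2[%classic t ->
    (@plane_measure R \x (@lebesgue_measure R))%E.-integrable setT (EFin \o f t).
  by move=> _; exact: (space_integrable_cutoff n (@continuous_interpolated_flux t)).
have derf (t : R) u : `](-1), 2[%classic t -> [set: R * R * R] u -> derivable (f ^~ u) t 1.
  by move=> _ _; have [] := df t u.
have gub (t : R) u : `](-1), 2[%classic t -> [set: R * R * R] u ->
    `|partial1of2 f t u| <= (g \o @space_point R) u.
  rewrite /= in_itv /= => /andP[t1 t2] _; rewrite d1.
  set x := space_point u.
  have /andP[c0 c1] := cutoff_bounds n x.
  have [nx|nx] := ltP n.+1%:R `|x|.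
    have [i ni] := norm_gt_coord (ler0n R n.+1) nx.
    by rewrite (cutoff_outside ni) mul0r normr0.
  have n0 : (0 : R) <= n.+1%:R by [].
  have hM : `|interpolated_flux_rate t x| <= M.
    apply: HM; last by rewrite (le_trans nx) // lerDr.
    by rewrite ler_norml; apply/andP; split; lra.
  rewrite normrM (ger0_norm c0) /g ler_pdivlMr ?exprn_gt0 ?norm_rV1_gt0 //.
  have a1 : cutoff n x * `|interpolated_flux_rate t x| <= M.
    by apply: le_trans hM; rewrite ler_piMl.
  have a2 : (1 + `|x|) ^+ 4 <= (2 + n.+1%:R) ^+ 4.
    by rewrite lerXn2r ?nnegrE ?addr_ge0 //; lra.
  have b1 : 0 <= cutoff n x * `|interpolated_flux_rate t x| by rewrite mulr_ge0.
  have b2 : 0 <= (1 + `|x|) ^+ 4 by rewrite exprn_ge0 // addr_ge0.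
  exact: ler_pM b1 b2 a1 a2.
have Is : `](-1), 2[%classic s by rewrite /= in_itv.
have D := derivable_under_integral measurableT Is intf derf (fun u => g0 (space_point u)) ig gub.
have E := differentiation_under_integral measurableT Is intf derf (fun u => g0 (space_point u)) ig gub.
split; first exact: D.
rewrite -derive1E [LHS]E space_integralE; apply: eq_Rintegral => u _.
exact: d1.
Qed.

End interpolation.

(** With the cutoff fixed, the mean value theorem in the deformation parameter turns the difference
    of the two fluxes into one cut-off divergence, evaluated at an unknown intermediate graph. Its
    bound does not depend on that graph and vanishes as n grows. *)
Lemma flux_surface_independent j h h' (K : R) : 0 <= K ->
  (forall mu, Ck 1 (j mu)) -> Ck 2 h -> Ck 2 h' ->
  (forall p, 'D_('e_0) (j 0) p = \sum_(i < 3) 'D_('e_(sp i)) (j (sp i)) p) ->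
  (forall i x, `|'D_('e_i) h x| <= 1) -> (forall i x, `|'D_('e_i) h' x| <= 1) ->
  (forall mu t x, Num.min (h x) (h' x) <= t <= Num.max (h x) (h' x) ->
    `|j mu (event t x)| <= K / (1 + `|x|) ^+ 4) ->
  space_integral (flux h' j) = space_integral (flux h j).
Proof.
move=> K0 Cj Ch Ch' cons h1 h1' jK.
have C1h := CkW Ch; have C1h' := CkW Ch'.
have [C C0 HC] : exists2 C, 0 <= C & forall x, `|h' x - h x| <= C * (1 + `|x|).
  apply: (Lipschitz_growth (C := 2) (CkB C1h' C1h)) => i x.
  have dh : derivable h x ('e_i) := CkS_derivable C1h.
  have dh' : derivable h' x ('e_i) := CkS_derivable C1h'.
  by rewrite (deriveB dh' dh) (le_trans (ler_normB _ _)) // (_ : 2 = 1 + 1) ?lerD.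
have [eps [eps0 Heps]] := cutoff_flux_vanishes (mulr_ge0 C0 K0).
pose G n t := space_integral (fun x => cutoff n x * interpolated_flux j h h' t x).
have fb (g : 'rV[R]_3 -> R) : (forall i x, `|'D_('e_i) g x| <= 1) ->
    (forall x, Num.min (h x) (h' x) <= g x <= Num.max (h x) (h' x)) ->
    forall x, `|flux g j x| <= (4 * K) / (1 + `|x|) ^+ 4.
  by move=> g1 gb x; rewrite -mulrA; apply: flux_bound => // mu; exact: jK.
have lim0 := space_integral_cutoff_cvg (continuous_flux C1h (fun mu => Ck_continuous (Cj mu)))
  (fb h h1 (fun x => _)).
have lim1 := space_integral_cutoff_cvg (continuous_flux C1h' (fun mu => Ck_continuous (Cj mu)))
  (fb h' h1' (fun x => _)).
have {}lim0 : G n 0 @[n --> \oo] --> space_integral (flux h j).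
  rewrite /G interpolated_flux0; apply: lim0 => x.
  by rewrite ge_min le_max lexx.
have {}lim1 : G n 1 @[n --> \oo] --> space_integral (flux h' j).
  rewrite /G (interpolated_flux1 _ Ch Ch'); apply: lim1 => x.
  by rewrite ge_min le_max lexx !orbT.
have key n : `|G n 1 - G n 0| <= eps n.
  have DG (t : R) : t \in `]0, 1[%R -> is_derive t 1 (G n)
      (space_integral (fun x => cutoff n x * interpolated_flux_rate j h h' t x)).
    rewrite in_itv /= => /andP[t0 t1]; apply: is_derive_cutoff_flux => //.
    by apply/andP; split; lra.
  have cG : {within `[0, 1], continuous (G n)}.
    apply: derivable_within_continuous => t; rewrite in_itv /= => /andP[t0 t1].
    have t12 : -1 < t < 2 by apply/andP; split; lra.
    by have [] := is_derive_cutoff_flux Cj Ch Ch' n t12.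
  have [c cI ->] := MVT ltr01 DG cG; rewrite subr0 mulr1.
  move: cI; rewrite in_itv /= => /andP[c0 c1].
  rewrite (_ : (fun x => _) = fun x => cutoff n x *
      \sum_i 'D_('e_i) (interpolation_current j h h' c i) x); last first.
    by apply/funext => x; rewrite divergence_interpolation_current.
  apply: Heps => [i|i x]; first exact: Ck_interpolation_current.
  rewrite /interpolation_current normrM.
  have x0 := norm_rV1_gt0 x.
  have -> : C * K / (1 + `|x|) ^+ 3 = C * (1 + `|x|) * (K / (1 + `|x|) ^+ 4).
    have x0' : 1 + `|x| != 0 by rewrite gt_eqF.
    by field.
  apply: ler_pM => //.
  (* For 0 < c < 1 the height h + c (h' - h) lies between h and h', where the decay of j is
     assumed. *)
  apply: jK; rewrite ge_min le_max.
  by case: (leP (h x) (h' x)) => hh; apply/andP; split; apply/orP;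
    [left|right|right|left]; nra.
have lim : (G n 1 - G n 0) @[n --> \oo] -->
    space_integral (flux h' j) - space_integral (flux h j) by exact: cvgB.
apply/eqP; rewrite -subr_eq0; apply/eqP.
apply: (cvg_unique _ lim) => //.
apply: (@squeeze_cvgr _ _ _ _ (fun n => - eps n) eps) => //.
- by apply: nearW => n; rewrite -ler_norml.
- by rewrite -oppr0; exact: cvgN.
Qed.

End graphs.

(** * Cauchy surfaces *)

Lemma Lipschitz_continuous (R : realType) (V : normedModType R) (f : V -> R) (C : R) :
  0 < C -> (forall x y, f x - f y <= C * `|x - y|) -> continuous f.
Proof.
move=> C0 H x; apply/cvgrPdist_le => e e0.
have eC : 0 < e / C by rewrite divr_gt0.
have /cvgrPdist_le /(_ _ eC) : (y : V) @[y --> x] --> x by exact: cvg_id.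
apply: filterS => y; rewrite ler_pdivlMr // mulrC => xy.
rewrite ler_norml; apply/andP; split; last exact: le_trans (H x y) xy.
by rewrite lerNl opprB (le_trans (H y x)) // distrC.
Qed.

(** * Euclidean norm and 1-Lipschitz functions *)

Section euclid.
Context {R : realType}.
Implicit Types x y z : 'rV[R]_3.

(** The norm of row vectors is the sup norm, which serves for decay estimates; light cones need the
    Euclidean one. The two are comparable, with factor 2. *)
Definition dot3 x y : R := \sum_i x 0 i * y 0 i.
Definition enorm x : R := Num.sqrt (dot3 x x).

Lemma dot3E x y :
  dot3 x y = x 0 0 * y 0 0 + x 0 1 * y 0 1 + x 0 2%:R * y 0 2%:R.
Proof.
rewrite /dot3 !big_ord_recl big_ord0 addr0 addrA.
by congr (_ + _ * _ + _ * _); congr (_ 0 _); exact: val_inj.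
Qed.

Lemma dot3_ge0 x : 0 <= dot3 x x.
Proof. by rewrite dot3E !addr_ge0 // -expr2 sqr_ge0. Qed.

Lemma sqr_enorm x : enorm x ^+ 2 = dot3 x x.
Proof. by rewrite sqr_sqrtr // dot3_ge0. Qed.

Lemma enorm_ge0 x : 0 <= enorm x.
Proof. exact: sqrtr_ge0. Qed.

Lemma dot3_le x y : dot3 x y <= enorm x * enorm y.
Proof.
have h : dot3 x y ^+ 2 <= (enorm x * enorm y) ^+ 2.
  rewrite exprMn !sqr_enorm !dot3E.
  move: (x 0 0) (x 0 1) (x 0 2%:R) (y 0 0) (y 0 1) (y 0 2%:R) => a b c d e f.
  rewrite -subr_ge0 (_ : _ - _ = (a * e - b * d) ^+ 2 + (a * f - c * d) ^+ 2 +
    (b * f - c * e) ^+ 2); last by ring.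
  by rewrite !addr_ge0 // sqr_ge0.
apply: (le_trans (ler_norm _)).
rewrite -[leRHS]ger0_norm ?mulr_ge0 ?enorm_ge0 //.
by rewrite -ler_sqr ?nnegrE // !real_normK ?num_real.
Qed.

Lemma enormN x : enorm (- x) = enorm x.
Proof. by rewrite /enorm !dot3E !mxE !mulrNN. Qed.

Lemma enormB x y : enorm (x - y) = enorm (y - x).
Proof. by rewrite -enormN opprB. Qed.

Lemma enorm_triangle x y : enorm (x + y) <= enorm x + enorm y.
Proof.
rewrite -ler_sqr ?nnegrE ?addr_ge0 ?enorm_ge0 // sqrrD !sqr_enorm.
have := dot3_le x y; rewrite !dot3E !mxE => h; nra.
Qed.

Lemma enorm_sub x y : enorm x - enorm y <= enorm (x - y).
Proof. by rewrite lerBlDr; apply: le_trans (enorm_triangle _ _); rewrite subrK. Qed.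

Lemma enormZ (c : R) x : enorm (c *: x) = `|c| * enorm x.
Proof.
rewrite /enorm (_ : dot3 (c *: x) (c *: x) = c ^+ 2 * dot3 x x); last first.
  by rewrite !dot3E !mxE; ring.
by rewrite sqrtrM ?sqr_ge0 // sqrtr_sqr.
Qed.

Lemma enorm0 : enorm 0 = 0.
Proof. by rewrite /enorm dot3E !mxE !mulr0 !addr0 sqrtr0. Qed.

Lemma norm_le_enorm x : `|x| <= enorm x.
Proof.
apply: rV_norm_le => [|i]; first exact: enorm_ge0.
rewrite -sqrtr_sqr ler_wsqrtr // dot3E.
have s k : 0 <= x 0 k * x 0 k by rewrite -expr2 sqr_ge0.
have := s 0; have := s 1; have := s 2%:R.
case: i => [[|[|[|//]]] p] s2 s1 s0; rewrite expr2.
- rewrite (_ : Ordinal p = 0); first lra; exact: val_inj.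
- rewrite (_ : Ordinal p = 1); first lra; exact: val_inj.
- rewrite (_ : Ordinal p = 2%:R); first lra; exact: val_inj.
Qed.

Lemma enorm_le_norm x : enorm x <= 2 * `|x|.
Proof.
rewrite -ler_sqr ?nnegrE ?mulr_ge0 ?enorm_ge0 // sqr_enorm dot3E.
have s k : x 0 k * x 0 k <= `|x| ^+ 2.
  rewrite -expr2 -real_normK ?num_real // lerXn2r ?nnegrE //; exact: ler_coord_norm.
have := s 0; have := s 1; have := s 2%:R; nra.
Qed.

Lemma continuous_enorm : continuous enorm.
Proof.
apply: (@Lipschitz_continuous _ _ _ 2) => // x y.
exact: le_trans (enorm_sub x y) (enorm_le_norm _).
Qed.

Definition Lipschitz1 (g : 'rV[R]_3 -> R) :=
  forall x y, g x - g y <= enorm (x - y).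

Lemma Lipschitz1_continuous g : Lipschitz1 g -> continuous g.
Proof.
move=> Lg; apply: (@Lipschitz_continuous _ _ _ 2) => // x y.
exact: le_trans (Lg x y) (enorm_le_norm _).
Qed.

End euclid.

(** * Timelike curves, heights of Cauchy surfaces, and decay between two surfaces *)

Section curves.
Context {R : realType}.
Notation sp i := (lift (0 : 'I_4) (i : 'I_3)).
Implicit Types (gamma : R -> 'rV[R]_4) (S : set 'rV[R]_4).

Definition space_part (p : 'rV[R]_4) : 'rV[R]_3 := \row_i p 0 (sp i).

Lemma space_partE p i : space_part p 0 i = p 0 (sp i).
Proof. by rewrite mxE. Qed.

Lemma space_part_event (t : R) (x : 'rV[R]_3) : space_part (event t x) = x.
Proof. by apply/rowP => i; rewrite mxE event_space. Qed.

Lemma event_space_part (p : 'rV[R]_4) : event (p 0 0) (space_part p) = p.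
Proof.
apply/rowP => mu; rewrite event_coord; case: unliftP => [i ->|-> //].
by rewrite mxE.
Qed.

Lemma mdotE (u v : 'rV[R]_4) :
  mdot u v = u 0 0 * v 0 0 - dot3 (space_part u) (space_part v).
Proof.
rewrite /mdot big_ord_recl; congr (_ + _).
  rewrite big_ord_recl big1 ?addr0 => [|i _]; first by rewrite /Defs.eta eqxx mul1r.
  by rewrite /Defs.eta /= !mul0r.
rewrite /dot3 -sumrN; apply: eq_bigr => i _.
rewrite (bigD1 (sp i)) //= big1 ?addr0 => [|nu]; last first.
  by rewrite /Defs.eta eq_sym => /negPf ->; rewrite !mul0r.
by rewrite /Defs.eta eqxx /= !mxE mulN1r mulNr.
Qed.

Lemma is_derive_curve gamma (s : R) (mu : 'I_4) : derivable gamma s 1 ->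
  is_derive s 1 (fun t => gamma t 0 mu) ('D_1 gamma s 0 mu).
Proof.
move=> d; split; first by have /derivable_mxP /(_ 0 mu) := d.
by rewrite derive_mx // mxE.
Qed.

(** The time component of a timelike velocity cannot vanish, so by continuity it keeps one sign. The
    factor sg is 1 for future-directed curves and -1 for past-directed ones. *)
Lemma timelike_time_direction gamma : timelike_curve gamma ->
  exists2 sg : R, sg * sg = 1 & forall s, 0 < sg * ('D_1 gamma s) 0 0.
Proof.
move=> [dg cd tl].
pose d s := ('D_1 gamma s) 0 0.
have cdd : continuous d := continuous_compose cd (@coord_continuous _ _ _ 0 0).
have d0 s : d s != 0.
  apply/eqP => e; have := tl s; rewrite mdotE -/(d s) e mul0r sub0r oppr_gt0.
  by rewrite ltNge dot3_ge0.
have same (a b : R) : a <= b -> ~ (Num.min (d a) (d b) < 0 < Num.max (d a) (d b)).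
  move=> ab /andP[m M].
  have [|c _ /eqP] := @IVT R d a b 0 ab (continuous_subspaceT cdd).
    by rewrite (ltW m) (ltW M).
  by rewrite (negPf (d0 c)).
have sameb (a b : R) : d a < 0 -> 0 < d b -> False.
  move=> da db; have [ab|ba] := leP a b.
    apply: (same _ _ ab); apply/andP; split.
      by rewrite gt_min da.
    by rewrite lt_max db orbT.
  apply: (same _ _ (ltW ba)); apply/andP; split.
    by rewrite gt_min da orbT.
  by rewrite lt_max db.
have [p|n] := ltP 0 (d 0).
  exists 1 => [|s]; first by rewrite mulr1.
  rewrite mul1r lt_neqAle eq_sym d0 leNgt; apply/negP => h.
  exact: sameb h p.
have n' : d 0 < 0 by rewrite lt_neqAle d0.
exists (-1) => [|s]; first by rewrite mulN1r opprK.
rewrite mulN1r oppr_gt0 lt_neqAle d0 /= leNgt; apply/negP => h.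
exact: sameb n' h.
Qed.

(** The velocity is projected on the fixed total displacement u: by Cauchy-Schwarz the function |u|
    sg t - u.x has positive derivative, so the mean value theorem for real functions suffices. *)
Lemma timelike_separation gamma (sg : R) : timelike_curve gamma -> sg * sg = 1 ->
  (forall s, 0 < sg * ('D_1 gamma s) 0 0) -> forall a b : R, a < b ->
  enorm (space_part (gamma b) - space_part (gamma a)) <
    sg * (gamma b 0 0 - gamma a 0 0).
Proof.
move=> [dg cd tl] sg2 sgp a b ab.
set u := space_part (gamma b) - space_part (gamma a).
have Dc (s : R) mu := is_derive_curve mu (dg s).
have speed s : enorm (space_part ('D_1 gamma s)) < sg * ('D_1 gamma s) 0 0.
  rewrite -ltr_sqr ?nnegrE ?enorm_ge0 ?(ltW (sgp s)) // sqr_enorm.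
  have := tl s; rewrite mdotE subr_gt0 => /lt_le_trans; apply.
  by rewrite exprMn expr2 sg2 mul1r expr2.
have mvt (f df : R -> R) : (forall s : R, is_derive s 1 f (df s)) ->
    (forall s, 0 < df s) -> 0 < f b - f a.
  move=> D p; have [|c _ ->] := MVT ab (fun s _ => D s).
    by apply: derivable_within_continuous => s _; have [] := D s.
  by rewrite mulr_gt0 // subr_gt0.
have Dt (s : R) : is_derive s 1 (fun r => sg * gamma r 0 0) (sg * ('D_1 gamma s) 0 0).
  exact: (is_deriveZ sg (Dc s 0)).
(* For u = 0 the projection carries no information; the monotonicity of time is used instead. *)
have [u0|u0] := eqVneq (enorm u) 0.
  by rewrite u0 mulrBr; exact: mvt Dt sgp.
have up : 0 < enorm u by rewrite lt_neqAle eq_sym u0 enorm_ge0.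
have Du (s : R) : is_derive s 1
    (fun r => enorm u * (sg * gamma r 0 0) - dot3 u (space_part (gamma r)))
    (enorm u * (sg * ('D_1 gamma s) 0 0) - dot3 u (space_part ('D_1 gamma s))).
  have D2 := is_derive_sum (fun i => is_deriveZ (u 0 i) (Dc s (sp i))).
  have := is_deriveB (is_deriveZ (enorm u) (Dt s)) D2.
  rewrite (_ : dot3 u (space_part ('D_1 gamma s)) = \sum_(i < 3) u 0 i *: ('D_1 gamma s) 0 (sp i)).
    rewrite (_ : _ - _ = (fun r => enorm u * (sg * gamma r 0 0) - dot3 u (space_part (gamma r)))) //.
    apply/funext => r; rewrite !fctE; congr (_ - _); rewrite fct_sumE.
    by apply: eq_bigr => i _; rewrite space_partE.
  by apply: eq_bigr => i _; rewrite space_partE.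
have := mvt _ _ Du; rewrite (_ : (_ - _) - (_ - _) = enorm u * (sg * (gamma b 0 0 - gamma a 0 0)) - enorm u ^+ 2).
  move=> H; have {}H := H _.
  have : 0 < enorm u * (sg * (gamma b 0 0 - gamma a 0 0) - enorm u).
    rewrite mulrBr -expr2; apply: H => s; rewrite subr_gt0.
    by rewrite (le_lt_trans (dot3_le _ _)) // ltr_pM2l.
  by rewrite pmulr_rgt0 // subr_gt0.
rewrite sqr_enorm {4}/u !dot3E !mxE; ring.
Qed.

Lemma escaping_inextendible gamma (C : R) :
  (forall s, `|s| - C <= `|gamma s 0 0|) -> inextendible gamma.
Proof.
move=> H.
have bnd (p q : 'rV[R]_4) : `|p - q| <= 1 -> `|q 0 0| <= `|p| + 1.
  move=> pq; rewrite (le_trans (ler_coord_norm q 0)) //.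
  have := ler_normB p (p - q); rewrite subKr; lra.
split=> -[p gp].
- have B : \forall s \near +oo, `|gamma s 0 0| <= `|p| + 1.
    have /cvgrPdist_le /(_ 1 ltr01) := gp; apply: filterS => s; exact: bnd.
  have : \forall s \near (+oo : set_system R), False.
    near=> s; have h1 : `|gamma s 0 0| <= `|p| + 1 by near: s.
    have h2 : `|p| + 1 + C < s by near: s; apply: nbhs_pinfty_gt; exact: num_real.
    have := H s; have := ler_norm s; lra.
  by move/filter_ex => [].
- have B : \forall s \near -oo, `|gamma s 0 0| <= `|p| + 1.
    have /cvgrPdist_le /(_ 1 ltr01) := gp; apply: filterS => s; exact: bnd.
  have : \forall s \near (-oo : set_system R), False.
    near=> s; have h1 : `|gamma s 0 0| <= `|p| + 1 by near: s.
    have h2 : s < - (`|p| + 1 + C) by near: s; apply: nbhs_ninfty_lt; exact: num_real.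
    have := H s; have := ler_norm (- s); rewrite normrN; lra.
  by move/filter_ex => [].
Unshelve. all: by end_near.
Qed.

(** Test curves that move uniformly in space and have a free time function. All properties of
    heights below come from probing a Cauchy surface with such curves. *)
Lemma uniform_direction_curve (tau dtau : R -> R) (x0 v : 'rV[R]_3) (C : R) :
  (forall s : R, is_derive s 1 tau (dtau s)) -> continuous dtau ->
  (forall s, dot3 v v < dtau s ^+ 2) -> (forall s, `|s| - C <= `|tau s|) ->
  let gamma s := event (tau s) (x0 + s *: v) in
  timelike_curve gamma /\ inextendible gamma.
Proof.
move=> Dtau cdtau dv tauC gamma.
have Dg (s : R) (mu : 'I_4) : is_derive s 1 (fun r => gamma r 0 mu)
    (event (dtau s) v 0 mu).
  under eq_fun do rewrite event_coord; rewrite event_coord.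
  case: unliftP => [i _|_] //.
  apply: is_derive_quadratic_remainder => h; rewrite !mxE.
  by rewrite (_ : _ - _ = 0) ?normr0 ?sqr_ge0 //; ring.
have dg s : derivable gamma s 1.
  by apply/derivable_mxP => i mu; rewrite (ord1 i); have [] := Dg s mu.
have DgE s : 'D_1 gamma s = event (dtau s) v.
  by apply/rowP => mu; rewrite derive_mx // mxE; have [_ ->] := Dg s mu.
split; last by apply: (@escaping_inextendible _ C) => s; rewrite event_time.
split=> [//||s]; last by rewrite DgE mdotE event_time space_part_event subr_gt0 -expr2.
rewrite (_ : 'D_1 gamma = fun s => event (dtau s) v); last exact/funext.
by apply: continuous_event => //; exact: cst_continuous.
Qed.

Lemma cauchy_surface_not_avoided S (tau dtau : R -> R) (x0 v : 'rV[R]_3) (C : R) :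
  cauchy_surface S -> (forall s : R, is_derive s 1 tau (dtau s)) ->
  continuous dtau -> (forall s, dot3 v v < dtau s ^+ 2) ->
  (forall s, `|s| - C <= `|tau s|) ->
  exists! s, S (event (tau s) (x0 + s *: v)).
Proof.
move=> cS D cd dv tC.
by have [tl ie] := uniform_direction_curve x0 D cd dv tC; exact: cS tl ie.
Qed.

Lemma heightP S x : cauchy_surface S ->
  S (event (height S x) x) /\ forall t, S (event t x) -> t = height S x.
Proof.
move=> cS.
have [|||s [Ss uS]] := @cauchy_surface_not_avoided S id (fun=> 1) x 0 0 cS.
- exact: cst_continuous.
- by move=> s; rewrite dot3E !mxE !mul0r !addr0 expr1n.
- by move=> s; rewrite subr0.
move: Ss; rewrite scaler0 addr0 => Ss.
have Sh : S (event (height S x) x).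
  by apply: (@getPex _ [set t | S (event t x)]); exists s.
have E t : S (event t x) -> s = t by move=> St; apply: uS; rewrite scaler0 addr0.
by split=> // t St; rewrite -(E t St) -(E _ Sh).
Qed.

(** Two points of S violating the inequality would lie on a straight inextendible timelike line,
    which would meet S twice. *)
Lemma height_Lipschitz S : cauchy_surface S -> Lipschitz1 (height S).
Proof.
move=> cS x y; rewrite leNgt; apply/negP => xy.
pose d := height S x - height S y.
have d0 : 0 < d by apply: le_lt_trans xy; exact: enorm_ge0.
pose v := d^-1 *: (x - y).
have [||||s [Ss us]] := @cauchy_surface_not_avoided S (fun s => height S y + s) (fun=> 1) y v `|height S y| cS.
- move=> s; apply: is_derive_quadratic_remainder => h.
  by rewrite (_ : _ - _ = 0) ?normr0 ?sqr_ge0 //; ring.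
- exact: cst_continuous.
- move=> s; rewrite -sqr_enorm enormZ gtr0_norm ?invr_gt0 // ltr_sqr ?nnegrE //.
    by rewrite mulrC ltr_pdivrMr // mul1r.
  by rewrite mulr_ge0 ?enorm_ge0 // invr_ge0 ltW.
- move=> s; rewrite lerBlDr; have := ler_normB (height S y + s) (height S y).
  by rewrite (addrC (height S y)) addrK.
have s0 : s = 0 by apply: us; rewrite scale0r !addr0; have [] := heightP y cS.
have sd : s = d.
  apply: us; rewrite /v scalerA divff ?gt_eqF // scale1r /d addrC subrK.
  by rewrite addrC subrK; have [] := heightP x cS.
by move: d0; rewrite -sd s0 ltxx.
Qed.

(* A null ray staying strictly on one side of S could be accelerated into an
   inextendible timelike curve missing S. *)
Lemma height_coercive S (ep : R) : cauchy_surface S -> ep * ep = 1 ->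
  forall T, exists r, forall x, r <= enorm x -> T < ep * height S x + enorm x.
Proof.
move=> cS ep2 T; apply: contrapT => H.
have epL x y : ep * height S x - ep * height S y <= enorm (x - y).
  have h1 := height_Lipschitz cS x y; have h2 := height_Lipschitz cS y x.
  have : (ep - 1) * (ep + 1) = 0 by rewrite mulrDr mulrBl ep2; ring.
  move/eqP; rewrite mulf_eq0 subr_eq0 addr_eq0 => /orP[|] /eqP ->.
    by rewrite !mul1r.
  by rewrite enormB !mulN1r; lra.
have bad (n : nat) : exists x, n%:R <= enorm x /\ ep * height S x + enorm x <= T.
  apply: contrapT => H'; apply: H; exists n%:R => x nx.
  by rewrite ltNge; apply/negP => h; apply: H'; exists x.
have [X HX] := choice bad.
pose w n := (enorm (X n.+1))^-1 *: X n.+1.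
have Xp n : 0 < enorm (X n.+1) by have [h _] := HX n.+1; exact: lt_le_trans h.
have w1 n : enorm (w n) = 1.
  by rewrite enormZ gtr0_norm ?invr_gt0 // mulVf // gt_eqF.
have Xw n : X n.+1 = enorm (X n.+1) *: w n.
  by rewrite /w scalerA divff ?scale1r // gt_eqF.
pose K := [set y : 'rV[R]_3 | enorm y = 1].
have cK : compact K.
  apply: bounded_closed_compact.
    exists 1; split; first exact: num_real.
    by move=> M M1 y /= y1; rewrite (le_trans (norm_le_enorm y)) // y1 ltW.
  rewrite (_ : K = enorm @^-1` [set 1]) //.
  by apply: closed_comp; [move=> y _; exact: continuous_enorm|exact: closed_eq].
have [|om [om1 clom]] := cK (w n @[n --> \oo]) _.
  by exists 0%N => // n _; exact: w1.
(* The bound at X n is carried back along its ray to s w_n by the Lipschitz property, as soon as |X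
   n| exceeds s; it passes to the cluster direction om because it is a closed condition. *)
have ray s : 0 <= s -> ep * height S (s *: om) + s <= T.
  move=> s0; pose B := [set y | ep * height S (s *: y) + s <= T].
  have cB : closed B.
    rewrite (_ : B = (fun y => ep * height S (s *: y) + s) @^-1` [set t | t <= T]) //.
    apply: closed_comp; last exact: closed_le.
    move=> y _; apply: continuous_add; last exact: cst_continuous.
    apply: continuous_mul; first exact: cst_continuous.
    apply: continuous_compose; last exact/Lipschitz1_continuous/height_Lipschitz.
    exact: scaler_continuous.
  suff wB : \forall n \near \oo, B (w n) by apply: cB => N Nom; exact: clom.
  exists (Num.truncn s) => // n /= tn; rewrite /B /=.
  have ns : s <= enorm (X n.+1).
    have [h _] := HX n.+1; apply: le_trans h; apply: ltW.
    by rewrite (lt_le_trans (truncnS_gt _)) // ler_nat.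
  have [_ hT] := HX n.+1.
  have := epL (s *: w n) (X n.+1).
  have -> : enorm (s *: w n - X n.+1) = enorm (X n.+1) - s.
    rewrite (_ : s *: w n - X n.+1 = - ((enorm (X n.+1) - s) *: w n)).
      by rewrite enormN enormZ w1 mulr1 ger0_norm // subr_ge0.
    by rewrite {1}Xw -scalerBl -scaleNr opprB.
  lra.
(* The time component has speed 1 + 1 / (1 + s^2) > 1, so the curve is timelike but asymptotically
   null. For s >= 0, meeting S would force atan s >= 2 > pi/2. For s < 0, the Lipschitz bound from
   the origin keeps S at distance at least 2 in time. *)
have [||||s [Ss us]] := @cauchy_surface_not_avoided S
  (fun s => ep * (T + 2 - s - atan s)) (fun s => - ep * (1 + (1 + s ^+ 2)^-1)) 0 om `|T + 2| cS.
- move=> s.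
  have := is_deriveZ ep (is_deriveB (is_deriveB (is_derive_cst (T + 2) s 1) (is_derive_id s 1)) (is_derive1_atan s)).
  move/is_derive_eq; apply.
  by rewrite /GRing.scale /=; ring.
- apply: continuous_mul; first exact: cst_continuous.
  apply: continuous_add; first exact: cst_continuous.
  apply: continuous_inv => [|s]; last by rewrite gt_eqF // ltr_pwDl // sqr_ge0.
  apply: continuous_add; first exact: cst_continuous.
  by apply: continuous_expn => s; exact: cvg_id.
- move=> s; rewrite -sqr_enorm om1 expr1n exprMn sqrrN expr2 ep2 mul1r.
  have p : 0 < (1 + s ^+ 2)^-1 by rewrite invr_gt0 ltr_pwDl // sqr_ge0.
  by rewrite exprn_egt1 //; lra.
- move=> s.
  have -> : `|ep * (T + 2 - s - atan s)| = `|T + 2 - s - atan s|.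
    rewrite normrM (_ : `|ep| = 1) ?mul1r //.
    by apply/eqP; rewrite -(@eqrXn2 _ 2) // real_normK ?num_real // expr1n expr2 ep2.
  have as0 : `|s| <= `|s + atan s|.
    have [s0|s0] := leP 0 s.
      have a0 : 0 <= atan s by rewrite -atan0 le_atan.
      by rewrite !ger0_norm ?addr_ge0 // lerDl.
    have a0 : atan s <= 0 by rewrite -atan0 le_atan // ltW.
    by rewrite !ler0_norm ?(ltW s0) //; lra.
  have := ler_normB (T + 2) (T + 2 - s - atan s).
  rewrite (_ : T + 2 - (T + 2 - s - atan s) = s + atan s); first lra.
  by ring.
have hs : ep * (T + 2 - s - atan s) = height S (s *: om).
  by have [_ u] := heightP (s *: om) cS; apply: u; rewrite add0r in Ss.
have hs' : T + 2 - s - atan s = ep * height S (s *: om).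
  by rewrite -hs mulrA ep2 mul1r.
have [s0|s0] := leP 0 s.
  have := ray s s0; have := atan_ltpi2 s; have /andP[_ p2] := @pihalf_02 R; lra.
have a0 : atan s <= 0 by rewrite -atan0 le_atan // ltW.
have := ray 0 (lexx 0); rewrite scale0r addr0 => r0.
have := epL (s *: om) 0; rewrite subr0 enormZ om1 mulr1 ltr0_norm //; lra.
Qed.

Lemma shift_curve gamma (v : 'rV[R]_4) : timelike_curve gamma -> inextendible gamma ->
  timelike_curve (fun s => gamma s + v) /\ inextendible (fun s => gamma s + v).
Proof.
move=> [dg cd tl] [i1 i2].
have E s : 'D_1 (fun s => gamma s + v) s = 'D_1 gamma s.
  by have := deriveD (dg s) (@derivable_cst _ _ _ v s 1); rewrite derive_cst addr0.
have E' : 'D_1 (fun s => gamma s + v) = 'D_1 gamma by exact/funext.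
split; first split=> [s||s].
- exact: (derivableD (dg s) (@derivable_cst _ _ _ v s 1)).
- by rewrite E'.
- by rewrite E; exact: tl.
have lim (F : set_system R) : Filter F -> (exists p : 'rV[R]_4, gamma s + v @[s --> F] --> p) ->
    exists p : 'rV[R]_4, gamma s @[s --> F] --> p.
  move=> FF [p gp]; exists (p - v).
  rewrite (_ : gamma = fun s => gamma s + v - v); last first.
    by apply/funext => s; rewrite addrK.
  by apply: cvgB => //; exact: cvg_cst.
by split=> h; [apply: i1|apply: i2]; exact: lim h.
Qed.

(** In time a timelike curve gains strictly more than its spatial displacement, and f changes by at
    most that displacement. So t - f(x) strictly increases towards the future, and a graph of f is
    met at most once. *)
Lemma time_order gamma (sg : R) (f : 'rV[R]_3 -> R) : timelike_curve gamma ->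
  sg * sg = 1 -> (forall s, 0 < sg * ('D_1 gamma s) 0 0) -> Lipschitz1 f ->
  forall a b : R, sg * a < sg * b ->
  gamma a 0 0 - f (space_part (gamma a)) < gamma b 0 0 - f (space_part (gamma b)).
Proof.
move=> tl sg2 sgp Lf.
have sep := timelike_separation tl sg2 sgp.
have : (sg - 1) * (sg + 1) = 0 by rewrite mulrDr mulrBl sg2; ring.
move/eqP; rewrite mulf_eq0 subr_eq0 addr_eq0 => /orP[|] /eqP sgE a b;
  rewrite sgE ?mul1r ?mulN1r ?ltrN2 => ab; have := sep _ _ ab; rewrite sgE;
  have := Lf (space_part (gamma b)) (space_part (gamma a)).
  by rewrite mul1r; lra.
rewrite enormB mulN1r; lra.
Qed.

Lemma time_order_le gamma (sg : R) (f : 'rV[R]_3 -> R) : timelike_curve gamma ->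
  sg * sg = 1 -> (forall s, 0 < sg * ('D_1 gamma s) 0 0) -> Lipschitz1 f ->
  forall a b : R, sg * a <= sg * b ->
  gamma a 0 0 - f (space_part (gamma a)) <= gamma b 0 0 - f (space_part (gamma b)).
Proof.
move=> tl sg2 sgp Lf a b; rewrite le_eqVlt => /orP[/eqP e|]; last first.
  by move=> ab; apply: ltW; exact: time_order ab.
have -> // : a = b.
by rewrite -[a]mul1r -sg2 -mulrA e mulrA sg2 mul1r.
Qed.

(** The time translate of S by c is met as well; instead of the surface, the curve is translated by
    -c. *)
Lemma cauchy_surface_crossing S gamma (c : R) : cauchy_surface S ->
  timelike_curve gamma -> inextendible gamma ->
  exists s, gamma s 0 0 - height S (space_part (gamma s)) = c.
Proof.
move=> cS tl ie; have [tl' ie'] := shift_curve (event (- c) 0) tl ie.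
have [s [Ss _]] := cS _ tl' ie'; exists s.
have [_ u] := heightP (space_part (gamma s)) cS.
have := u (gamma s 0 0 - c) _; rewrite (_ : event _ _ = gamma s + event (- c) 0) => [/(_ Ss) <-|].
  by ring.
apply/rowP => mu; rewrite [RHS]mxE !event_coord; case: unliftP => [i ->|->].
  by rewrite !mxE addr0.
by [].
Qed.

(** A 1-Lipschitz graph can be asymptotically null and then be avoided by inextendible curves.
    Trapping g between translates of the two surfaces excludes this: every curve gets from one side
    of the graph to the other. *)
Lemma graph_cauchy S S' (g : 'rV[R]_3 -> R) : cauchy_surface S -> cauchy_surface S' ->
  Lipschitz1 g ->
  (forall x, Num.min (height S x) (height S' x) - 1 <= g x <=
    Num.max (height S x) (height S' x) + 1) ->
  cauchy_surface [set p : 'rV[R]_4 | p 0 0 = g (space_part p)].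
Proof.
move=> cS cS' Lg gb gamma tl ie.
have [sg sg2 sgp] := timelike_time_direction tl.
have ord := time_order tl sg2 sgp Lg.
have ordS := time_order_le tl sg2 sgp (height_Lipschitz cS).
have ordS' := time_order_le tl sg2 sgp (height_Lipschitz cS').
have [a1 A1] := cauchy_surface_crossing (-1) cS tl ie.
have [a2 A2] := cauchy_surface_crossing (-1) cS' tl ie.
have [b1 B1] := cauchy_surface_crossing 1 cS tl ie.
have [b2 B2] := cauchy_surface_crossing 1 cS' tl ie.
pose phi s := gamma s 0 0 - g (space_part (gamma s)).
(* At the earlier of the crossings of the two surfaces lowered by 1, the curve is at least 1 below
   both surfaces, hence not above the graph. *)
have [a phia] : exists a, phi a <= 0.
  have [l|l] := leP (sg * a1) (sg * a2).
    exists a1; have := ordS' _ _ l; have /andP[h _] := gb (space_part (gamma a1)).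
    move: h; rewrite /phi minEle; case: ifP => _; lra.
  exists a2; have := ordS _ _ (ltW l); have /andP[h _] := gb (space_part (gamma a2)).
  move: h; rewrite /phi minEle; case: ifP => _; lra.
(* Dually, at the later of the crossings of the two surfaces raised by 1. *)
have [b phib] : exists b, 0 <= phi b.
  have [l|l] := leP (sg * b1) (sg * b2).
    exists b2; have := ordS _ _ l; have /andP[_ h] := gb (space_part (gamma b2)).
    move: h; rewrite /phi maxEle; case: ifP => _; lra.
  exists b1; have := ordS' _ _ (ltW l); have /andP[_ h] := gb (space_part (gamma b1)).
  move: h; rewrite /phi maxEle; case: ifP => _; lra.
have [dg _ _] := tl.
have cg : continuous gamma.
  by move=> s; apply: differentiable_continuous; apply/derivable1_diffP.
have cphi : continuous phi.
  apply: continuous_add.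
    exact: (continuous_compose cg (@coord_continuous _ _ _ 0 0)).
  apply: continuous_opp; apply: continuous_compose (Lipschitz1_continuous Lg).
  apply: continuous_rV => i.
  under eq_fun do rewrite space_partE.
  exact: (continuous_compose cg (@coord_continuous _ _ _ 0 (sp i))).
have [s phis] : exists s, phi s = 0.
  have ivt u v : u <= v -> Num.min (phi u) (phi v) <= 0 <= Num.max (phi u) (phi v) ->
      exists s, phi s = 0.
    move=> uv h; have [c _ hc] := IVT uv (continuous_subspaceT cphi) h.
    by exists c.
  have [ab|/ltW ba] := leP a b; [apply: ivt ab _|apply: ivt ba _];
    by rewrite ge_min le_max phia phib ?orbT.
exists s; split => [|s' hs'].
  by rewrite /=; apply/eqP; rewrite -subr_eq0; apply/eqP.
have phis' : phi s' = 0 by rewrite /phi hs' subrr.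
have [l|l|e] := ltgtP (sg * s) (sg * s').
- by have := ord _ _ l; rewrite -/(phi s) -/(phi s') phis phis' ltxx.
- by have := ord _ _ l; rewrite -/(phi s) -/(phi s') phis phis' ltxx.
- by rewrite -[s]mul1r -sg2 -mulrA e mulrA sg2 mul1r.
Qed.

(* Increasing both null coordinates |x| + t and |x| - t along the sequence keeps
   its points achronal. *)
Lemma spacelike_sequence (P : R -> 'rV[R]_3 -> Prop) :
  (forall T, exists t x, [/\ P t x, T < enorm x + t & T < enorm x - t]) ->
  exists t : nat -> R, exists x : nat -> 'rV[R]_3,
  [/\ forall n, P (t n) (x n),
      forall m n, t m - t n <= enorm (x m - x n) &
      forall r, exists n, r <= enorm (x n)].
Proof.
move=> H.
have {}H (T : R) : exists p : R * 'rV[R]_3,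
    [/\ P p.1 p.2, T < enorm p.2 + p.1 & T < enorm p.2 - p.1].
  by have [t [x h]] := H T; exists (t, x).
have [F HF] := choice H.
(* Each new event exceeds the preceding one by at least 1 in both null coordinates; the unit step
   makes the radii unbounded. *)
pose T (p : R * 'rV[R]_3) := Num.max (enorm p.2 + p.1) (enorm p.2 - p.1) + 1.
pose p n := iter n (F \o T) (F 0).
pose v n := enorm (p n).2 + (p n).1.
pose w n := enorm (p n).2 - (p n).1.
have Pp n : P (p n).1 (p n).2.
  by case: n => [|n]; [have [] := HF 0|have [] := HF (T (p n))].
have step n : v n + 1 <= v n.+1 /\ w n + 1 <= w n.+1.
  have [_] := HF (T (p n)); rewrite -/(v n.+1) -/(w n.+1) /T -/(v n) -/(w n).
  have : v n <= Num.max (v n) (w n) by rewrite le_max lexx.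
  have : w n <= Num.max (v n) (w n) by rewrite le_max lexx orbT.
  lra.
have mono k n : v n + k%:R <= v (n + k)%N /\ w n + k%:R <= w (n + k)%N.
  elim: k => [|k [h1 h2]]; first by rewrite !addr0 addn0 !lexx.
  by have [s1 s2] := step (n + k)%N; rewrite addnS -natr1; lra.
have rad m n : (m <= n)%N -> `|(p n).1 - (p m).1| <= enorm ((p n).2 - (p m).2).
  move=> /subnKC mn; have [h1 h2] := mono (n - m)%N m; rewrite mn in h1 h2.
  have k0 : 0 <= ((n - m)%N%:R : R) by rewrite ler0n.
  apply: le_trans (enorm_sub _ _); rewrite ler_norml; apply/andP; split.
    by move: h1; rewrite /v; lra.
  by move: h2; rewrite /w; lra.
exists (fun n => (p n).1), (fun n => (p n).2); split=> // [m n|r].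
  have [mn|/ltnW nm] := leqP m n.
    rewrite enormB; apply: le_trans (rad _ _ mn); rewrite distrC; exact: ler_norm.
  apply: le_trans (rad _ _ nm); exact: ler_norm.
exists (Num.truncn (r - enorm (p 0%N).2)).+1.
have [h1 h2] := mono (Num.truncn (r - enorm (p 0%N).2)).+1 0%N; rewrite add0n in h1 h2.
have := truncnS_gt (r - enorm (p 0%N).2); move: h1 h2; rewrite /v /w; lra.
Qed.

(* g is the supremum of lo and of the past light cones of the given events. *)
Lemma Lipschitz1_envelope (lo hi : 'rV[R]_3 -> R) (t : nat -> R) (x : nat -> 'rV[R]_3) :
  Lipschitz1 lo -> Lipschitz1 hi -> (forall y, lo y <= hi y) ->
  (forall n, lo (x n) <= t n <= hi (x n)) ->
  (forall m n, t m - t n <= enorm (x m - x n)) ->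
  exists g, [/\ Lipschitz1 g, forall y, lo y <= g y <= hi y & forall n, g (x n) = t n].
Proof.
move=> Llo Lhi lohi tb sep.
pose E y := [set lo y] `|` range (fun n => t n - enorm (y - x n)).
have Eub y : ubound (E y) (hi y).
  move=> _ [-> //|[n _ <-]]; have := Lhi (x n) y; rewrite enormB.
  by have /andP[_ h] := tb n; lra.
have E0 y : E y !=set0 by exists (lo y); left.
have hE y z : E y z -> z <= sup (E y).
  by move=> Ez; apply: ub_le_sup => //; exists (hi y); exact: Eub.
have leE y z : ubound (E y) z -> sup (E y) <= z by move=> h; exact: ge_sup.
exists (fun y => sup (E y)); split=> [y z|y|n].
- rewrite lerBlDr; apply: leE => _ [->|[n _ <-]].
    have h : lo z <= sup (E z) by apply: hE; left.
    have := Llo y z; lra.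
  have h : t n - enorm (z - x n) <= sup (E z) by apply: hE; right; exists n.
  have := enorm_triangle (z - y) (y - x n); rewrite addrA subrK (enormB z y); lra.
- by apply/andP; split; [apply: hE; left|apply: leE; exact: Eub].
- apply/eqP; rewrite eq_le; apply/andP; split.
    apply: leE => _ [->|[m _ <-]]; first by have /andP[] := tb n.
    by have := sep m n; rewrite enormB; lra.
  by apply: hE; right; exists n => //; rewrite subrr enorm0 subr0.
Qed.

Lemma Lipschitz1_min (g h : 'rV[R]_3 -> R) : Lipschitz1 g -> Lipschitz1 h ->
  Lipschitz1 (fun x => Num.min (g x) (h x)).
Proof.
move=> Lg Lh x y; rewrite !minEle; have l1 := Lg x y; have l2 := Lh x y.
by case: (leP (g x) (h x)) => ?; case: (leP (g y) (h y)) => ?; lra.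
Qed.

Lemma Lipschitz1_max (g h : 'rV[R]_3 -> R) : Lipschitz1 g -> Lipschitz1 h ->
  Lipschitz1 (fun x => Num.max (g x) (h x)).
Proof.
move=> Lg Lh x y; rewrite !maxEle; have l1 := Lg x y; have l2 := Lh x y.
by case: (leP (g x) (h x)) => ?; case: (leP (g y) (h y)) => ?; lra.
Qed.

(** The margin 1 on either side makes the strip a neighbourhood of the region between the surfaces,
    so that derivatives of a field supported in P vanish there too. *)
Lemma compact_support_strip S S' (P : set 'rV[R]_4) :
  cauchy_surface S -> cauchy_surface S' ->
  (forall S'', cauchy_surface S'' -> compact (closure (S'' `&` P))) ->
  exists r, forall t x, r <= enorm x ->
    Num.min (height S x) (height S' x) - 1 <= t <=
      Num.max (height S x) (height S' x) + 1 -> ~ P (event t x).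
Proof.
move=> cS cS' cP; apply: contrapT => H.
pose lo x := Num.min (height S x) (height S' x) - 1.
pose hi x := Num.max (height S x) (height S' x) + 1.
have L := height_Lipschitz cS; have L' := height_Lipschitz cS'.
have Llo : Lipschitz1 lo.
  by move=> x y; have := Lipschitz1_min L L' x y; rewrite /lo; lra.
have Lhi : Lipschitz1 hi.
  by move=> x y; have := Lipschitz1_max L L' x y; rewrite /hi; lra.
have lohi y : lo y <= hi y.
  by rewrite /lo /hi minEle maxEle; case: (leP (height S y) (height S' y)) => ?; lra.
have one : (1 : R) * 1 = 1 by rewrite mulr1.
have mone : (-1 : R) * -1 = 1 by rewrite mulrNN mulr1.
pose Q t x := lo x <= t <= hi x /\ P (event t x).
have far T : exists t x, [/\ Q t x, T < enorm x + t & T < enorm x - t].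
  (* Coercivity with both signs and for both surfaces makes both null coordinates of far points of
     the strip large; the extra 1 pays for the margin of the strip. *)
  have [r1 h1] := height_coercive cS one (T + 1).
  have [r2 h2] := height_coercive cS mone (T + 1).
  have [r3 h3] := height_coercive cS' one (T + 1).
  have [r4 h4] := height_coercive cS' mone (T + 1).
  apply: contrapT => H'; apply: H.
  exists (Num.max (Num.max r1 r2) (Num.max r3 r4)) => t x.
  rewrite !ge_max => /andP[/andP[x1 x2] /andP[x3 x4]] tb Pt.
  apply: H'; exists t, x.
  have := h1 x x1; have := h2 x x2; have := h3 x x3; have := h4 x x4.
  move/andP: (tb) => [].
  rewrite minEle maxEle; case: (leP (height S x) (height S' x)) => ? ? ? ? ? ? ?; split => //; lra.
have [t [x [Qtx sep unb]]] := spacelike_sequence far.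
have [|g [Lg gb gx]] := Lipschitz1_envelope Llo Lhi lohi _ sep.
  by move=> n; have [] := Qtx n.
have cg := graph_cauchy cS cS' Lg gb.
have /compact_bounded [M [_ hM]] := cP _ cg.
have [n hn] := unb (2 * (Num.max M 0 + 1) + 1).
have : `|event (t n) (x n)| <= Num.max M 0 + 1.
  apply: (hM (Num.max M 0 + 1)).
    by rewrite ltr_pwDr // le_max lexx.
  apply: subset_closure; split; last by have [] := Qtx n.
  by rewrite /= event_time space_part_event gx.
have : `|x n| <= `|event (t n) (x n)|.
  apply: rV_norm_le => [|i]; first exact: normr_ge0.
  by rewrite -(event_space (t n)) ler_coord_norm.
have := enorm_le_norm (x n); lra.
Qed.

Definition decaying S S' (a : 'I_4 -> 'rV[R]_4 -> R) := exists2 K : R, 0 <= K &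
  forall (t : R) (x : 'rV[R]_3), Num.min (height S x) (height S' x) <= t <=
    Num.max (height S x) (height S' x) ->
  forall mu, `|a mu (event t x)| <= K / (1 + `|x|) ^+ 2 /\
    forall nu, `|'D_(delta_mx 0 nu) (a mu) (event t x)| <= K / (1 + `|x|) ^+ 2.

Lemma continuous_bounded_ball_family n (I : finType) (f : I -> 'rV[R]_n -> R) (r : R) :
  (forall i, continuous (f i)) ->
  exists2 M : R, 0 <= M & forall i x, `|x| <= r -> `|f i x| <= M.
Proof.
move=> cf; have [|M M0 H] := @continuous_bounded_ball R n (fun x => \sum_i `|f i x|) r.
  apply: continuous_sum => i; apply: continuous_compose (cf i) _.
  exact: norm_continuous.
exists M => // i x xr; apply: le_trans (H x xr).
apply: le_trans (ler_norm _).
by rewrite (bigD1 i) //= lerDl sumr_ge0.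
Qed.

(** Near the axis the region is bounded and continuity gives a constant. Farther out the field
    vanishes on a neighbourhood of each point of the region, hence so do its derivatives. *)
Lemma support_decaying S S' (a : 'I_4 -> 'rV[R]_4 -> R) (r : R) :
  cauchy_surface S -> cauchy_surface S' -> (forall mu, Ck 1 (a mu)) ->
  (forall (t : R) x, r <= enorm x ->
    Num.min (height S x) (height S' x) - 1 <= t <=
      Num.max (height S x) (height S' x) + 1 -> forall mu, a mu (event t x) = 0) ->
  decaying S S' a.
Proof.
move=> cS cS' Ca a0.
have L := height_Lipschitz cS; have L' := height_Lipschitz cS'.
(* The unit added to r makes r < |x| strict outside the ball, so that it persists for nearby
   points. *)
pose rho := Num.max r 0 + 1.
have rho0 : 0 <= rho by rewrite addr_ge0 // le_max lexx orbT.
have [M1 M10 H1] := continuous_bounded_ball rho (Lipschitz1_continuous L).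
have [M2 M20 H2] := continuous_bounded_ball rho (Lipschitz1_continuous L').
pose rad := Num.max rho (M1 + M2).
have ca mu := Ck_continuous (Ca mu).
have cda (k : 'I_4 * 'I_4) : continuous (fun p => 'D_(delta_mx 0 k.2) (a k.1) p).
  exact: Ck_continuous (CkS_derive k.2 (Ca k.1)).
have [M3 M30 H3] := continuous_bounded_ball_family rad ca.
have [M4 M40 H4] := continuous_bounded_ball_family rad cda.
have p1 (x : 'rV[R]_3) : 0 < (1 + `|x|) ^+ 2 by rewrite exprn_gt0 // ltr_pwDl.
exists ((M3 + M4) * (1 + rho) ^+ 2) => [|t x tb mu].
  by apply: mulr_ge0; [exact: addr_ge0|apply: exprn_ge0; exact: addr_ge0].
have [xr|xr] := leP (enorm x) rho.
  have nx : `|x| <= rho := le_trans (norm_le_enorm x) xr.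
  have ie : `|event t x| <= rad.
    apply: event_norm; last by rewrite le_max nx.
    rewrite le_max; apply/orP; right.
    have := H1 x nx; have := H2 x nx; rewrite !ler_norml.
    move: tb; rewrite minEle maxEle; case: (leP (height S x) (height S' x)) => _ ? ? ?; lra.
  have B z : `|z| <= M3 + M4 -> `|z| <= (M3 + M4) * (1 + rho) ^+ 2 / (1 + `|x|) ^+ 2.
    move=> zM; rewrite ler_pdivlMr //.
    apply: (@le_trans _ _ ((M3 + M4) * (1 + `|x|) ^+ 2)); first by rewrite ler_pM2r.
    apply: ler_wpM2l; first exact: addr_ge0.
    have h : 1 + `|x| <= 1 + rho by rewrite lerD2l.
    by apply: lerXn2r h; rewrite nnegrE; exact: addr_ge0.
  split=> [|nu]; apply: B.
    by rewrite (le_trans (H3 mu _ ie)) // lerDl.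
  by rewrite (le_trans (H4 (mu, nu) _ ie)) // lerDr.
have rx : r < enorm x by apply: le_lt_trans xr; rewrite ler_wpDr // le_max lexx.
have K0 : 0 <= (M3 + M4) * (1 + rho) ^+ 2 / (1 + `|x|) ^+ 2.
  apply: divr_ge0 (ltW (p1 x)).
  by apply: mulr_ge0; [exact: addr_ge0|apply: exprn_ge0; exact: addr_ge0].
split=> [|nu].
  by rewrite (a0 _ _ (ltW rx)) ?normr0 //; move: tb; lra.
rewrite derive_near0 ?normr0 //.
have csp : continuous space_part.
  apply: continuous_rV => i; under eq_fun do rewrite space_partE.
  exact: coord_continuous.
(* Positivity of the three continuous functions f1, f2, f3 cuts out an open part of the widened
   strip that contains the given event. *)
pose f1 (p : 'rV[R]_4) := enorm (space_part p) - r.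
pose f2 (p : 'rV[R]_4) := p 0 0 - Num.min (height S (space_part p)) (height S' (space_part p)) + 1.
pose f3 (p : 'rV[R]_4) := Num.max (height S (space_part p)) (height S' (space_part p)) + 1 - p 0 0.
have c1 : continuous f1.
  apply: continuous_add; last exact: cst_continuous.
  exact: continuous_compose csp continuous_enorm.
have c2 : continuous f2.
  apply: continuous_add; last exact: cst_continuous.
  apply: continuous_add; first exact: coord_continuous.
  apply: continuous_opp.
  exact: (continuous_compose csp (Lipschitz1_continuous (Lipschitz1_min L L'))).
have c3 : continuous f3.
  apply: continuous_add; last by apply: continuous_opp; exact: coord_continuous.
  apply: continuous_add; last exact: cst_continuous.
  exact: (continuous_compose csp (Lipschitz1_continuous (Lipschitz1_max L L'))).
have pos (f : 'rV[R]_4 -> R) : continuous f -> 0 < f (event t x) -> \forall p \near event t x, 0 < f p.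
  by move=> cf f0; exact: cvgr_gt (cf (event t x)) _ f0.
have := pos _ c1; have := pos _ c2; have := pos _ c3.
rewrite /f1 /f2 /f3 !space_part_event !event_time => h3 h2 h1.
have {}h1 := h1 _; have {}h2 := h2 _; have {}h3 := h3 _.
near=> p; rewrite -(event_space_part p); apply: a0.
  by apply: ltW; rewrite -subr_gt0; near: p; apply: h1; rewrite subr_gt0.
apply/andP; split.
  rewrite -subr_ge0; apply: ltW; rewrite opprB addrA addrAC.
  by near: p; apply: h2; move: tb; lra.
by rewrite -subr_ge0; apply: ltW; near: p; apply: h3; move: tb; lra.
Unshelve. all: by end_near.
Qed.

Lemma normcR_le (z : R[i]) (k : R) : `|z| <= k%:C%C ->
  `|complex.Re z| <= k /\ `|complex.Im z| <= k.
Proof.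
case: z => a b; rewrite normc_def lecR /= => h; split; apply: le_trans h.
  by rewrite -sqrtr_sqr ler_wsqrtr // lerDl sqr_ge0.
by rewrite -sqrtr_sqr ler_wsqrtr // lerDr sqr_ge0.
Qed.

Definition re_field (A : field4 R) mu p := complex.Re (A mu p).
Definition im_field (A : field4 R) mu p := complex.Im (A mu p).

(** Both alternatives of [falls_off] are turned into decay, so the integral estimates need only one
    hypothesis. *)
Lemma falls_off_decaying S S' (A : field4 R) : cauchy_surface S -> cauchy_surface S' ->
  (forall mu, CkC 1 (A mu)) -> falls_off S S' A ->
  decaying S S' (re_field A) /\ decaying S S' (im_field A).
Proof.
move=> cS cS' CA [cA|[K HK]].
  have [r Hr] := compact_support_strip cS cS' cA.
  have A0 (t : R) x : r <= enorm x -> Num.min (height S x) (height S' x) - 1 <= t <=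
      Num.max (height S x) (height S' x) + 1 -> forall mu, A mu (event t x) = 0.
    move=> xr tb mu; apply/eqP/negPn/negP => h; apply: (Hr t x xr tb); by exists mu.
  split; apply: (@support_decaying _ _ _ r) => //.
  - by move=> mu; have [] := CA mu.
  - by move=> t x xr tb mu; rewrite /re_field A0.
  - by move=> mu; have [] := CA mu.
  - by move=> t x xr tb mu; rewrite /im_field A0.
have p1 (x : 'rV[R]_3) : 0 < (1 + `|x|) ^+ 2 by rewrite exprn_gt0 // ltr_pwDl.
have le1 (x : 'rV[R]_3) : K / (1 + `|x|) ^+ 2 <= Num.max K 0 / (1 + `|x|) ^+ 2.
  by rewrite ler_pM2r ?invr_gt0 // le_max lexx.
by split; (exists (Num.max K 0); first by rewrite le_max lexx orbT);
  move=> t x tb mu; have [h1 h2] := HK t x tb mu;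
  (split=> [|nu]; first (by have [u v] := normcR_le h1; apply: le_trans (le1 x)));
  have [u v] := normcR_le (h2 nu); apply: le_trans (le1 x).
Qed.

End curves.

(** * Unit normal and volume element *)

Lemma det_mx33 (R : comNzRingType) (A : 'M[R]_3) : \det A =
  A 0 0 * (A 1 1 * A 2%:R 2%:R - A 1 2%:R * A 2%:R 1)
  - A 0 1 * (A 1 0 * A 2%:R 2%:R - A 1 2%:R * A 2%:R 0)
  + A 0 2%:R * (A 1 0 * A 2%:R 1 - A 1 1 * A 2%:R 0).
Proof.
rewrite (expand_det_row _ 0) !big_ord_recl big_ord0 /cofactor.
rewrite !(expand_det_row _ 0) !big_ord_recl !big_ord0 /cofactor !det_mx11 !mxE /=.
rewrite !expr0 !expr1 /bump /= ?expr0 ?expr1 ?exprS ?expr0.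
have e1 : lift 0 (0 : 'I_2) = 1 :> 'I_3 by exact: val_inj.
have e2 : lift 0 (1 : 'I_2) = 2%:R :> 'I_3 by exact: val_inj.
have e3 : lift 1 (0 : 'I_2) = 0 :> 'I_3 by exact: val_inj.
have e4 : lift 1 (1 : 'I_2) = 2%:R :> 'I_3 by exact: val_inj.
have e5 : lift 2%:R (0 : 'I_2) = 0 :> 'I_3 by exact: val_inj.
have e6 : lift 2%:R (1 : 'I_2) = 1 :> 'I_3 by exact: val_inj.
have e7 : lift 0 (0 : 'I_1) = 1 :> 'I_2 by exact: val_inj.
have e8 : lift 1 (0 : 'I_1) = 0 :> 'I_2 by exact: val_inj.
rewrite ?(e1, e2, e3, e4, e5, e6, e7, e8).
ring.
Qed.

Lemma dot3C (R : realType) (x y : 'rV[R]_3) : dot3 x y = dot3 y x.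
Proof. by apply: eq_bigr => i _; rewrite mulrC. Qed.

Lemma dot3Zl (R : realType) (a : R) (x y : 'rV[R]_3) : dot3 (a *: x) y = a * dot3 x y.
Proof. by rewrite mulr_sumr; apply: eq_bigr => i _; rewrite mxE mulrA. Qed.

Lemma dot3Zr (R : realType) (a : R) (x y : 'rV[R]_3) : dot3 x (a *: y) = a * dot3 x y.
Proof. by rewrite dot3C dot3Zl dot3C. Qed.

Section surface.
Context {R : realType} (S : set 'rV[R]_4) (cS : spacelike_cauchy_surface S).
Notation "''e_' i" := (delta_mx 0 i) (format "''e_' i").
Notation sp i := (lift (0 : 'I_4) (i : 'I_3)).

Let h := height S.
Let Ch : Ck 1 h. Proof. by have [_ C _] := cS; exact: CkW C. Qed.
Let g (x : 'rV[R]_3) : 'rV[R]_3 := \row_i 'D_('e_i) h x.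

Lemma derive_height x v : 'D_v h x = dot3 v (g x).
Proof. by rewrite derive_sum_coord //; apply: eq_bigr => i _; rewrite mxE. Qed.

Lemma tangentE x v : tangent S x v = event ('D_v h x) v.
Proof.
have Dh : is_derive x v h ('D_v h x).
  by apply: derivableP; exact: diff_derivable (C1_differentiable x Ch).
have D (mu : 'I_4) : is_derive x v (fun y => chart S y 0 mu) (event ('D_v h x) v 0 mu).
  rewrite /chart; under eq_fun do rewrite event_coord; rewrite event_coord.
  by case: unliftP => [i _|_] //; exact: is_derive_coord.
have d : derivable (chart S) x v.
  by apply/derivable_mxP => i mu; rewrite (ord1 i); have [] := D mu.
by apply/rowP => mu; rewrite /tangent derive_mx // mxE; have [_ ->] := D mu.
Qed.

Lemma mdot_tangent x u v : mdot (tangent S x u) (tangent S x v) =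
  dot3 u (g x) * dot3 v (g x) - dot3 u v.
Proof. by rewrite !tangentE mdotE !event_time !space_part_event !derive_height. Qed.

(** Spacelikeness is tested in the steepest direction, the gradient itself: with q its squared
    length, it reads q^2 < q. *)
Lemma slope_lt1 x : dot3 (g x) (g x) < 1.
Proof.
have [g0|g0] := eqVneq (g x) 0.
  by rewrite g0 dot3E !mxE !mulr0 !addr0.
have [_ _ /(_ x _ g0)] := cS; rewrite mdot_tangent subr_lt0.
have := dot3_ge0 (g x); rewrite le_eqVlt => /orP[/eqP <- //|p].
by rewrite -[ltRHS]mulr1 ltr_pM2l.
Qed.

Lemma partial_height_le1 i x : `|'D_('e_i) h x| <= 1.
Proof.
have -> : 'D_('e_i) h x = g x 0 i by rewrite mxE.
apply: (le_trans (ler_coord_norm _ _)); apply: (le_trans (norm_le_enorm _)).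
rewrite -ler_sqr ?nnegrE ?enorm_ge0 ?ler01 // sqr_enorm expr1n ltW //; exact: slope_lt1.
Qed.

Let s x := Num.sqrt (1 - dot3 (g x) (g x)).

Lemma s_gt0 x : 0 < s x.
Proof. by rewrite sqrtr_gt0 subr_gt0 slope_lt1. Qed.

Lemma sqr_s x : s x ^+ 2 = 1 - dot3 (g x) (g x).
Proof. by rewrite sqr_sqrtr // subr_ge0 ltW // slope_lt1. Qed.

(** Orthogonality to the coordinate tangents makes the spatial part a multiple of the gradient; the
    norm then fixes the time component up to sign, and the orientation fixes the sign. Equality with
    a singleton is what makes the [get] in [normal] computable. *)
Lemma future_unit_normalE x : future_unit_normal S x = [set event (s x)^-1 ((s x)^-1 *: g x)].
Proof.
have s0 := s_gt0 x; have s2 := sqr_s x.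
apply/seteqP; split=> [n [n1 n0 nt]|_ ->].
  have ni i : n 0 (sp i) = n 0 0 * g x 0 i.
    have := nt ('e_i); rewrite tangentE mdotE event_time space_part_event derive_height.
    rewrite /dot3 (sum_delta i (fun k => g x 0 k)).
    rewrite (eq_bigr (fun k => ('e_i : 'rV[R]_3) 0 k * space_part n 0 k)); last first.
      by move=> k _; rewrite mulrC.
    by rewrite sum_delta space_partE => /eqP; rewrite subr_eq0 => /eqP.
  have sn : space_part n = n 0 0 *: g x by apply/rowP => i; rewrite space_partE ni !mxE.
  have : (n 0 0 * s x) ^+ 2 = 1.
    by rewrite exprMn s2 -[RHS]n1 mdotE sn dot3Zl dot3Zr; ring.
  move/eqP; rewrite sqrf_eq1 => /orP[/eqP e|/eqP e]; last first.
    have : 0 < n 0 0 * s x by rewrite mulr_gt0.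
    by rewrite e oppr_gt0 ltr10.
  have n0E : n 0 0 = (s x)^-1.
    by apply: (@mulIf _ (s x)); rewrite ?gt_eqF // mulVf // gt_eqF.
  by rewrite /= -n0E -sn event_space_part.
split=> [||v].
- rewrite mdotE event_time space_part_event.
  rewrite (_ : _ - _ = (s x)^-1 ^+ 2 * (1 - dot3 (g x) (g x))).
    by rewrite -s2 -exprMn mulVf ?expr1n // gt_eqF.
  by rewrite dot3Zl dot3Zr; ring.
- by rewrite event_time invr_gt0.
- rewrite tangentE mdotE !event_time !space_part_event derive_height.
  by rewrite dot3Zl (dot3C v) subrr.
Qed.

Lemma normalE x : normal S x = event (s x)^-1 ((s x)^-1 *: g x).
Proof.
rewrite /normal (_ : [set n | future_unit_normal S x n] = [set event (s x)^-1 ((s x)^-1 *: g x)]).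
  by apply: (@getPex _ [set _]); exists (event (s x)^-1 ((s x)^-1 *: g x)).
by rewrite -future_unit_normalE.
Qed.

(** The Gram matrix is the identity minus the rank-one matrix of products of slopes, so its
    determinant is 1 - |g|^2. *)
Lemma volume_densityE x : volume_density S x = s x.
Proof.
rewrite /volume_density /s; congr Num.sqrt.
have d (i j : 'I_3) : mdot (tangent S x ('e_i)) (tangent S x ('e_j)) =
    g x 0 i * g x 0 j - (i == j)%:R.
  rewrite mdot_tangent; congr (_ * _ - _).
  - by rewrite /dot3 (sum_delta i (fun k => g x 0 k)).
  - by rewrite /dot3 (sum_delta j (fun k => g x 0 k)).
  - by rewrite /dot3 (sum_delta i (fun k => ('e_j : 'rV[R]_3) 0 k)) mxE.
rewrite det_mx33 dot3E.
under eq_mx do rewrite d.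
rewrite !(mxE, eqxx) /=.
move: ('D_('e_0) h x) ('D_('e_1) h x) ('D_('e_(2%:R)) h x) => a b c; ring.
Qed.

Lemma normal_volume x (w : 'I_4 -> R) :
  (\sum_nu normal S x 0 nu * w nu) * volume_density S x =
  w 0 + \sum_i 'D_('e_i) h x * w (sp i).
Proof.
have s0 := s_gt0 x.
rewrite normalE volume_densityE big_ord_recl event_time mulrDl.
rewrite mulrAC mulVf ?mul1r ?gt_eqF //; congr (_ + _).
rewrite mulr_suml; apply: eq_bigr => i _.
rewrite event_space mxE [g x 0 i]mxE; have := gt_eqF s0.
move: (s x) ('D_('e_i) h x) (w _) => r d u /negbT r0.
by rewrite mulrC -(mulrA _ d) mulVKf.
Qed.

End surface.

(** * The real current *)

Section real_current.
Context {R : realType}.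
Notation "''e_' i" := (delta_mx 0 i) (format "''e_' i").
Notation sp i := (lift (0 : 'I_4) (i : 'I_3)).
Notation rfield := ('I_4 -> 'rV[R]_4 -> R).
Implicit Types (a b c : rfield) (S : set 'rV[R]_4).

Definition sgn (mu : 'I_4) : R := if mu == 0 then 1 else -1.

Lemma sgn_space i : sgn (sp i) = -1.
Proof. by []. Qed.

Lemma normr_sgn mu : `|sgn mu| = 1.
Proof. by rewrite /sgn; case: ifP => _; rewrite ?normrN normr1. Qed.

Definition real_maxwell a := forall nu p, \sum_mu sgn mu *
  'D_('e_mu) (fun q => 'D_('e_mu) (a nu) q - 'D_('e_nu) (a mu) q) p = 0.

(* sgn mu is the diagonal entry of the metric, so both indices below are lower. *)
Definition real_current a b (nu : 'I_4) (p : 'rV[R]_4) : R := \sum_mu sgn mu *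
  (a mu p * 'D_('e_nu) (b mu) p - a nu p * 'D_('e_mu) (b mu) p
   - 'D_('e_nu) (a mu) p * b mu p + 'D_('e_mu) (a mu) p * b nu p).

Definition combine (k : R) a (l : R) b : rfield := fun mu p => k * a mu p + l * b mu p.

Definition grad (z : 'rV[R]_4 -> R) : rfield := fun mu p => 'D_('e_mu) z p.

Lemma partial_combine n (f g : 'rV[R]_n -> R) (k l : R) i x : Ck 1 f -> Ck 1 g ->
  'D_('e_i) (fun y => k * f y + l * g y) x = k * 'D_('e_i) f x + l * 'D_('e_i) g x.
Proof.
move=> Cf Cg.
have df : derivable f x ('e_i) := CkS_derivable Cf.
have dg : derivable g x ('e_i) := CkS_derivable Cg.
by have [_ ->] := is_deriveD (is_deriveZ k (derivableP df)) (is_deriveZ l (derivableP dg)).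
Qed.

Lemma Ck_combine m n (f g : 'rV[R]_n -> R) (k l : R) : Ck m f -> Ck m g ->
  Ck m (fun y => k * f y + l * g y).
Proof. by move=> Cf Cg; apply: CkD; apply: CkM => //; exact: Ck_cst. Qed.

Lemma Ck_real_current k a b nu : (forall mu, Ck k.+1 (a mu)) ->
  (forall mu, Ck k.+1 (b mu)) -> Ck k (real_current a b nu).
Proof.
move=> Ca Cb; have Ca' mu := CkW (Ca mu); have Cb' mu := CkW (Cb mu).
apply: Ck_sum => mu _; apply: CkM; first exact: Ck_cst.
by apply: CkD; [apply: CkB; [apply: CkB|]|]; apply: CkM => //; exact: CkS_derive.
Qed.

Lemma real_current_anti a b nu p : real_current b a nu p = - real_current a b nu p.
Proof. by rewrite -sumrN; apply: eq_bigr => mu _; ring. Qed.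

Lemma real_current_combine a b c (k l : R) nu p :
  (forall mu, Ck 1 (b mu)) -> (forall mu, Ck 1 (c mu)) ->
  real_current a (combine k b l c) nu p =
  k * real_current a b nu p + l * real_current a c nu p.
Proof.
move=> Cb Cc; rewrite /real_current !mulr_sumr -big_split; apply: eq_bigr => mu _ /=.
rewrite /combine !partial_combine //.
move: (b mu p) (c mu p) (b nu p) (c nu p) (a mu p) (a nu p).
move: ('D_('e_nu) (b mu) p) ('D_('e_nu) (c mu) p) ('D_('e_mu) (b mu) p).
move: ('D_('e_mu) (c mu) p) ('D_('e_nu) (a mu) p) ('D_('e_mu) (a mu) p) (sgn mu).
by move=> *; ring.
Qed.

Lemma real_current_bound a b nu p (K L : R) :
  (forall mu, `|a mu p| <= K /\ forall nu, `|'D_('e_nu) (a mu) p| <= K) ->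
  (forall mu, `|b mu p| <= L /\ forall nu, `|'D_('e_nu) (b mu) p| <= L) ->
  `|real_current a b nu p| <= 16 * (K * L).
Proof.
move=> aK bL.
have prod x y : `|x| <= K -> `|y| <= L -> `|x * y| <= K * L.
  by move=> xK yL; rewrite normrM ler_pM.
have aK1 mu : `|a mu p| <= K by have [] := aK mu.
have aK2 mu nu' : `|'D_('e_nu') (a mu) p| <= K by have [_] := aK mu.
have bL1 mu : `|b mu p| <= L by have [] := bL mu.
have bL2 mu nu' : `|'D_('e_nu') (b mu) p| <= L by have [_] := bL mu.
have -> : 16 * (K * L) = \sum_(mu < 4) 4 * (K * L).
  by rewrite sumr_const card_ord -mulr_natr; ring.
apply: (le_trans (ler_norm_sum _ _ _)); apply: ler_sum => mu _.
rewrite normrM normr_sgn mul1r.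
rewrite (_ : 4 * (K * L) = K * L + K * L + K * L + K * L); last by ring.
do 3 (apply: (le_trans (ler_normD _ _)); rewrite ?normrN; apply: lerD; last exact: prod);
  exact: prod.
Qed.

(** Conservation of the current at one point, as an identity of finite sums: [Da i j] stands for d_i
    a_j and [Ha i j k] for d_i d_j a_k. Products of first derivatives cancel, partly after
    exchanging the indices; the remaining terms are the Maxwell equations of a and b contracted with
    b and a. *)
Lemma current_divergence_algebra (I : finType) (e : I -> R) (a b : I -> R)
    (Da Db : I -> I -> R) (Ha Hb : I -> I -> I -> R) :
  (forall i j k, Ha i j k = Ha j i k) -> (forall i j k, Hb i j k = Hb j i k) ->
  (forall k, \sum_i e i * (Ha i i k - Ha i k i) = 0) ->
  (forall k, \sum_i e i * (Hb i i k - Hb i k i) = 0) ->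
  \sum_n e n * (\sum_m e m *
    (Da n m * Db n m + a m * Hb n n m - (Da n n * Db m m + a n * Hb n m m)
     - (Ha n n m * b m + Da n m * Db n m) + (Ha n m m * b n + Da m m * Db n n))) = 0.
Proof.
move=> sa sb ma mb.
have swap (F : I -> I -> R) : \sum_n \sum_m F n m = \sum_n \sum_m F m n.
  exact: exchange_big.
pose T n m := e n * e m * (a m * Hb n n m - a n * Hb n m m
   - Ha n n m * b m + Ha n m m * b n + Da m m * Db n n - Da n n * Db m m).
rewrite (_ : \sum_n _ = \sum_n \sum_m T n m); last first.
  by apply: eq_bigr => n _; rewrite mulr_sumr; apply: eq_bigr => m _; rewrite /T; ring.
rewrite (_ : \sum_n _ = \sum_n \sum_m (e n * e m * (a m * Hb n n m - Ha n n m * b m)) +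
  \sum_n \sum_m (e n * e m * (Ha n m m * b n - a n * Hb n m m)) +
  (\sum_n \sum_m (e n * e m * (Da m m * Db n n)) - \sum_n \sum_m (e n * e m * (Da n n * Db m m)))); last first.
  rewrite -sumrB -!big_split; apply: eq_bigr => n _ /=.
  by rewrite -sumrB -!big_split; apply: eq_bigr => m _ /=; rewrite /T; ring.
rewrite (swap (fun n m => e n * e m * (Da n n * Db m m))).
rewrite (swap (fun n m => e n * e m * (a m * Hb n n m - Ha n n m * b m))).
rewrite [X in _ + (_ - X)](eq_bigr (fun n => \sum_m e n * e m * (Da m m * Db n n))).
  rewrite subrr addr0 -big_split; apply: big1 => k _ /=.
  have := congr1 (fun t => e k * b k * t) (ma k).
  have := congr1 (fun t => e k * a k * t) (mb k); rewrite !mulr0 => hb ha.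
  transitivity (e k * a k * (\sum_i e i * (Hb i i k - Hb i k i)) -
      e k * b k * (\sum_i e i * (Ha i i k - Ha i k i))); last by rewrite ha hb subrr.
  rewrite -big_split !mulr_sumr -sumrB /=.
  by apply: eq_bigr => m _; rewrite (sa k m m) (sb k m m); ring.
by move=> n _; apply: eq_bigr => m _; rewrite (mulrC (e m)).
Qed.

Lemma real_maxwellE a nu p : (forall mu, Ck 2 (a mu)) -> real_maxwell a ->
  \sum_mu sgn mu * ('D_('e_mu) ('D_('e_mu) (a nu)) p - 'D_('e_mu) ('D_('e_nu) (a mu)) p) = 0.
Proof.
move=> Ca ma; rewrite -[RHS](ma nu p); apply: eq_bigr => mu _; congr (_ * _).
have d1 : derivable ('D_('e_mu) (a nu)) p ('e_mu) := CkS_derivable (CkS_derive mu (Ca nu)).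
have d2 : derivable ('D_('e_nu) (a mu)) p ('e_mu) := CkS_derivable (CkS_derive nu (Ca mu)).
by rewrite (deriveB d1 d2).
Qed.

Lemma partial_real_current a b nu lam p : (forall mu, Ck 2 (a mu)) ->
  (forall mu, Ck 2 (b mu)) ->
  'D_('e_lam) (real_current a b nu) p = \sum_m sgn m *
    ('D_('e_lam) (a m) p * 'D_('e_nu) (b m) p + a m p * 'D_('e_lam) ('D_('e_nu) (b m)) p
     - ('D_('e_lam) (a nu) p * 'D_('e_m) (b m) p + a nu p * 'D_('e_lam) ('D_('e_m) (b m)) p)
     - ('D_('e_lam) ('D_('e_nu) (a m)) p * b m p + 'D_('e_nu) (a m) p * 'D_('e_lam) (b m) p)
     + ('D_('e_lam) ('D_('e_m) (a m)) p * b nu p + 'D_('e_m) (a m) p * 'D_('e_lam) (b nu) p)).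
Proof.
move=> Ca Cb; have Ca' mu := CkW (Ca mu); have Cb' mu := CkW (Cb mu).
have Ca1 mu i := CkS_derive i (Ca mu); have Cb1 mu i := CkS_derive i (Cb mu).
have D f g : Ck 1 f -> Ck 1 g -> is_derive p ('e_lam) (fun q => f q * g q)
    ('D_('e_lam) f p * g p + f p * 'D_('e_lam) g p).
  move=> Cf Cg; rewrite -partialM //; apply: derivableP.
  have Cfg := CkM Cf Cg; exact: CkS_derivable Cfg.
have H m := is_deriveZ (sgn m) (is_deriveD (is_deriveB (is_deriveB
  (D _ _ (Ca' m) (Cb1 m nu)) (D _ _ (Ca' nu) (Cb1 m m)))
  (D _ _ (Ca1 m nu) (Cb' m))) (D _ _ (Ca1 m m) (Cb' nu))).
have [_ <-] := is_derive_sum H; congr ('D_('e_lam) _ p); apply/funext => q.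
by rewrite fct_sumE.
Qed.

Lemma real_current_conserved a b p : (forall mu, Ck 2 (a mu)) -> (forall mu, Ck 2 (b mu)) ->
  real_maxwell a -> real_maxwell b ->
  'D_('e_0) (real_current a b 0) p = \sum_(i < 3) 'D_('e_(sp i)) (real_current a b (sp i)) p.
Proof.
move=> Ca Cb ma mb; apply/eqP; rewrite -subr_eq0 -sumrN; apply/eqP.
have := @current_divergence_algebra _ sgn (a ^~ p) (b ^~ p)
  (fun i j => 'D_('e_i) (a j) p) (fun i j => 'D_('e_i) (b j) p)
  (fun i j k => 'D_('e_i) ('D_('e_j) (a k)) p) (fun i j k => 'D_('e_i) ('D_('e_j) (b k)) p)
  (fun i j k => partialC p i j (Ca k)) (fun i j k => partialC p i j (Cb k))
  (fun k => real_maxwellE k p Ca ma) (fun k => real_maxwellE k p Cb mb).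
rewrite (eq_bigr (fun n => sgn n * 'D_('e_n) (real_current a b n) p)); last first.
  by move=> n _; rewrite partial_real_current.
rewrite big_ord_recl {1}/sgn eqxx mul1r => H; rewrite -[RHS]H; congr (_ + _).
by apply: eq_bigr => i _; rewrite sgn_space mulN1r.
Qed.

Lemma weighted_sum_combine (I : finType) (e u v w : I -> R) (k l : R) :
  (forall i, w i = k * u i + l * v i) -> \sum_i e i * u i = 0 ->
  \sum_i e i * v i = 0 -> \sum_i e i * w i = 0.
Proof.
move=> E hu hv; transitivity (k * (\sum_i e i * u i) + l * (\sum_i e i * v i)).
  by rewrite !mulr_sumr -big_split; apply: eq_bigr => i _ /=; rewrite E; ring.
by rewrite hu hv !mulr0 addr0.
Qed.

Lemma real_maxwell_combine a b (k l : R) : (forall mu, Ck 2 (a mu)) ->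
  (forall mu, Ck 2 (b mu)) -> real_maxwell a -> real_maxwell b ->
  real_maxwell (combine k a l b).
Proof.
move=> Ca Cb ma mb nu p.
pose F c (mu : 'I_4) q := 'D_('e_mu) (c nu) q - 'D_('e_nu) (c mu) q : R.
have CF c mu : (forall mu, Ck 2 (c mu)) -> Ck 1 (F c mu).
  by move=> Cc; apply: CkB; exact: CkS_derive.
have E mu : 'D_('e_mu) (F (combine k a l b) mu) p =
    k * 'D_('e_mu) (F a mu) p + l * 'D_('e_mu) (F b mu) p.
  rewrite -partial_combine; [|exact: CF|exact: CF].
  congr ('D_('e_mu) _ p); apply/funext => q.
  by rewrite /F /combine !partial_combine; try exact: CkW; rewrite !mulrBr opprD addrACA.
have ha : \sum_mu sgn mu * 'D_('e_mu) (F a mu) p = 0 := ma nu p.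
have hb : \sum_mu sgn mu * 'D_('e_mu) (F b mu) p = 0 := mb nu p.
exact: (weighted_sum_combine E ha hb).
Qed.

Lemma real_maxwell_grad z : Ck 2 z -> real_maxwell (grad z).
Proof.
move=> Cz nu p; apply: big1 => mu _.
rewrite (_ : (fun q => _) = cst 0) ?derive_cst ?mulr0 //.
by apply/funext => q; rewrite /grad (partialC q mu nu Cz) subrr.
Qed.

End real_current.

(** * Reduction of the scalar product to real fields *)

Section pairing.
Context {R : realType}.
Notation "''e_' i" := (delta_mx 0 i) (format "''e_' i").
Notation sp i := (lift (0 : 'I_4) (i : 'I_3)).
Notation rfield := ('I_4 -> 'rV[R]_4 -> R).
Implicit Types (a b c : rfield) (S : set 'rV[R]_4).

Lemma decaying_combine S S' a b (k l : R) :
  (forall mu, Ck 1 (a mu)) -> (forall mu, Ck 1 (b mu)) ->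
  decaying S S' a -> decaying S S' b -> decaying S S' (combine k a l b).
Proof.
move=> Ca Cb [K K0 aK] [L L0 bL]; exists (`|k| * K + `|l| * L).
  by rewrite addr_ge0 // mulr_ge0.
move=> t x tx mu.
have B (u v : R) : `|u| <= K / (1 + `|x|) ^+ 2 -> `|v| <= L / (1 + `|x|) ^+ 2 ->
    `|k * u + l * v| <= (`|k| * K + `|l| * L) / (1 + `|x|) ^+ 2.
  move=> uK vL; rewrite mulrDl -!mulrA (le_trans (ler_normD _ _)) // !normrM.
  by apply: lerD; apply: ler_wpM2l.
have [a1 a2] := aK t x tx mu; have [b1 b2] := bL t x tx mu.
by split=> [|nu]; [|rewrite /combine partial_combine //]; apply: B.
Qed.

Lemma decaying_left S S' a : decaying S S' a -> decaying S S a.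
Proof.
move=> [K K0 aK]; exists K => // t x; rewrite minxx maxxx -eq_le => /eqP <- mu.
by apply: aK; rewrite ge_min le_max lexx.
Qed.

Lemma decaying_sym S S' a : decaying S S' a -> decaying S' S a.
Proof.
by move=> [K K0 aK]; exists K => // t x; rewrite minC maxC; exact: aK.
Qed.

Lemma decaying_real_current S S' a b : decaying S S' a -> decaying S S' b ->
  exists2 K, 0 <= K & forall nu (t : R) (x : 'rV[R]_3),
    Num.min (height S x) (height S' x) <= t <= Num.max (height S x) (height S' x) ->
    `|real_current a b nu (event t x)| <= K / (1 + `|x|) ^+ 4.
Proof.
move=> [K K0 aK] [L L0 bL]; exists (16 * (K * L)); first by rewrite !mulr_ge0.
move=> nu t x tx.
have n0 : 1 + `|x| != 0 by rewrite gt_eqF // norm_rV1_gt0.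
have -> : 16 * (K * L) / (1 + `|x|) ^+ 4 =
    16 * (K / (1 + `|x|) ^+ 2 * (L / (1 + `|x|) ^+ 2)).
  by move: (1 + `|x|) n0 => r n0; field.
by apply: real_current_bound => mu; [exact: aK|exact: bL].
Qed.

Lemma flux_combine h (j j' : rfield) (k l : R) x :
  flux h (combine k j l j') x = k * flux h j x + l * flux h j' x.
Proof.
rewrite /flux !mulrDr !mulr_sumr addrACA -big_split; congr (_ + _).
apply: eq_bigr => i _ /=; rewrite /combine; move: ('D_('e_i) h x) => d; ring.
Qed.

Lemma integral_flux_combine h (j j' : rfield) (k l : R) :
  space_integrable (flux h j) -> space_integrable (flux h j') ->
  space_integral (flux h (combine k j l j')) =
  k * space_integral (flux h j) + l * space_integral (flux h j').
Proof.
move=> i i'; rewrite -!space_integralZ // -space_integralD; try exact: space_integrableZ.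
by congr space_integral; apply/funext => x; exact: flux_combine.
Qed.

Definition pairing S a b := space_integral (flux (height S) (real_current a b)).

Lemma integrable_pairing S a b : spacelike_cauchy_surface S ->
  (forall mu, Ck 1 (a mu)) -> (forall mu, Ck 1 (b mu)) ->
  decaying S S a -> decaying S S b ->
  space_integrable (flux (height S) (real_current a b)).
Proof.
move=> cS Ca Cb da db; have [_ Ch _] := cS.
have [K K0 HK] := decaying_real_current da db.
apply: (@space_integrable_bounded _ _ (4 * K)).
  apply: continuous_flux; first exact: CkW Ch.
  by move=> mu; apply: (@Ck_continuous _ _ 0); exact: Ck_real_current.
move=> x; rewrite -mulrA; apply: flux_bound => [i|mu].
  exact: partial_height_le1.
by apply: HK; rewrite minxx maxxx lexx.
Qed.

Lemma pairing_anti S a b : spacelike_cauchy_surface S ->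
  (forall mu, Ck 1 (a mu)) -> (forall mu, Ck 1 (b mu)) ->
  decaying S S a -> decaying S S b -> pairing S b a = - pairing S a b.
Proof.
move=> cS Ca Cb da db.
have iab := integrable_pairing cS Ca Cb da db.
rewrite /pairing (_ : real_current b a = combine (-1) (real_current a b) 0 (real_current a b)).
  by rewrite integral_flux_combine // mul0r addr0 mulN1r.
by apply/funext => nu; apply/funext => p; rewrite real_current_anti /combine mul0r addr0 mulN1r.
Qed.

Lemma pairing_combine S a b c (k l : R) : spacelike_cauchy_surface S ->
  (forall mu, Ck 1 (a mu)) -> (forall mu, Ck 1 (b mu)) -> (forall mu, Ck 1 (c mu)) ->
  decaying S S a -> decaying S S b -> decaying S S c ->
  pairing S a (combine k b l c) = k * pairing S a b + l * pairing S a c.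
Proof.
move=> cS Ca Cb Cc da db dc.
have ib := integrable_pairing cS Ca Cb da db.
have ic := integrable_pairing cS Ca Cc da dc.
rewrite /pairing -integral_flux_combine //; congr (space_integral (flux _ _)).
by apply/funext => nu; apply/funext => p; rewrite real_current_combine.
Qed.

Lemma pairing_surface_independent S S' a b : spacelike_cauchy_surface S ->
  spacelike_cauchy_surface S' ->
  (forall mu, Ck 2 (a mu)) -> (forall mu, Ck 2 (b mu)) ->
  real_maxwell a -> real_maxwell b -> decaying S S' a -> decaying S S' b ->
  pairing S' a b = pairing S a b.
Proof.
move=> cS cS' Ca Cb ma mb da db.
have [_ Ch _] := cS; have [_ Ch' _] := cS'.
have [K K0 HK] := decaying_real_current da db.
apply: (flux_surface_independent K0 _ Ch Ch').
- by move=> mu; exact: Ck_real_current.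
- by move=> p; exact: real_current_conserved.
- exact: partial_height_le1.
- exact: partial_height_le1.
- by move=> mu t x; exact: HK.
Qed.

End pairing.

Section complex_fields.
Context {R : realType}.
Notation "''e_' i" := (delta_mx 0 i) (format "''e_' i").
Notation sp i := (lift (0 : 'I_4) (i : 'I_3)).
Implicit Types (A B : field4 R) (S : set 'rV[R]_4).
Local Open Scope complex_scope.

Lemma sum_complex (I : Type) (r : seq I) (u v : I -> R) :
  \sum_(i <- r) (u i +i* v i) = (\sum_(i <- r) u i) +i* (\sum_(i <- r) v i).
Proof. by elim: r => [|i r IH]; rewrite ?big_nil // !big_cons IH. Qed.

Lemma raiseE (w : 'I_4 -> R[i]) mu : raise w mu = (sgn mu)%:C * w mu.
Proof.
rewrite /raise (bigD1 mu) //= big1 ?addr0 => [|nu nm].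
  by rewrite /Defs.eta eqxx.
by rewrite /Defs.eta eq_sym (negPf nm) mul0r.
Qed.

Definition C1_field A := forall mu, CkC 1 (A mu).

Lemma complexE (z : R[i]) : z = complex.Re z +i* complex.Im z.
Proof. by case: z. Qed.

Lemma currentE A B nu p : C1_field A -> C1_field B ->
  current A B nu p =
    (real_current (re_field A) (re_field B) nu p + real_current (im_field A) (im_field B) nu p) +i*
    (real_current (re_field A) (im_field B) nu p - real_current (im_field A) (re_field B) nu p).
Proof.
move=> CA CB.
have pU mu i : partial i (fun q => raise (fun rho => B rho q) mu) p =
    (sgn mu * 'D_('e_i) (re_field B mu) p) +i* (sgn mu * 'D_('e_i) (im_field B mu) p).
  have [C1 C2] := CB mu; rewrite /partial.
  have D (f : 'rV[R]_4 -> R) : Ck 1 f -> 'D_('e_i) (fun q => sgn mu * f q) p = sgn mu * 'D_('e_i) f p.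
    move=> Cf; have df : derivable f p ('e_i) := CkS_derivable Cf.
    by have [_ ->] := is_deriveZ (sgn mu) (derivableP df).
  rewrite -(D _ C1) -(D _ C2); congr ('D_('e_i) _ p +i* 'D_('e_i) _ p); apply/funext => q;
    rewrite raiseE /re_field /im_field (complexE (B mu q)) /=; ring.
have pC mu i : partial i (fun q => conjc (A mu q)) p =
    'D_('e_i) (re_field A mu) p +i* (- 'D_('e_i) (im_field A mu) p).
  have [C1 C2] := CA mu; rewrite /partial.
  have df : derivable (im_field A mu) p ('e_i) := CkS_derivable C2.
  rewrite -(deriveN df); congr ('D_('e_i) _ p +i* 'D_('e_i) _ p); apply/funext => q;
    by rewrite ?fctE /re_field /im_field /=; case: (A mu q).
rewrite /current /= /real_current -big_split -sumrB -sum_complex; apply: eq_bigr => mu _.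
rewrite pU pU pC /partial_up !raiseE pC /=.
rewrite (complexE (A mu p)) (complexE (A nu p)) (complexE (B mu p)) (complexE (B nu p)).
rewrite -/(re_field A mu p) -/(re_field A nu p) -/(re_field B mu p) -/(re_field B nu p).
rewrite -/(im_field A mu p) -/(im_field A nu p) -/(im_field B mu p) -/(im_field B nu p).
move: ('D_('e_nu) (re_field B mu) p) ('D_('e_nu) (im_field B mu) p).
move: ('D_('e_mu) (re_field B mu) p) ('D_('e_mu) (im_field B mu) p).
move: ('D_('e_nu) (re_field A mu) p) ('D_('e_nu) (im_field A mu) p).
move: ('D_('e_mu) (re_field A mu) p) ('D_('e_mu) (im_field A mu) p).
move: (re_field A mu p) (re_field A nu p) (re_field B mu p) (re_field B nu p).
move: (im_field A mu p) (im_field A nu p) (im_field B mu p) (im_field B nu p) (sgn mu).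
by move=> s *; apply/eqP; rewrite eq_complex /=; apply/andP; split; apply/eqP; ring.
Qed.

Lemma surface_integral_flux S (J : 'I_4 -> 'rV[R]_4 -> R[i]) : spacelike_cauchy_surface S ->
  surface_integral S (fun x => \sum_nu (normal S x 0 nu)%:C * J nu (chart S x)) =
  space_integral (flux (height S) (re_field J)) +i* space_integral (flux (height S) (im_field J)).
Proof.
move=> cS.
have E x : \sum_nu (normal S x 0 nu)%:C * J nu (chart S x) =
    (\sum_nu normal S x 0 nu * re_field J nu (chart S x)) +i*
    (\sum_nu normal S x 0 nu * im_field J nu (chart S x)).
  rewrite -sum_complex; apply: eq_bigr => nu _; rewrite /re_field /im_field.
  by case: (J nu _) => u v /=; apply/eqP; rewrite eq_complex /= !mul0r subr0 addr0 !eqxx.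
by congr (_ +i* _); congr space_integral; apply/funext => x; rewrite E /= normal_volume.
Qed.

Lemma scalar_productE S A B : spacelike_cauchy_surface S -> C1_field A -> C1_field B ->
  decaying S S (re_field A) -> decaying S S (im_field A) ->
  decaying S S (re_field B) -> decaying S S (im_field B) ->
  scalar_product S A B =
    (pairing S (re_field A) (im_field B) - pairing S (im_field A) (re_field B)) +i*
    (- (pairing S (re_field A) (re_field B) + pairing S (im_field A) (im_field B))).
Proof.
move=> cS CA CB da da' db db'.
have Ca mu : Ck 1 (re_field A mu) by have [] := CA mu.
have Ca' mu : Ck 1 (im_field A mu) by have [] := CA mu.
have Cb mu : Ck 1 (re_field B mu) by have [] := CB mu.
have Cb' mu : Ck 1 (im_field B mu) by have [] := CB mu.
have i1 := integrable_pairing cS Ca Cb da db.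
have i2 := integrable_pairing cS Ca' Cb' da' db'.
have i3 := integrable_pairing cS Ca Cb' da db'.
have i4 := integrable_pairing cS Ca' Cb da' db.
rewrite /scalar_product surface_integral_flux //.
have -> : re_field (current A B) = combine 1 (real_current (re_field A) (re_field B))
    1 (real_current (im_field A) (im_field B)).
  apply/funext => nu; apply/funext => p.
  by rewrite {1}/re_field currentE // /combine !mul1r.
have -> : im_field (current A B) = combine 1 (real_current (re_field A) (im_field B))
    (-1) (real_current (im_field A) (re_field B)).
  apply/funext => nu; apply/funext => p.
  by rewrite {1}/im_field currentE // /combine mul1r mulN1r.
rewrite (integral_flux_combine 1 1 i1 i2) (integral_flux_combine 1 (-1) i3 i4).
have alg (u v w z : R) : - 'i%C * ((1 * u + 1 * v) +i* (1 * w + -1 * z)) =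
    (w - z) +i* (- (u + v)).
  by apply/eqP; rewrite eq_complex /=; apply/andP; split; apply/eqP; ring.
exact: alg.
Qed.

End complex_fields.

(** * Gauge invariance *)

Section limit_at_infinity.
Context {R : realType}.
Notation "''e_' i" := (delta_mx 0 i) (format "''e_' i").
Implicit Types (u : 'rV[R]_3 -> R) (K r : R) (x y : 'rV[R]_3).

(** K / (1 + t)^2 is minus the derivative of K / (1 + t), so adding this barrier to u gives a
    nonincreasing function on the axis. Applied to -u as well, it confines u between monotone
    barriers. *)
Lemma radial_monotone u K : Ck 1 u ->
  (forall i x, `|'D_('e_i) u x| <= K / (1 + `|x|) ^+ 2) ->
  forall s t, 0 <= s -> s <= t ->
  u (t *: 'e_0) + K / (1 + t) <= u (s *: 'e_0) + K / (1 + s).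
Proof.
move=> Cu uK s t s0; rewrite le_eqVlt => /orP[/eqP -> //|st].
have K0 : 0 <= K.
  have := le_trans (normr_ge0 _) (uK 0 0).
  by rewrite normr0 addr0 expr1n divr1.
have du y : derivable u y ('e_0) := CkS_derivable Cu.
have Du (c : R) : is_derive c 1 (fun c : R => u (c *: 'e_0)) ('D_('e_0) u (c *: 'e_0)).
  have := @is_derive_line R _ u 0 ('e_0) c; rewrite add0r => H.
  by under eq_fun do rewrite -[X in u X]add0r; apply: H.
have Dinv (c : R) : 0 <= c -> is_derive c 1 (fun c : R => K / (1 + c)) (- K / (1 + c) ^+ 2).
  move=> c0; have n0 : 1 + c != 0 by rewrite gt_eqF // ltr_pwDl.
  have D1 : is_derive c 1 (fun c : R => 1 + c) 1.
    by have := is_deriveD (is_derive_cst (1 : R) c 1) (is_derive_id c 1); rewrite add0r.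
  have := is_deriveZ K (is_deriveV n0 D1); move/is_derive_eq; apply.
  by rewrite /GRing.scale /= mulr1 -exprVn mulrN mulNr.
pose f (c : R) := u (c *: 'e_0) + K / (1 + c).
have Df (c : R) : 0 <= c -> is_derive c 1 f ('D_('e_0) u (c *: 'e_0) - K / (1 + c) ^+ 2).
  by move=> c0; have := is_deriveD (Du c) (Dinv c c0); rewrite mulNr.
have [||c /andP[sc _] e] := @MVT R f (fun c => 'D_('e_0) u (c *: 'e_0) - K / (1 + c) ^+ 2) s t st.
- by move=> c /andP[sc _]; apply: Df; apply: le_trans s0 (ltW sc).
- apply: derivable_within_continuous => c /andP[sc _].
  by have [] := Df c (le_trans s0 sc).
rewrite -/(f t) -/(f s) -subr_le0 e.
have c0 : 0 <= c by apply: le_trans s0 (ltW sc).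
rewrite mulr_le0_ge0 ?subr_ge0 ?(ltW st) // subr_le0.
apply: le_trans (ler_norm _) _; apply: (le_trans (uK 0 _)).
apply: ler_wpM2l => //; rewrite lef_pV2 ?posrE ?exprn_gt0 ?norm_rV1_gt0 ?ltr_pwDl //.
apply: lerXn2r; rewrite ?nnegrE ?addr_ge0 // lerD2l.
have := ler_coord_norm (c *: ('e_0 : 'rV[R]_3)) 0; rewrite !mxE !eqxx mulr1.
exact: le_trans (ler_norm _).
Qed.

(** The shared coordinate i keeps the segment outside the open sup-norm ball of radius r, where each
    partial derivative is at most K / (1 + r)^2. Each of the 3 coordinates varies by at most 2 r,
    whence 6. *)
Lemma segment_variation u K r (i : 'I_3) x y : Ck 1 u ->
  (forall i x, `|'D_('e_i) u x| <= K / (1 + `|x|) ^+ 2) ->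
  x 0 i = y 0 i -> r <= `|x 0 i| -> `|x| <= r -> `|y| <= r ->
  `|u y - u x| <= 6 * K / (1 + r).
Proof.
move=> Cu uK xy rx xr yr.
have r0 : 0 <= r := le_trans (normr_ge0 x) xr.
have K0 : 0 <= K.
  have := le_trans (normr_ge0 _) (uK 0 0).
  by rewrite normr0 addr0 expr1n divr1.
pose v := y - x.
have dv z : derivable u z v := diff_derivable (C1_differentiable z Cu).
have D (s : R) := @is_derive_line R _ u x v s.
have [||c _] := @MVT R (fun s => u (x + s *: v)) (fun s => 'D_v u (x + s *: v)) 0 1 ltr01.
- by move=> s _; exact: D (dv _).
- apply: derivable_within_continuous => s _.
  by have [] := D s (dv _).
have xv : x + v = y by rewrite addrC subrK.
rewrite scale1r scale0r addr0 xv subr0 mulr1 => ->.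
rewrite derive_sum_coord //.
have rz : r <= `|x + c *: v|.
  apply: le_trans rx _; apply: le_trans (ler_coord_norm _ i).
  by rewrite !mxE xy subrr mulr0 addr0.
have p1 : 0 < 1 + r by rewrite ltr_pwDl.
have pz : 0 < 1 + `|x + c *: v| by rewrite norm_rV1_gt0.
have Dz k : `|'D_('e_k) u (x + c *: v)| <= K / (1 + r) ^+ 2.
  apply: (le_trans (uK k _)); apply: ler_wpM2l => //.
  rewrite lef_pV2 ?posrE ?exprn_gt0 //.
  by apply: lerXn2r; rewrite ?nnegrE ?(ltW p1) ?(ltW pz) // lerD2l.
have vk k : `|v 0 k| <= 2 * r.
  apply: (le_trans (ler_coord_norm _ _)); apply: (le_trans (ler_normB _ _)).
  by rewrite mulr2n mulrDl mul1r lerD.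
apply: (le_trans (ler_norm_sum _ _ _)).
apply: (@le_trans _ _ (\sum_(k < 3) 2 * r * (K / (1 + r) ^+ 2))).
  by apply: ler_sum => k _; rewrite normrM ler_pM.
rewrite sumr_const card_ord (_ : _ *+ 3 = 6 * K * r / (1 + r) ^+ 2); last by ring.
rewrite (_ : 6 * K / (1 + r) = 6 * K * (1 + r) / (1 + r) ^+ 2); last first.
  by field; rewrite gt_eqF.
rewrite ler_pM2r ?invr_gt0 ?exprn_gt0 //; apply: ler_wpM2l; first exact: mulr_ge0.
by rewrite lerDr.
Qed.

Lemma norm_attained x : exists i, `|x 0 i| = `|x|.
Proof.
have [i _ H] := @Order.TotalTheory.arg_maxP _ _ 'I_3 0 xpredT (fun i => `|x 0 i|) isT.
exists i; apply/eqP; rewrite eq_le ler_coord_norm /=; apply: rV_norm_le => // j.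
exact: H.
Qed.

(* Three segments, each with a coordinate of absolute value |x| held fixed, join
   two points of the sphere without entering the ball. *)
Lemma sphere_variation u K x y : Ck 1 u ->
  (forall i x, `|'D_('e_i) u x| <= K / (1 + `|x|) ^+ 2) -> `|x| = `|y| ->
  `|u y - u x| <= 18 * K / (1 + `|x|).
Proof.
move=> Cu uK xy; set r := `|x|; have r0 : 0 <= r := normr_ge0 x.
have [i xi] := norm_attained x; have [j yj] := norm_attained y.
have [k ki kj] : exists2 k : 'I_3, k != i & k != j.
  have /set0Pn[k] : ~: [set i; j] != finset.set0.
    by rewrite -card_gt0 cardsCs finset.setCK card_ord cards2; case: (i != j).
  by rewrite !inE negb_or => /andP[ki kj]; exists k.
(* On the path x, w x i, w y j, y the fixed coordinates are i, k, j in turn. The auxiliary k,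
   different from both i and j, carries the value r on the middle segment. *)
pose w (z : 'rV[R]_3) (l : 'I_3) : 'rV[R]_3 :=
  \row_m if m == l then z 0 l else if m == k then r else 0.
have wn z l : `|z| <= r -> `|w z l| <= r.
  move=> zr; apply: rV_norm_le => [|m]; first exact: r0.
  rewrite mxE; case: ifP => _.
    exact: le_trans (ler_coord_norm _ _) zr.
  by case: ifP => _; rewrite ?normr0 // ger0_norm.
have yr : `|y| <= r by rewrite /r xy.
have wl z l : w z l 0 l = z 0 l by rewrite mxE eqxx.
have wk z l : k != l -> w z l 0 k = r by move=> kl; rewrite mxE (negPf kl) eqxx.
have s1 : `|u (w x i) - u x| <= 6 * K / (1 + r).
  by apply: (@segment_variation _ _ _ i) => //; rewrite ?wl ?xi //; exact: wn.
have s2 : `|u (w y j) - u (w x i)| <= 6 * K / (1 + r).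
  by apply: (@segment_variation _ _ _ k) => //; rewrite ?wk //; try exact: wn;
    rewrite ?ger0_norm.
have s3 : `|u y - u (w y j)| <= 6 * K / (1 + r).
  by apply: (@segment_variation _ _ _ j) => //; rewrite ?wl ?yj ?(wn _ _ yr) // /r xy.
rewrite (_ : u y - u x = (u y - u (w y j)) + (u (w y j) - u (w x i)) + (u (w x i) - u x)); last by ring.
rewrite (_ : 18 * K / (1 + r) = 6 * K / (1 + r) + 6 * K / (1 + r) + 6 * K / (1 + r)); last by ring.
apply: (le_trans (ler_normD _ _)); apply: lerD s1.
by apply: (le_trans (ler_normD _ _)); exact: lerD.
Qed.

(** The limit is taken along one axis, as the supremum of the nondecreasing lower barriers; the
    sphere estimate carries it to all directions. The constant 19 is 18 for the sphere plus 1 for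
    the axis. *)
Lemma limit_at_infinity u K : Ck 1 u ->
  (forall i x, `|'D_('e_i) u x| <= K / (1 + `|x|) ^+ 2) ->
  exists c, forall x, `|u x - c| <= 19 * K / (1 + `|x|).
Proof.
move=> Cu uK; pose v s := u (s *: 'e_0).
have K0 : 0 <= K.
  have := le_trans (normr_ge0 _) (uK 0 0).
  by rewrite normr0 addr0 expr1n divr1.
have up := radial_monotone Cu uK.
have lo (s t : R) : 0 <= s -> s <= t -> v s - K / (1 + s) <= v t - K / (1 + t).
  move=> s0 st; have NuK i x : `|'D_('e_i) (fun y => - u y) x| <= K / (1 + `|x|) ^+ 2.
    have du : derivable u x ('e_i) := CkS_derivable Cu.
    by rewrite (deriveN du) normrN.
  by have := radial_monotone (CkN Cu) NuK s0 st; rewrite /v; lra.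
have Kp (s : R) : 0 <= s -> 0 <= K / (1 + s) by move=> s0; rewrite divr_ge0 ?addr_ge0.
have lu (s t : R) : 0 <= s -> 0 <= t -> v s - K / (1 + s) <= v t + K / (1 + t).
  move=> s0 t0; pose m := Num.max s t.
  have m0 : 0 <= m by rewrite le_max s0.
  have sm : s <= m by rewrite le_max lexx.
  have tm : t <= m by rewrite le_max lexx orbT.
  by have := lo s m s0 sm; have := up t m t0 tm; have := Kp m m0; rewrite /v; lra.
pose E := [set v s - K / (1 + s) | s in [set s | 0 <= s]].
have E0 : E !=set0 by exists (v 0 - K / (1 + 0)); exists 0 => //=.
have Eub t : 0 <= t -> ubound E (v t + K / (1 + t)).
  by move=> t0 _ [s /= s0 <-]; exact: lu.
exists (sup E) => x.
have r0 : 0 <= `|x| by [].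
have h1 : v `|x| - K / (1 + `|x|) <= sup E.
  apply: ub_le_sup; last by exists `|x|.
  by exists (v 0 + K / (1 + 0)); exact: Eub.
have h2 : sup E <= v `|x| + K / (1 + `|x|) by apply: ge_sup => //; exact: Eub.
have nx : `|x| = `|(`|x| *: 'e_0) : 'rV[R]_3|.
  apply/eqP; rewrite eq_le; apply/andP; split.
    have := ler_coord_norm (`|x| *: ('e_0 : 'rV[R]_3)) 0.
    by rewrite !mxE !eqxx mulr1 normr_id.
  apply: rV_norm_le => // k; rewrite !mxE eqxx /= normrM normr_id.
  by case: (k == 0); rewrite ?normr1 ?normr0 ?mulr1 ?mulr0.
have := sphere_variation Cu uK nx; rewrite -/(v _).
rewrite (_ : 19 * K / (1 + `|x|) = 18 * K / (1 + `|x|) + K / (1 + `|x|)); last by ring.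
move: (18 * K / (1 + `|x|)) h1 h2 => q h1 h2; rewrite !ler_norml => /andP[? ?].
by apply/andP; split; lra.
Qed.

End limit_at_infinity.

(** * The current of a pure gauge field as the divergence of a superpotential *)

Section gauge_invariance.
Context {R : realType}.
Notation "''e_' i" := (delta_mx 0 i) (format "''e_' i").
Notation sp i := (lift (0 : 'I_4) (i : 'I_3)).
Notation rfield := ('I_4 -> 'rV[R]_4 -> R).
Implicit Types (a : rfield) (z : 'rV[R]_4 -> R) (c : R).

Definition superpotential a z c (mu nu : 'I_4) (p : 'rV[R]_4) : R :=
  a mu p * 'D_('e_nu) z p - a nu p * 'D_('e_mu) z p
  + ('D_('e_mu) (a nu) p - 'D_('e_nu) (a mu) p) * (z p - c).

Lemma superpotential_anti a z c mu nu p :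
  superpotential a z c nu mu p = - superpotential a z c mu nu p.
Proof.
rewrite /superpotential.
move: ('D_('e_nu) (a mu) p) ('D_('e_mu) (a nu) p) ('D_('e_mu) z p) ('D_('e_nu) z p).
by move=> s t u v; ring.
Qed.

Lemma Ck_superpotential a z c mu nu : (forall mu, Ck 2 (a mu)) -> Ck 2 z ->
  Ck 1 (superpotential a z c mu nu).
Proof.
move=> Ca Cz; have Ca' k := CkW (Ca k); have Cz' := CkW Cz.
have CF := CkB (CkS_derive mu (Ca nu)) (CkS_derive nu (Ca mu)).
exact: (CkD (CkB (CkM (Ca' mu) (CkS_derive nu Cz)) (CkM (Ca' nu) (CkS_derive mu Cz)))
  (CkM CF (CkB Cz' (Ck_cst 1 c)))).
Qed.

Lemma partial_superpotential a z c mu nu lam p : (forall mu, Ck 2 (a mu)) -> Ck 2 z ->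
  'D_('e_lam) (superpotential a z c mu nu) p =
  ('D_('e_lam) (a mu) p * 'D_('e_nu) z p + a mu p * 'D_('e_lam) ('D_('e_nu) z) p)
  - ('D_('e_lam) (a nu) p * 'D_('e_mu) z p + a nu p * 'D_('e_lam) ('D_('e_mu) z) p)
  + (('D_('e_lam) ('D_('e_mu) (a nu)) p - 'D_('e_lam) ('D_('e_nu) (a mu)) p) * (z p - c)
     + ('D_('e_mu) (a nu) p - 'D_('e_nu) (a mu) p) * 'D_('e_lam) z p).
Proof.
move=> Ca Cz; have Ca' k := CkW (Ca k); have Cz' := CkW Cz.
have Ca1 k i := CkS_derive i (Ca k); have Cz1 i := CkS_derive i Cz.
have D (f : 'rV[R]_4 -> R) : Ck 1 f -> is_derive p ('e_lam) f ('D_('e_lam) f p).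
  by move=> Cf; apply: derivableP; exact: CkS_derivable Cf.
have DM (f g : 'rV[R]_4 -> R) : Ck 1 f -> Ck 1 g -> is_derive p ('e_lam) (fun q => f q * g q)
    ('D_('e_lam) f p * g p + f p * 'D_('e_lam) g p).
  by move=> Cf Cg; rewrite -partialM //; apply: D; exact: CkM.
have CF : Ck 1 (fun q => 'D_('e_mu) (a nu) q - 'D_('e_nu) (a mu) q) by exact: CkB.
have Czc : Ck 1 (fun q => z q - c) by apply: CkB => //; exact: Ck_cst.
have [_ H] := is_deriveD (is_deriveB (DM _ _ (Ca' mu) (Cz1 nu)) (DM _ _ (Ca' nu) (Cz1 mu)))
  (DM _ _ CF Czc).
rewrite [LHS]H; congr (_ + (_ * _ + _ * _)).
  by have [_ ->] := is_deriveB (D _ (Ca1 nu mu)) (D _ (Ca1 mu nu)).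
have [_ ->] := is_deriveB (D _ Cz') (is_derive_cst c p ('e_lam)).
by rewrite subr0.
Qed.

(** The divergence of the superpotential exceeds the current only by the Maxwell expression of a
    times z - c, which vanishes whatever c is. This leaves c free to be chosen for decay. *)
Lemma real_current_grad a z c nu p : (forall mu, Ck 2 (a mu)) -> Ck 2 z -> real_maxwell a ->
  real_current a (grad z) nu p =
  \sum_mu sgn mu * 'D_('e_mu) (superpotential a z c mu nu) p.
Proof.
move=> Ca Cz ma; have := real_maxwellE nu p Ca ma => /(congr1 (fun t => t * (z p - c))).
rewrite mul0r mulr_suml => M.
transitivity (real_current a (grad z) nu p + \sum_mu sgn mu *
  ('D_('e_mu) ('D_('e_mu) (a nu)) p - 'D_('e_mu) ('D_('e_nu) (a mu)) p) * (z p - c)).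
  by rewrite M addr0.
rewrite -big_split; apply: eq_bigr => mu _ /=.
rewrite partial_superpotential // /grad (partialC p nu mu Cz).
move: ('D_('e_mu) ('D_('e_nu) z) p) ('D_('e_mu) ('D_('e_mu) z) p).
move: ('D_('e_mu) (a nu) p) ('D_('e_nu) (a mu) p) ('D_('e_mu) z p) ('D_('e_nu) z p).
move: ('D_('e_mu) ('D_('e_mu) (a nu)) p) ('D_('e_mu) ('D_('e_nu) (a mu)) p) ('D_('e_mu) (a mu) p).
by move=> *; ring.
Qed.

Lemma sum_sgn (F : 'I_4 -> R) : \sum_mu sgn mu * F mu = F 0 - \sum_k F (sp k).
Proof.
rewrite big_ord_recl {1}/sgn eqxx mul1r -sumrN; congr (_ + _).
by apply: eq_bigr => k _; rewrite sgn_space mulN1r.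
Qed.

Lemma sum_antisymmetric (I : finType) (F : I -> I -> R) :
  (forall i j, F j i = - F i j) -> \sum_i \sum_j F i j = 0.
Proof.
move=> anti; have h : \sum_i \sum_j F i j = - \sum_i \sum_j F i j.
  rewrite {1}exchange_big -sumrN; apply: eq_bigr => i _; rewrite -sumrN.
  by apply: eq_bigr => j _; rewrite anti.
lra.
Qed.

(** Here g and H play the gradient and the Hessian of the height. H and the products g_i g_k are
    symmetric, so their contractions with the antisymmetric P and T drop out. *)
Lemma divergence_algebra (I : finType) (g U V : I -> R) (H P T X : I -> I -> R) :
  (forall i j, H i j = H j i) -> (forall i j, P j i = - P i j) ->
  (forall i j, T j i = - T i j) ->
  \sum_k (- (g k * U k + V k) - \sum_i (H k i * P k i + g i * (g k * T k i + X k i))) =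
  - \sum_k V k + \sum_i g i * (- U i - \sum_k X k i).
Proof.
move=> sH aP aT.
have h1 : \sum_k \sum_i (H k i * P k i + g i * g k * T k i) = 0.
  apply: sum_antisymmetric => i j; rewrite (sH j i) (aP i j) (aT i j); ring.
have h2 : \sum_k \sum_i g i * X k i = \sum_i g i * \sum_k X k i.
  by rewrite exchange_big; apply: eq_bigr => i _; rewrite mulr_sumr.
transitivity (- \sum_k V k - \sum_k g k * U k - \sum_k \sum_i g i * X k i -
    \sum_k \sum_i (H k i * P k i + g i * g k * T k i)).
  rewrite -!sumrN -!big_split; apply: eq_bigr => k _ /=.
  have -> : \sum_i (H k i * P k i + g i * (g k * T k i + X k i)) =
      \sum_i g i * X k i + \sum_i (H k i * P k i + g i * g k * T k i).
    by rewrite -big_split; apply: eq_bigr => i _ /=; ring.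
  by ring.
rewrite h1 h2 subr0 -addrA -opprD -big_split /=; congr (_ + _).
by rewrite -sumrN; apply: eq_bigr => i _; ring.
Qed.

(** The superpotential contracted with the weighted normal (1, grad h); the minus signs raise the
    spatial index k. *)
Definition graph_superpotential h a z c (k : 'I_3) (x : 'rV[R]_3) : R :=
  - superpotential a z c (sp k) 0 (event (h x) x)
  - \sum_i 'D_('e_i) h x * superpotential a z c (sp k) (sp i) (event (h x) x).

Lemma Ck_graph_superpotential h a z c k : Ck 2 h -> (forall mu, Ck 2 (a mu)) -> Ck 2 z ->
  Ck 1 (graph_superpotential h a z c k).
Proof.
move=> Ch Ca Cz; have Ch' := CkW Ch.
have CG mu nu : Ck 1 (fun x => superpotential a z c mu nu (event (h x) x)).
  by apply: Ck_graph Ch'; exact: Ck_superpotential.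
apply: CkB; first exact: CkN.
by apply: Ck_sum => i _; apply: CkM => //; exact: CkS_derive.
Qed.

(** Differentiation along the graph also differentiates through the height, which gives the terms
    with time derivatives. What survives the symmetric cancellations is, by antisymmetry of G, the
    divergence of G in components 0 and i, weighted as in [flux]. *)
Lemma divergence_graph_superpotential h a z c x : Ck 2 h -> (forall mu, Ck 2 (a mu)) ->
  Ck 2 z -> real_maxwell a ->
  \sum_k 'D_('e_k) (graph_superpotential h a z c k) x = flux h (real_current a (grad z)) x.
Proof.
move=> Ch Ca Cz ma; have Ch' := CkW Ch.
set G := superpotential a z c; set p := event (h x) x.
have CG mu nu : Ck 1 (G mu nu) by exact: Ck_superpotential.
have G0 mu nu : 'D_('e_nu) (G mu mu) p = 0.
  rewrite (_ : G mu mu = cst 0) ?derive_cst //; apply/funext => q.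
  by rewrite /G /superpotential !subrr mul0r addr0.
have Ga lam mu nu : 'D_('e_lam) (G nu mu) p = - 'D_('e_lam) (G mu nu) p.
  have dG : derivable (G mu nu) p ('e_lam) := CkS_derivable (CG mu nu).
  rewrite -(deriveN dG); congr ('D_('e_lam) _ p); apply/funext => q.
  by rewrite /G superpotential_anti.
have DG mu nu k := is_derive_graph x k (CG mu nu) Ch'.
have Dh i k : is_derive x ('e_k) ('D_('e_i) h) ('D_('e_k) ('D_('e_i) h) x).
  by apply: derivableP; exact: CkS_derivable (CkS_derive i Ch).
have DW k : 'D_('e_k) (graph_superpotential h a z c k) x =
    - ('D_('e_k) h x * 'D_('e_0) (G (sp k) 0) p + 'D_('e_(sp k)) (G (sp k) 0) p)
    - \sum_i ('D_('e_k) ('D_('e_i) h) x * G (sp k) (sp i) p +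
        'D_('e_i) h x * ('D_('e_k) h x * 'D_('e_0) (G (sp k) (sp i)) p +
                        'D_('e_(sp k)) (G (sp k) (sp i)) p)).
  have DD i := is_deriveM (Dh i k) (DG (sp k) (sp i) k).
  have [_ H] := is_deriveB (is_deriveN (DG (sp k) 0 k)) (is_derive_sum DD).
  rewrite -/p in H.
  transitivity ('D_('e_k) ((- (fun y => G (sp k) 0 (event (h y) y))) -
    \sum_i ('D_('e_i) h * (fun y => G (sp k) (sp i) (event (h y) y)))) x).
    congr ('D_('e_k) _ x); apply/funext => y.
    by rewrite /graph_superpotential !fctE fct_sumE.
  rewrite H; congr (_ - _); apply: eq_bigr => i _.
  by rewrite /GRing.scale /= addrC; congr (_ + _); rewrite mulrC.
rewrite (eq_bigr _ (fun k _ => DW k)).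
rewrite (@divergence_algebra _ (fun k => 'D_('e_k) h x) (fun k => 'D_('e_0) (G (sp k) 0) p)
  (fun k => 'D_('e_(sp k)) (G (sp k) 0) p) (fun k i => 'D_('e_k) ('D_('e_i) h) x)
  (fun k i => G (sp k) (sp i) p) (fun k i => 'D_('e_0) (G (sp k) (sp i)) p)
  (fun k i => 'D_('e_(sp k)) (G (sp k) (sp i)) p)); first last.
- by move=> i j; exact: Ga.
- by move=> i j; exact: superpotential_anti.
- by move=> i j; exact: partialC Ch.
have RC nu : real_current a (grad z) nu p =
    'D_('e_0) (G 0 nu) p - \sum_k 'D_('e_(sp k)) (G (sp k) nu) p.
  exact: etrans (real_current_grad c nu p Ca Cz ma) (sum_sgn _).
rewrite /flux -/p; congr (_ + _).
  by rewrite [RHS]RC (G0 0 0) sub0r.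
by apply: eq_bigr => i _; rewrite [X in _ = _ * X]RC -(Ga 0 (sp i) 0).
Qed.

End gauge_invariance.

Section pairing_gauge.
Context {R : realType}.
Notation "''e_' i" := (delta_mx 0 i) (format "''e_' i").
Notation sp i := (lift (0 : 'I_4) (i : 'I_3)).
Notation rfield := ('I_4 -> 'rV[R]_4 -> R).
Implicit Types (a b : rfield) (z : 'rV[R]_4 -> R) (S : set 'rV[R]_4).

(** The two products of a with derivatives of z decay like r^-4 and are weakened to r^-3; the two
    products with z - c are of order r^-3 exactly. Hence 78 = 1 + 1 + 38 + 38. *)
Lemma superpotential_bound a z (c K L r : R) mu nu p : 1 <= r -> 0 <= K -> 0 <= L ->
  (forall mu, `|a mu p| <= K / r ^+ 2 /\ forall nu, `|'D_('e_nu) (a mu) p| <= K / r ^+ 2) ->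
  (forall mu, `|'D_('e_mu) z p| <= L / r ^+ 2) -> `|z p - c| <= 38 * L / r ->
  `|superpotential a z c mu nu p| <= 78 * (K * L) / r ^+ 3.
Proof.
move=> r1 K0 L0 aK zL zc.
have r0 : 0 < r by apply: lt_le_trans r1.
have q0 : 0 <= K * L / r ^+ 3 by rewrite !divr_ge0 ?mulr_ge0 ?exprn_ge0 ?(ltW r0).
have az (i j : 'I_4) : `|a i p * 'D_('e_j) z p| <= K * L / r ^+ 3.
  have [ai _] := aK i; rewrite normrM.
  apply: (le_trans (ler_pM (normr_ge0 _) (normr_ge0 _) ai (zL j))).
  rewrite [leLHS](_ : _ = K * L / r ^+ 3 * r^-1); last by field; rewrite gt_eqF.
  by rewrite ler_piMr // invf_le1.
have dz (i j : 'I_4) : `|'D_('e_j) (a i) p * (z p - c)| <= 38 * (K * L / r ^+ 3).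
  have [_ dai] := aK i; rewrite normrM.
  apply: (le_trans (ler_pM (normr_ge0 _) (normr_ge0 _) (dai j) zc)).
  by rewrite [leLHS](_ : _ = 38 * (K * L / r ^+ 3)) //; field; rewrite gt_eqF.
rewrite /superpotential mulrBl.
rewrite (_ : 78 * (K * L) / r ^+ 3 = K * L / r ^+ 3 + K * L / r ^+ 3 +
  (38 * (K * L / r ^+ 3) + 38 * (K * L / r ^+ 3))); last by ring.
apply: (le_trans (ler_normD _ _)); apply: lerD;
  by apply: (le_trans (ler_normB _ _)); apply: lerD.
Qed.

Lemma pairing_grad S a z : spacelike_cauchy_surface S -> (forall mu, Ck 2 (a mu)) ->
  Ck 2 z -> real_maxwell a -> decaying S S a -> decaying S S (grad z) ->
  pairing S a (grad z) = 0.
Proof.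
move=> cS Ca Cz ma da dz; have [_ Ch _] := cS; set h := height S in Ch *.
have Ch' := CkW Ch; have Cz' := CkW Cz.
have [M M0 HM] := decaying_real_current da dz.
have [K K0 aK] := da; have [L L0 zL] := dz.
have on_S x : Num.min (h x) (h x) <= h x <= Num.max (h x) (h x).
  by rewrite minxx maxxx lexx.
have {}aK x := aK (h x) x (on_S x).
have {}zL x mu : `|'D_('e_mu) z (event (h x) x)| <= L / (1 + `|x|) ^+ 2.
  by have [H _] := zL (h x) x (on_S x) mu.
have {}HM nu x := HM nu (h x) x (on_S x).
have h1 := partial_height_le1 cS.
(* The limit at infinity is taken for the restriction of z to the surface. Since the slopes of h are
   at most 1, the chain rule doubles L, and 38 = 19 times 2. *)
pose u x := z (event (h x) x).
have Du i x : `|'D_('e_i) u x| <= 2 * L / (1 + `|x|) ^+ 2.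
  have [_ ->] := is_derive_graph x i Cz' Ch'.
  apply: (le_trans (ler_normD _ _)).
  rewrite (_ : 2 * L / (1 + `|x|) ^+ 2 = 1 * (L / (1 + `|x|) ^+ 2) + L / (1 + `|x|) ^+ 2); last by ring.
  by rewrite normrM; apply: lerD => //; apply: ler_pM.
have [c Hc] := limit_at_infinity (Ck_graph Cz' Ch') Du.
have n1 (x : 'rV[R]_3) : 1 <= 1 + `|x| by rewrite lerDl.
have zc x : `|z (event (h x) x) - c| <= 38 * L / (1 + `|x|).
  by rewrite (_ : 38 * L = 19 * (2 * L)) //; ring.
have G x mu nu := superpotential_bound mu nu (n1 x) K0 L0 (aK x) (zL x) (zc x).
have KL : 0 <= K * L by exact: mulr_ge0.
(* One constant must serve both bounds: the cubic one on the superpotential and the fourth-power one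
   on its divergence, which is the flux of the current itself. *)
pose B := 4 * (78 * (K * L)) + 4 * M.
have B1 : 4 * (78 * (K * L)) <= B by rewrite lerDl mulr_ge0.
have B2 : 4 * M <= B by rewrite lerDr !mulr_ge0.
have B0 : 0 <= B by rewrite addr_ge0 // !mulr_ge0.
have E x := divergence_graph_superpotential c x Ch Ca Cz ma.
rewrite /pairing (_ : flux _ _ = fun x => \sum_k 'D_('e_k) (graph_superpotential h a z c k) x); last first.
  by apply/funext => x; rewrite E.
apply: (space_integral_divergence0 B0).
- by move=> k; exact: Ck_graph_superpotential.
- move=> k x; have r0 : 0 < 1 + `|x| := norm_rV1_gt0 x.
  apply: (@le_trans _ _ (4 * (78 * (K * L)) / (1 + `|x|) ^+ 3)); last first.
    by rewrite ler_pM2r // invr_gt0 exprn_gt0.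
  set q := 78 * (K * L) / (1 + `|x|) ^+ 3.
  rewrite (_ : _ / _ = q + \sum_(i < 3) q); last first.
    by rewrite sumr_const card_ord /q; ring.
  apply: (le_trans (ler_normB _ _)); rewrite normrN; apply: lerD; first exact: G.
  apply: (le_trans (ler_norm_sum _ _ _)); apply: ler_sum => i _.
  by rewrite normrM -[leRHS]mul1r; apply: ler_pM => //; exact: G.
- move=> x; have r0 : 0 < 1 + `|x| := norm_rV1_gt0 x.
  rewrite E; apply: (@le_trans _ _ (4 * M / (1 + `|x|) ^+ 4)); last first.
    by rewrite ler_pM2r // invr_gt0 exprn_gt0.
  by rewrite -mulrA; apply: flux_bound.
Qed.

(** Decay of [grad z] is not assumed but recovered from that of b and of the transformed field, of
    whose difference it is a multiple by the inverse of s. *)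
Lemma pairing_gauge S a b z (s : R) : s != 0 -> spacelike_cauchy_surface S ->
  (forall mu, Ck 2 (a mu)) -> (forall mu, Ck 2 (b mu)) -> Ck 3 z -> real_maxwell a ->
  decaying S S a -> decaying S S b -> decaying S S (combine 1 b (- s) (grad z)) ->
  pairing S a (combine 1 b (- s) (grad z)) = pairing S a b.
Proof.
move=> s0 cS Ca Cb Cz ma da db dg.
have Ca' mu := CkW (Ca mu); have Cb' mu := CkW (Cb mu).
have Cg mu : Ck 1 (grad z mu) by exact: CkW (CkS_derive mu Cz).
have dz : decaying S S (grad z).
  have -> : grad z = combine s^-1 b (- s^-1) (combine 1 b (- s) (grad z)).
    by apply/funext => mu; apply/funext => p; rewrite /combine; field.
  by apply: decaying_combine => // mu; exact: Ck_combine.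
rewrite pairing_combine // mul1r (pairing_grad cS Ca (CkW Cz) ma da dz).
by rewrite mulr0 addr0.
Qed.

End pairing_gauge.

(** * Sesquilinearity, gauge invariance and isotropic fields *)

Section solutions.
Context {R : realType}.
Notation "''e_' i" := (delta_mx 0 i) (format "''e_' i").
Notation rfield := ('I_4 -> 'rV[R]_4 -> R).
Implicit Types (A B : field4 R) (a b : rfield) (S : set 'rV[R]_4).
Local Open Scope complex_scope.

Lemma realC_mul (s x y : R) : s%:C * (x +i* y) = (s * x) +i* (s * y).
Proof. by apply/eqP; rewrite eq_complex /= !mul0r subr0 addr0 !eqxx. Qed.

Definition real_potential S S' a :=
  [/\ forall mu, Ck 2 (a mu), real_maxwell a & decaying S S' a].

Lemma maxwell_solutionE A : maxwell_solution A <->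
  [/\ forall mu, CkC 2 (A mu), real_maxwell (re_field A) & real_maxwell (im_field A)].
Proof.
have E nu p : \sum_mu partial_up mu
      (fun q => partial mu (A nu) q - partial nu (A mu) q) p =
    (\sum_mu sgn mu * 'D_('e_mu) (fun q => 'D_('e_mu) (re_field A nu) q - 'D_('e_nu) (re_field A mu) q) p) +i*
    (\sum_mu sgn mu * 'D_('e_mu) (fun q => 'D_('e_mu) (im_field A nu) q - 'D_('e_nu) (im_field A mu) q) p).
  rewrite -sum_complex; apply: eq_bigr => mu _; rewrite /partial_up raiseE.
  exact: realC_mul.
split=> [[CA mA]|[CA mr mi]].
  split=> [//|nu p|nu p].
    exact: etrans (esym (congr1 (@complex.Re R) (E nu p))) (congr1 (@complex.Re R) (mA nu p)).
  exact: etrans (esym (congr1 (@complex.Im R) (E nu p))) (congr1 (@complex.Im R) (mA nu p)).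
split=> [//|nu p].
exact: etrans (E nu p) (congr2 (@complex.Complex R) (mr nu p) (mi nu p)).
Qed.

Lemma solution_potentials S S' A : spacelike_cauchy_surface S ->
  spacelike_cauchy_surface S' ->
  maxwell_solution A -> falls_off S S' A ->
  real_potential S S' (re_field A) /\ real_potential S S' (im_field A).
Proof.
move=> [cS _ _] [cS' _ _] /maxwell_solutionE[CA mr mi] fA.
have C1A mu : CkC 1 (A mu) by have [C1 C2] := CA mu; split; exact: CkW.
have [dr di] := falls_off_decaying cS cS' C1A fA.
have Cr mu : Ck 2 (re_field A mu) by have [C _] := CA mu; exact: C.
have Ci mu : Ck 2 (im_field A mu) by have [_ C] := CA mu; exact: C.
by split; [exact: And3 Cr mr dr|exact: And3 Ci mi di].
Qed.

Lemma real_potential_pairing_anti S a b : spacelike_cauchy_surface S ->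
  real_potential S S a -> real_potential S S b -> pairing S b a = - pairing S a b.
Proof.
move=> cS [Ca _ da] [Cb _ db].
by apply: pairing_anti => // mu; exact: CkW.
Qed.

Lemma scalar_product_pairing S A B : spacelike_cauchy_surface S ->
  real_potential S S (re_field A) -> real_potential S S (im_field A) ->
  real_potential S S (re_field B) -> real_potential S S (im_field B) ->
  scalar_product S A B =
    (pairing S (re_field A) (im_field B) - pairing S (im_field A) (re_field B)) +i*
    (- (pairing S (re_field A) (re_field B) + pairing S (im_field A) (im_field B))).
Proof.
move=> cS [Ca _ da] [Ca' _ da'] [Cb _ db] [Cb' _ db'].
have CA : C1_field A := fun mu => conj (CkW (Ca mu)) (CkW (Ca' mu)).
have CB : C1_field B := fun mu => conj (CkW (Cb mu)) (CkW (Cb' mu)).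
exact: (scalar_productE cS CA CB da da' db db').
Qed.

Lemma real_potential_combine S S' a b (k l : R) :
  real_potential S S' a -> real_potential S S' b -> real_potential S S' (combine k a l b).
Proof.
move=> [Ca ma da] [Cb mb db]; split.
- by move=> mu; exact: Ck_combine.
- exact: real_maxwell_combine.
- by apply: decaying_combine => // mu; exact: CkW.
Qed.

Lemma pairing_potential_combine S a b c (k l : R) : spacelike_cauchy_surface S ->
  real_potential S S a -> real_potential S S b -> real_potential S S c ->
  pairing S a (combine k b l c) = k * pairing S a b + l * pairing S a c.
Proof.
move=> cS [Ca _ da] [Cb _ db] [Cc _ dc].
by apply: pairing_combine => // mu; exact: CkW.
Qed.

Lemma scalar_product_hermitian S A B : spacelike_cauchy_surface S ->
  real_potential S S (re_field A) -> real_potential S S (im_field A) ->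
  real_potential S S (re_field B) -> real_potential S S (im_field B) ->
  scalar_product S B A = conjc (scalar_product S A B).
Proof.
move=> cS a a' b b'; rewrite !scalar_product_pairing //.
rewrite (real_potential_pairing_anti cS a b') (real_potential_pairing_anti cS a' b).
rewrite (real_potential_pairing_anti cS a b) (real_potential_pairing_anti cS a' b').
move: (pairing _ _ _) (pairing _ _ _) (pairing _ _ _) (pairing _ _ _) => u v w z.
by apply/eqP; rewrite eq_complex /=; apply/andP; split; apply/eqP; ring.
Qed.

Lemma re_field_lincomb (al be : R[i]) A B : re_field (lincomb al A be B) =
  combine 1 (combine (complex.Re al) (re_field A) (- complex.Im al) (im_field A))
          1 (combine (complex.Re be) (re_field B) (- complex.Im be) (im_field B)).
Proof.
apply/funext => mu; apply/funext => p; rewrite /re_field /im_field /combine /lincomb.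
by case: al be (A mu p) (B mu p) => [? ?] [? ?] [? ?] [? ?] /=; ring.
Qed.

Lemma im_field_lincomb (al be : R[i]) A B : im_field (lincomb al A be B) =
  combine 1 (combine (complex.Im al) (re_field A) (complex.Re al) (im_field A))
          1 (combine (complex.Im be) (re_field B) (complex.Re be) (im_field B)).
Proof.
apply/funext => mu; apply/funext => p; rewrite /re_field /im_field /combine /lincomb.
by case: al be (A mu p) (B mu p) => [? ?] [? ?] [? ?] [? ?] /=; ring.
Qed.

Lemma lincomb_potentials S S' (al be : R[i]) A B :
  real_potential S S' (re_field A) -> real_potential S S' (im_field A) ->
  real_potential S S' (re_field B) -> real_potential S S' (im_field B) ->
  real_potential S S' (re_field (lincomb al A be B)) /\
  real_potential S S' (im_field (lincomb al A be B)).
Proof.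
move=> a a' b b'; rewrite re_field_lincomb im_field_lincomb.
by split; do !apply: real_potential_combine.
Qed.

Lemma scalar_product_linear_right S (al be : R[i]) A B B' : spacelike_cauchy_surface S ->
  real_potential S S (re_field A) -> real_potential S S (im_field A) ->
  real_potential S S (re_field B) -> real_potential S S (im_field B) ->
  real_potential S S (re_field B') -> real_potential S S (im_field B') ->
  scalar_product S A (lincomb al B be B') =
  al * scalar_product S A B + be * scalar_product S A B'.
Proof.
move=> cS a a' b b' c c'.
have [l l'] := lincomb_potentials al be b b' c c'.
rewrite !scalar_product_pairing // re_field_lincomb im_field_lincomb.
have q d (k1 k2 k3 k4 : R) : real_potential S S d ->
    pairing S d (combine 1 (combine k1 (re_field B) k2 (im_field B))
                         1 (combine k3 (re_field B') k4 (im_field B'))) =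
    1 * (k1 * pairing S d (re_field B) + k2 * pairing S d (im_field B)) +
    1 * (k3 * pairing S d (re_field B') + k4 * pairing S d (im_field B')).
  move=> pd; have pb := real_potential_combine k1 k2 b b'.
  have pc := real_potential_combine k3 k4 c c'.
  by rewrite (pairing_potential_combine 1 1 cS pd pb pc)
    (pairing_potential_combine k1 k2 cS pd b b') (pairing_potential_combine k3 k4 cS pd c c').
rewrite !(q _ _ _ _ _ a) !(q _ _ _ _ _ a').
move: (pairing _ _ _) (pairing _ _ _) (pairing _ _ _) (pairing _ _ _) => q1 q2 q3 q4.
move: (pairing _ _ _) (pairing _ _ _) (pairing _ _ _) (pairing _ _ _) => q5 q6 q7 q8.
case: al be {l l'} => [? ?] [? ?].
by apply/eqP; rewrite eq_complex /=; apply/andP; split; apply/eqP; ring.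
Qed.

Lemma real_potential_left S S' a : real_potential S S' a -> real_potential S S a.
Proof. by move=> [Ca ma da]; split=> //; exact: decaying_left da. Qed.

Lemma real_potential_sym S S' a : real_potential S S' a -> real_potential S' S a.
Proof. by move=> [Ca ma da]; split=> //; exact: decaying_sym da. Qed.

Lemma scalar_product_surface_independent S S' A B : spacelike_cauchy_surface S ->
  spacelike_cauchy_surface S' ->
  real_potential S S' (re_field A) -> real_potential S S' (im_field A) ->
  real_potential S S' (re_field B) -> real_potential S S' (im_field B) ->
  scalar_product S' A B = scalar_product S A B.
Proof.
move=> cS cS' a a' b b'.
have left c := @real_potential_left S S' c.
have right c (h : real_potential S S' c) := real_potential_left (real_potential_sym h).
rewrite (scalar_product_pairing cS' (right _ a) (right _ a') (right _ b) (right _ b')).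
rewrite (scalar_product_pairing cS (left _ a) (left _ a') (left _ b) (left _ b')).
have E c d : real_potential S S' c -> real_potential S S' d -> pairing S' c d = pairing S c d.
  by move=> [Cc mc dc] [Cd md dd]; exact: pairing_surface_independent.
by rewrite (E _ _ a b') (E _ _ a' b) (E _ _ a b) (E _ _ a' b').
Qed.

Lemma re_field_gauge (e : R) theta A : re_field (gauge e theta A) =
  combine 1 (re_field A) (- e^-1) (grad (fun p => complex.Re (theta p))).
Proof.
apply/funext => mu; apply/funext => p; rewrite /re_field /combine /gauge /partial /grad.
by case: (A mu p) => ? ? /=; ring.
Qed.

Lemma im_field_gauge (e : R) theta A : im_field (gauge e theta A) =
  combine 1 (im_field A) (- e^-1) (grad (fun p => complex.Im (theta p))).
Proof.
apply/funext => mu; apply/funext => p; rewrite /im_field /combine /gauge /partial /grad.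
by case: (A mu p) => ? ? /=; ring.
Qed.

Lemma maxwell_solution_gauge (e : R) theta A : CkC 3 theta -> maxwell_solution A ->
  maxwell_solution (gauge e theta A).
Proof.
move=> [Ct Ct'] /maxwell_solutionE[CA mr mi].
have Cr mu : Ck 2 (re_field A mu) by have [C _] := CA mu; exact: C.
have Ci mu : Ck 2 (im_field A mu) by have [_ C] := CA mu; exact: C.
apply/maxwell_solutionE; rewrite re_field_gauge im_field_gauge; split.
- move=> mu; split.
    have -> : (fun p => complex.Re (gauge e theta A mu p)) = re_field (gauge e theta A) mu by [].
    by rewrite re_field_gauge; apply: Ck_combine => //; exact: CkS_derive.
  have -> : (fun p => complex.Im (gauge e theta A mu p)) = im_field (gauge e theta A) mu by [].
  by rewrite im_field_gauge; apply: Ck_combine => //; exact: CkS_derive.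
- have Cg mu : Ck 2 (grad (fun p => complex.Re (theta p)) mu) := CkS_derive mu Ct.
  exact: (real_maxwell_combine _ _ Cr Cg mr (real_maxwell_grad (CkW Ct))).
- have Cg mu : Ck 2 (grad (fun p => complex.Im (theta p)) mu) := CkS_derive mu Ct'.
  exact: (real_maxwell_combine _ _ Ci Cg mi (real_maxwell_grad (CkW Ct'))).
Qed.

Lemma scalar_product_gauge_right S A B (e : R) zeta : e != 0 ->
  spacelike_cauchy_surface S -> CkC 3 zeta ->
  real_potential S S (re_field A) -> real_potential S S (im_field A) ->
  real_potential S S (re_field B) -> real_potential S S (im_field B) ->
  real_potential S S (re_field (gauge e zeta B)) ->
  real_potential S S (im_field (gauge e zeta B)) ->
  scalar_product S A (gauge e zeta B) = scalar_product S A B.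
Proof.
move=> e0 cS [Cz Cz'] a a' b b' g g'; rewrite !scalar_product_pairing //.
have E c d z : real_potential S S c -> real_potential S S d -> Ck 3 z ->
    real_potential S S (combine 1 d (- e^-1) (grad z)) ->
    pairing S c (combine 1 d (- e^-1) (grad z)) = pairing S c d.
  move=> [Cc mc dc] [Cd _ dd] C3z [_ _ dg].
  by apply: pairing_gauge => //; rewrite invr_eq0.
rewrite re_field_gauge in g *; rewrite im_field_gauge in g' *.
by rewrite (E _ _ _ a b' Cz' g') (E _ _ _ a' b Cz g) (E _ _ _ a b Cz g) (E _ _ _ a' b' Cz' g').
Qed.

(* Its gradient is a real pure gauge field that falls off on every surface. *)
Definition gaussian (p : 'rV[R]_4) : R := expR (- \sum_i p 0 i ^+ 2).

Lemma is_derive_of_line (V : normedModType R) (g : V -> R) (p v : V) (d : R) :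
  is_derive (0 : R) 1 (fun s : R => g (p + s *: v)) d -> is_derive p v g d.
Proof.
move=> [D1 D2].
have E : (fun h : R => h^-1 *: (g (p + (h *: (1 : R) + 0) *: v) - g (p + (0 : R) *: v))) =
         (fun h : R => h^-1 *: (g (h *: v + p) - g p)).
  apply/funext => h; rewrite addr0 scale0r addr0 (_ : h *: (1 : R) = h) 1?(addrC p) //.
  exact: mulr1.
by split; [move: D1; rewrite /derivable /= E|move: D2; rewrite /derive /= E].
Qed.

Lemma is_derive_gaussian (mu : 'I_4) p :
  is_derive p ('e_mu) gaussian (-2 * (p 0 mu * gaussian p)).
Proof.
apply: is_derive_of_line.
have E : (fun s : R => gaussian (p + s *: 'e_mu)) =
    (fun s : R => expR (- (\sum_i p 0 i ^+ 2 + s * (2 * p 0 mu + s)))).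
  apply/funext => s; rewrite /gaussian; congr (expR (- _)).
  rewrite (bigD1 mu) //= [in RHS](bigD1 mu) //= (eq_bigr (fun i => p 0 i ^+ 2)).
    by rewrite !mxE !eqxx /= mulr1; ring.
  by move=> i /negPf im; rewrite !mxE im andbF mulr0 addr0.
rewrite E.
have D : is_derive (0 : R) 1 (fun s : R => - (\sum_i p 0 i ^+ 2 + s * (2 * p 0 mu + s))) (- (2 * p 0 mu)).
  apply: is_derive_quadratic_remainder => h.
  rewrite (_ : _ - _ = - h ^+ 2); last by ring.
  by rewrite normrN ger0_norm ?sqr_ge0.
have := is_derive1_comp (is_derive_expR _) D; move/is_derive_eq; apply.
by rewrite mul0r addr0 /GRing.scale /= -/(gaussian p); ring.
Qed.

Lemma Ck_gaussian k : Ck k gaussian.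
Proof.
elim: k => [|k IH].
  split=> //; have C : Ck 1 (fun p : 'rV[R]_4 => - \sum_i p 0 i ^+ 2).
    apply: CkN; apply: Ck_sum => i _; under eq_fun do rewrite expr2.
    by apply: CkM; exact: Ck_coord.
  exact: continuous_compose (Ck_continuous C) (@continuous_expR R).
split; first exact: (Ck_continuous IH).
move=> mu; split=> [p|]; first by have [] := is_derive_gaussian mu p.
under eq_fun => p do have [_ ->] := is_derive_gaussian mu p.
by apply: CkM; [exact: Ck_cst|apply: CkM => //; exact: Ck_coord].
Qed.

(** Both the weight and (1 + |x|)^2 are bounded by affine functions of q, and exp q >= (1 + q / 2)^2
    absorbs their product. With 32 the coefficients of q^2 on the two sides match. *)
Lemma gaussian_weight_bound (p : 'rV[R]_4) (w : R) : let q := \sum_i p 0 i ^+ 2 in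
  `|w| <= 4 * q + 2 -> forall x : 'rV[R]_3, `|x| ^+ 2 <= q ->
  `|w * gaussian p| <= 32 / (1 + `|x|) ^+ 2.
Proof.
move=> q wq x xq.
have q0 : 0 <= q by apply: sumr_ge0 => i _; exact: sqr_ge0.
have e0 : 0 < gaussian p := expR_gt0 _.
have eq1 : (1 + q / 2) ^+ 2 * gaussian p <= 1.
  have e1 : 1 + q / 2 <= expR (q / 2) by exact: expR_ge1Dx.
  have e2 : (1 + q / 2) ^+ 2 <= expR q.
    rewrite [in leRHS](_ : q = q / 2 + q / 2); last by field.
    rewrite expRD -expr2; apply: lerXn2r; rewrite ?nnegrE ?expR_ge0 //.
    by rewrite addr_ge0 // divr_ge0.
  have e3 : expR q * gaussian p = 1 by rewrite /gaussian -expRD subrr expR0.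
  by rewrite -[leRHS]e3 ler_pM2r.
have n0 : 0 < (1 + `|x|) ^+ 2 by rewrite exprn_gt0 // norm_rV1_gt0.
have nq : (1 + `|x|) ^+ 2 <= 2 * (1 + q).
  by have := sqr_ge0 (1 - `|x|); move: xq; rewrite sqrrB sqrrD; nra.
rewrite normrM (gtr0_norm e0) ler_pdivlMr //.
have g1 : `|w| * gaussian p <= (4 * q + 2) * gaussian p by rewrite ler_pM2r.
have : (4 * q + 2) * (2 * (1 + q)) <= 32 * (1 + q / 2) ^+ 2 by nra.
have s1 : `|w| * gaussian p * (1 + `|x|) ^+ 2 <= (4 * q + 2) * gaussian p * (2 * (1 + q)).
  by apply: ler_pM => //; rewrite mulr_ge0 // ltW.
by move=> /(ler_wpM2r (ltW e0)); lra.
Qed.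

(** The weights of the first and second derivatives are -2 p_mu and -2 delta + 4 p_mu p_nu, both at
    most 4 q + 2 in absolute value. The bound holds at every event, so on any pair of surfaces. *)
Lemma gaussian_decaying S S' : decaying S S' (grad gaussian).
Proof.
exists 32 => // t x _ mu; set p := event t x.
have xp : `|x| ^+ 2 <= \sum_i p 0 i ^+ 2.
  have [i <-] := norm_attained x; rewrite real_normK ?num_real // -(event_space t).
  by rewrite (bigD1 (lift 0 i)) //= lerDl sumr_ge0 // => j _; exact: sqr_ge0.
have sq (i : 'I_4) : p 0 i ^+ 2 <= \sum_i p 0 i ^+ 2.
  by rewrite (bigD1 i) //= lerDl sumr_ge0 // => j _; exact: sqr_ge0.
have gradE (nu : 'I_4) : grad gaussian nu = fun q => -2 * (q 0 nu * gaussian q).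
  by apply/funext => q; rewrite /grad; have [_ ->] := is_derive_gaussian nu q.
split=> [|nu].
  rewrite gradE mulrA; apply: gaussian_weight_bound xp.
  have := sq mu; move: (\sum_i _) (p 0 mu) => q s h.
  have := sqr_ge0 (1 - s); have := sqr_ge0 (1 + s); rewrite ler_norml => ? ?.
  by apply/andP; split; nra.
have [_ Dg] := is_derive_gaussian nu p.
have C1 : Ck 1 (fun q : 'rV[R]_4 => q 0 mu) := Ck_coord 1 mu.
have Cc : Ck 1 (fun q : 'rV[R]_4 => -2 * q 0 mu) := CkM (Ck_cst 1 (-2)) C1.
have -> : grad gaussian mu = fun q => (-2 * q 0 mu) * gaussian q.
  by rewrite gradE; apply/funext => q; rewrite mulrA.
rewrite (partialM nu p Cc (Ck_gaussian 1)) Dg.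
have -> : 'D_('e_nu) (fun q : 'rV[R]_4 => -2 * q 0 mu) p = -2 * ('e_nu : 'rV[R]_4) 0 mu.
  by have [_ ->] := is_deriveZ (-2) (is_derive_coord mu p ('e_nu)).
rewrite (_ : _ + _ = (-2 * ('e_nu : 'rV[R]_4) 0 mu + 4 * (p 0 mu * p 0 nu)) * gaussian p); last by ring.
apply: gaussian_weight_bound xp.
have := sq mu; have := sq nu; move: (\sum_i _) (p 0 mu) (p 0 nu) => q s r h1 h2.
have := sqr_ge0 (s - r); have := sqr_ge0 (s + r); rewrite !mxE eqxx ler_norml => ? ?.
by case: (mu == nu) => /=; apply/andP; split; nra.
Qed.

Lemma not_positive_definite S : spacelike_cauchy_surface S -> ~ positive_definite_on S.
Proof.
move=> cS pd.
pose A : field4 R := fun mu p => (grad gaussian mu p)%:C.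
have reA : re_field A = grad gaussian by [].
have imA : im_field A = fun _ _ => 0 by [].
have C2 mu : Ck 2 (grad gaussian mu) := CkS_derive mu (Ck_gaussian 3).
have m0 : real_maxwell (fun _ _ => 0 : R).
  rewrite (_ : (fun _ _ => 0) = grad (fun _ => 0)).
    exact: real_maxwell_grad (Ck_cst 2 0).
  by apply/funext => mu; apply/funext => p; rewrite /grad derive_cst.
have mA : maxwell_solution A.
  apply/maxwell_solutionE; rewrite reA imA; split=> [mu||//].
    by split; [exact: C2|exact: Ck_cst].
  exact: real_maxwell_grad (Ck_gaussian 2).
have [K K0 HK] := gaussian_decaying S S.
have pz (mu nu : 'I_4) p : partial nu (A mu) p = ('D_('e_nu) (grad gaussian mu) p)%:C.
  by rewrite /partial /= derive_cst.
have nR (r : R) : `|r%:C| = (`|r|)%:C :> R[i].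
  by rewrite normc_def /= expr0n /= addr0 sqrtr_sqr.
have fA : falls_off S S A.
  right; exists K => t x tx mu; have [h1 h2] := HK t x tx mu.
  by split=> [|nu]; rewrite ?pz nR lecR.
have nz : exists mu p, A mu p != 0.
  exists 0, ('e_0); rewrite /A /grad; have [_ ->] := is_derive_gaussian 0 ('e_0).
  rewrite mxE !eqxx mul1r eq_complex /= negb_and mulf_eq0 oppr_eq0 pnatr_eq0 /=.
  by rewrite gt_eqF // expR_gt0.
have [a a'] := solution_potentials cS cS mA fA.
(* The imaginary part is the zero field; writing it as 0 times itself plus 0 times itself lets
   linearity of [pairing] give 0. *)
have z r : real_potential S S r -> pairing S r (im_field A) = 0.
  move=> pr; have E : im_field A = combine 0 (im_field A) 0 (im_field A).
    by apply/funext => mu; apply/funext => p; rewrite /combine !mul0r addr0.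
  by rewrite E (pairing_potential_combine 0 0 cS pr a' a') !mul0r addr0.
have aa : pairing S (re_field A) (re_field A) = 0.
  by have := real_potential_pairing_anti cS a a; lra.
have := pd A mA fA nz; rewrite scalar_product_pairing //.
rewrite (real_potential_pairing_anti cS a a') (z _ a) (z _ a') aa.
by rewrite !(oppr0, addr0, subrr) ltxx.
Qed.

End solutions.

Theorem proposition8 (R : realType) (e_x : R) (e_x_neq0 : e_x != 0) :
  (* not positive definite *)
  (forall S : set 'rV[R]_4, spacelike_cauchy_surface S ->
     ~ positive_definite_on S) /\
  (* (i) sesquilinear and Hermitian *)
  (forall S : set 'rV[R]_4, spacelike_cauchy_surface S ->
     [/\ forall (a b : R[i]) (A B B' : field4 R),
           maxwell_solution A -> maxwell_solution B -> maxwell_solution B' ->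
           falls_off S S A -> falls_off S S B -> falls_off S S B' ->
           scalar_product S A (lincomb a B b B') =
             a * scalar_product S A B + b * scalar_product S A B',
         forall (a b : R[i]) (A A' B : field4 R),
           maxwell_solution A -> maxwell_solution A' -> maxwell_solution B ->
           falls_off S S A -> falls_off S S A' -> falls_off S S B ->
           scalar_product S (lincomb a A b A') B =
             conjc a * scalar_product S A B + conjc b * scalar_product S A' B &
         forall A B : field4 R,
           maxwell_solution A -> maxwell_solution B ->
           falls_off S S A -> falls_off S S B ->
           scalar_product S B A = conjc (scalar_product S A B)]) /\
  (* (ii) independent of the Cauchy surface *)
  (forall S S' : set 'rV[R]_4,
     spacelike_cauchy_surface S -> spacelike_cauchy_surface S' ->
     forall A B : field4 R,
       maxwell_solution A -> maxwell_solution B ->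
       falls_off S S' A -> falls_off S S' B ->
       scalar_product S' A B = scalar_product S A B) /\
  (* (iii) gauge invariant *)
  (forall S : set 'rV[R]_4, spacelike_cauchy_surface S ->
     forall (A B : field4 R) (theta zeta : 'rV[R]_4 -> R[i]),
       maxwell_solution A -> maxwell_solution B ->
       CkC 3 theta -> CkC 3 zeta ->
       falls_off S S A -> falls_off S S B ->
       falls_off S S (gauge e_x theta A) -> falls_off S S (gauge e_x zeta B) ->
       scalar_product S (gauge e_x theta A) (gauge e_x zeta B) =
         scalar_product S A B).
Proof.
split; [|split; [|split]].
- by move=> S cS; exact: not_positive_definite.
- move=> S cS; split.
  + move=> a b A B B' mA mB mB' fA fB fB'.
    have [Ar Ai] := solution_potentials cS cS mA fA; have [Br Bi] := solution_potentials cS cS mB fB.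
    have [Br' Bi'] := solution_potentials cS cS mB' fB'.
    exact: scalar_product_linear_right.
  + move=> a b A A' B mA mA' mB fA fA' fB.
    have [Ar Ai] := solution_potentials cS cS mA fA; have [Br Bi] := solution_potentials cS cS mB fB.
    have [Ar' Ai'] := solution_potentials cS cS mA' fA'.
    have [lr li] := lincomb_potentials a b Ar Ai Ar' Ai'.
    (* Antilinearity on the left is linearity on the right transported by Hermitian symmetry. *)
    rewrite (scalar_product_hermitian cS Br Bi lr li).
    rewrite (scalar_product_linear_right a b cS Br Bi Ar Ai Ar' Ai').
    rewrite (scalar_product_hermitian cS Br Bi Ar Ai) (scalar_product_hermitian cS Br Bi Ar' Ai').
    move: (scalar_product S B A) (scalar_product S B A') => u v.
    by rewrite rmorphD !rmorphM.
  + move=> A B mA mB fA fB.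
    have [Ar Ai] := solution_potentials cS cS mA fA; have [Br Bi] := solution_potentials cS cS mB fB.
    exact: scalar_product_hermitian.
- move=> S S' cS cS' A B mA mB fA fB.
  have [Ar Ai] := solution_potentials cS cS' mA fA; have [Br Bi] := solution_potentials cS cS' mB fB.
  exact: scalar_product_surface_independent.
- move=> S cS A B theta zeta mA mB Ct Cz fA fB fgA fgB.
  have [Ar Ai] := solution_potentials cS cS mA fA; have [Br Bi] := solution_potentials cS cS mB fB.
  have [gr gi] := solution_potentials cS cS (maxwell_solution_gauge e_x Ct mA) fgA.
  have [hr hi] := solution_potentials cS cS (maxwell_solution_gauge e_x Cz mB) fgB.
  (* The right argument is transformed first, while the left one is already the transformed field,
     itself a solution that falls off. Hermitian symmetry then brings the left argument to the
     right. *)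
  rewrite (scalar_product_gauge_right e_x_neq0 cS Cz gr gi Br Bi hr hi).
  rewrite (scalar_product_hermitian cS Br Bi gr gi).
  rewrite (scalar_product_gauge_right e_x_neq0 cS Ct Br Bi Ar Ai gr gi).
  by rewrite -(scalar_product_hermitian cS Br Bi Ar Ai).
Qed.
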